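(* Let $\Omega\subset\mathbb R^N$ be a polyhedral bounded open set and let $\mathcal T$ be a regular triangulation of $\overline\Omega$ with positive constants $s$ and $h$. (i) Let $q$ be a real number such that $q>N/2$. Then there exists a constant $\tilde C(q)$, depending on $q$ only, such that for any $u\in W^{2,q}(\Omega,\mathbb R^{M_1})$ we have $$\|u-\Pi_{\mathcal T}(u)\|_{L^q(\Omega)}\le\tilde C(q)h^2\|D^2u\|_{L^q(\Omega)}\quad\text{and}\quad\|\nabla(u-\Pi_{\mathcal T}(u))\|_{L^q(\Omega)}\le\tilde C(q)\,s\,h\,\|D^2u\|_{L^q(\Omega)}.$$ (ii) There exists a constant $C$, depending on $s$ only, such that for any $u\in C^2(\overline\Omega,\mathbb R^{M_1})$ we have $$|\Pi_{\mathcal T}(u)|_{W^{1,\infty}(\Omega)}\le|u|_{W^{1,\infty}(\Omega)}+Ch\|D^2u\|_{L^\infty(\Omega)}.$$ The same estimates, in (i) and (ii), hold for matrix-valued functions.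
   Context: $N\ge2$ is the space dimension and $M_1$ is a positive integer; the dependence of constants on $N$ is not indicated (constants may always depend on $N$). A bounded open set $\Omega\subset\mathbb R^N$ is polyhedral if it coincides with the interior of $\overline\Omega$ and $\partial\Omega$ is a finite union of cells, a cell being the closure of an open connected subset of an $(N-1)$-dimensional hyperplane. A triangulation of $\overline\Omega$ is a finite set $\mathcal T$ of closed $N$-simplexes with nonempty interior whose union is $\overline\Omega$ and such that the intersection of two different elements is either empty or a common face. For $K\in\mathcal T$, $h_K=\mathrm{diam}(K)$ and $\rho_K=\sup\{\mathrm{diam}(B):B\text{ a ball contained in }K\}$. $\mathcal T$ is regular with constants $s$ and $h$ if $h_K\le h$ and $h_K\le s\rho_K$ for every $K\in\mathcal T$. $\Pi_{\mathcal T}$ is the piecewise linear interpolation operator: for $u\in C(\overline\Omega)$, $\Pi_{\mathcal T}(u)$ is the continuous function on $\overline\Omega$ that is affine on each $K\in\mathcal T$ and agrees with $u$ at all vertices of the simplexes of $\mathcal T$; for vector-valued or matrix-valued $u$ it acts component by component. For $u\in W^{2,q}$ with $q>N/2$ it is applied to the continuous representative of $u$. $\nabla u$ is the $M_1\times N$ Jacobian and $D^2u$ is the collection of all second derivatives of all components of $u$. $|u|_{W^{1,\infty}(\Omega)}=\|\nabla u\|_{L^\infty(\Omega)}$, where the pointwise norm of $\nabla u$ is the operator norm from $\mathbb R^N$ to $\mathbb R^{M_1}$ (both Euclidean). The norms $\|D^2u\|_{L^q(\Omega)}$ and $\|D^2u\|_{L^\infty(\Omega)}$ are the $L^q$ and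 $L^\infty$ norms of the pointwise Euclidean norm of $D^2u$. An $N_1\times M_1$ matrix-valued function is identified with an $\mathbb R^{N_1M_1}$-valued one.
   Formalization: In (i), u is assumed to have a representative continuous on the closure of Ω, to which the interpolation operator is applied; for a general polyhedral Ω (e.g. two triangles touching at a vertex) a function in W^{2,q} may have none, and then its interpolant is undefined. *)

(* Defs.v *)
From HB Require Import structures.
From mathcomp Require Import all_boot all_order all_algebra.
From mathcomp Require Import all_classical all_reals all_analysis.

Set Implicit Arguments.
Unset Strict Implicit.
Unset Printing Implicit Defensive.
Import Order.TTheory GRing.Theory Num.Theory.
Import numFieldNormedType.Exports.

Local Open Scope classical_set_scope.
Local Open Scope ring_scope.

Definition rV_display : measure_display. Proof. exact: default_measure_display. Qed.

Section rV_measurable.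
Context {R : realType} (n : nat).

Let coors : 'I_n -> 'rV[R]_n -> measurableTypeR R := fun i v => v ord0 i.

Let rV_set0 : g_sigma_preimage coors set0.
Proof. exact: sigma_algebra0. Qed.

Let rV_setC A : g_sigma_preimage coors A -> g_sigma_preimage coors (~` A).
Proof. exact: sigma_algebraC. Qed.

Let rV_bigcup (F : _^nat) : (forall i, g_sigma_preimage coors (F i)) ->
  g_sigma_preimage coors (\bigcup_i (F i)).
Proof. exact: sigma_algebra_bigcup. Qed.

(* The sigma-algebra generated by the coordinates, i.e. the Borel sets. *)
HB.instance Definition _ := @isMeasurable.Build rV_display 'rV[R]_n
  (g_sigma_preimage coors) rV_set0 rV_setC rV_bigcup.

Lemma measurable_coord (i : 'I_n) :
  measurable_fun setT (fun v : 'rV[R]_n => v ord0 i : measurableTypeR R).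
Proof.
move=> _ Y mY; rewrite setTI; apply: sub_sigma_algebra => /=.
rewrite -bigcup_seq/=; exists i => /=; first by rewrite mem_index_enum.
by exists Y => //; rewrite setTI.
Qed.

Lemma measurable_fun_rV d (T : measurableType d) (f : T -> 'rV[R]_n) :
  (forall i, measurable_fun setT (fun x => f x ord0 i : measurableTypeR R)) ->
  measurable_fun setT f.
Proof.
move=> mf.
suff H : measurable `<=` image_set_system setT f measurable.
  by move=> _ A /H; rewrite /image_set_system /= setTI.
apply: smallest_sub.
  exact/sigma_algebra_image/sigma_algebra_measurable.
move=> A; rewrite -bigcup_seq/= => -[i _] [B mB <-].
by rewrite /image_set_system /= !setTI; have := mf i measurableT _ mB; rewrite setTI.
Qed.

End rV_measurable.

Section lebesgue_rV_step.
Context {R : realType} (n : nat).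

Definition cons_rV (p : measurableTypeR R * 'rV[R]_n) : 'rV[R]_n.+1 :=
  \row_i (if unlift ord0 i is Some j then p.2 ord0 j else p.1).

Definition uncons_rV (v : 'rV[R]_n.+1) : measurableTypeR R * 'rV[R]_n :=
  (v ord0 ord0, \row_j v ord0 (lift ord0 j)).

Lemma cons_rVK : cancel cons_rV uncons_rV.
Proof.
case=> a v; rewrite /uncons_rV /cons_rV; congr pair; first by rewrite mxE unlift_none.
by apply/rowP => j; rewrite !mxE liftK.
Qed.

Lemma measurable_cons_rV : measurable_fun setT cons_rV.
Proof.
apply: measurable_fun_rV => i.
rewrite (_ : (fun _ => _) = fun p : measurableTypeR R * 'rV[R]_n =>
  if unlift ord0 i is Some j then p.2 ord0 j else p.1); last first.
  by apply/funext => p; rewrite mxE.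
case: (unlift ord0 i) => [j|]; last exact: measurable_fst.
by apply: (measurableT_comp (measurable_coord j)).
Qed.

Lemma measurable_uncons_rV : measurable_fun setT uncons_rV.
Proof.
apply: measurable_fun_pair; first exact: measurable_coord.
apply: measurable_fun_rV => j.
rewrite (_ : (fun _ => _) = fun v : 'rV[R]_n.+1 => v ord0 (lift ord0 j)).
  exact: measurable_coord.
by apply/funext => v; rewrite mxE.
Qed.

Variable m : {sigma_finite_measure set 'rV[R]_n -> \bar R}.

Definition lebesgue_rVS : set 'rV[R]_n.+1 -> \bar R :=
  pushforward (@lebesgue_measure R \x m)%E cons_rV.

Let lebesgue_rVS0 : lebesgue_rVS set0 = 0%E.
Proof. by rewrite /lebesgue_rVS /pushforward preimage_set0 measure0. Qed.

Let lebesgue_rVS_ge0 A : (0 <= lebesgue_rVS A)%E.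
Proof. by rewrite /lebesgue_rVS /pushforward measure_ge0. Qed.

Let lebesgue_rVS_sigma_additive : semi_sigma_additive lebesgue_rVS.
Proof.
move=> F mF tF mUF; rewrite /lebesgue_rVS /pushforward preimage_bigcup.
apply: measure_semi_sigma_additive.
- by move=> k; rewrite -[X in measurable X]setTI; exact: measurable_cons_rV.
- apply/trivIsetP => /= i j _ _ ij; rewrite -preimage_setI.
  by move/trivIsetP : tF => /(_ _ _ _ _ ij) ->//; rewrite preimage_set0.
- by rewrite -preimage_bigcup -[X in measurable X]setTI; exact: measurable_cons_rV.
Qed.

HB.instance Definition _ := isMeasure.Build _ _ _ lebesgue_rVS
  lebesgue_rVS0 lebesgue_rVS_ge0 lebesgue_rVS_sigma_additive.

Let lebesgue_rVS_sigma_finite : sigma_finite setT lebesgue_rVS.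
Proof.
have /sigma_finiteP[F [TF ndF Foo]] := sigma_finiteT (@lebesgue_measure R).
have /sigma_finiteP[G [TG ndG Goo]] := sigma_finiteT m.
exists (fun k => uncons_rV @^-1` (F k `*` G k)).
  rewrite -preimage_bigcup [X in _ @^-1` X](_ : _ = setT) ?preimage_setT//.
  rewrite -subTset => -[x y] _.
  have [i _ Fx] : (\bigcup_k F k) x by rewrite -TF.
  have [j _ Gy] : (\bigcup_k G k) y by rewrite -TG.
  exists (maxn i j) => //; split.
    by move: x Fx; exact/subsetPset/ndF/leq_maxl.
  by move: y Gy; exact/subsetPset/ndG/leq_maxr.
move=> k; have [mFk Fk] := Foo k; have [mGk Gk] := Goo k; split.
  rewrite -[X in measurable X]setTI; apply: measurable_uncons_rV => //.
  exact: measurableX.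
rewrite /lebesgue_rVS /pushforward -comp_preimage.
rewrite (_ : uncons_rV \o cons_rV = id) ?preimage_id; last first.
  by apply/funext => p; exact: cons_rVK.
by rewrite product_measure1E// lte_mul_pinfty// ge0_fin_numE.
Qed.

HB.instance Definition _ := Measure_isSigmaFinite.Build _ _ _ lebesgue_rVS
  lebesgue_rVS_sigma_finite.

End lebesgue_rV_step.

Fixpoint lebesgue_rV (R : realType) (n : nat) :
    {sigma_finite_measure set 'rV[R]_n -> \bar R} :=
  if n is n'.+1 then lebesgue_rVS (lebesgue_rV R n') else \d_(0 : 'rV[R]_0).

(* MathComp-Analysis norms matrices with the sup norm, hence [enorm]. *)
Definition enorm {R : realType} {m n : nat} (A : 'M[R]_(m, n)) : R :=
  Num.sqrt (\sum_i \sum_j A i j ^+ 2).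

Definition opnorm {R : realType} {m n : nat} (A : 'M[R]_(m, n)) : R :=
  sup [set enorm (A *m v) | v in [set v : 'cV[R]_n | enorm v <= 1]].

Section geometry.
Context {R : realType} {N : nat}.
Implicit Types (A K F Omega : set 'rV[R]_N) (x a : 'rV[R]_N).
Implicit Types (V : 'M[R]_(N.+1, N)) (T : set (set 'rV[R]_N)).

Definition diam A : R := sup [set enorm (x - y) | x in A & y in A].

Definition eball x (r : R) : set 'rV[R]_N := [set y | enorm (y - x) < r].

Definition hyperplane a (b : R) : set 'rV[R]_N :=
  [set x | \sum_i a ord0 i * x ord0 i = b].

Definition cell A := exists a b (D : set 'rV[R]_N),
  [/\ a != 0,
      exists2 U : set 'rV[R]_N, open U & D = U `&` hyperplane a b,
      connected D &
      A = closure D].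

Definition polyhedral Omega :=
  [/\ open Omega, bounded_set Omega, Omega = interior (closure Omega) &
    exists2 C : set (set 'rV[R]_N), finite_set C /\ (forall A, C A -> cell A) &
      closure Omega `\` Omega = \bigcup_(A in C) A].

(* The rows of [V] are the vertices; [I] selects those spanning the face, so
   that [face V setT] is the convex hull of all of them. *)
Definition face V (I : {set 'I_N.+1}) : set 'rV[R]_N :=
  [set x | exists w : 'rV[R]_N.+1,
    [/\ forall i, 0 <= w ord0 i, forall i, i \notin I -> w ord0 i = 0,
        \sum_i w ord0 i = 1 & x = w *m V]].

Definition is_simplex_of V K := K = face V [set: 'I_N.+1]%SET.

Definition nsimplex K := (exists V, is_simplex_of V K) /\ interior K !=set0.

Definition is_vertex K x := exists V i, is_simplex_of V K /\ x = row i V.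

(* [I] may be empty, in which case [F] is empty, or full, in which case it is
   [K]. *)
Definition is_face K F := exists V I, is_simplex_of V K /\ F = face V I.

Definition triangulation Omega T :=
  [/\ finite_set T,
      forall K, T K -> nsimplex K,
      \bigcup_(K in T) K = closure Omega &
      forall K L, T K -> T L -> K <> L ->
        K `&` L = set0 \/ (is_face K (K `&` L) /\ is_face L (K `&` L))].

(* [diam] and [inradius_diam] are suprema of real sets and are meaningful for
   the bounded sets with nonempty interior to which they are applied. *)
Definition inradius_diam K : R :=
  sup [set diam (eball xr.1 xr.2) |
       xr in [set xr : 'rV[R]_N * R | 0 < xr.2 /\ eball xr.1 xr.2 `<=` K]].

Definition regular_triangulation Omega T (s h : R) :=
  triangulation Omega T /\
  forall K, T K -> diam K <= h /\ diam K <= s * inradius_diam K.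

End geometry.

Section interpolation.
Context {R : realType} {N : nat}.
Variables (Omega : set 'rV[R]_N) (T : set (set 'rV[R]_N)).

Definition affine_on (K : set 'rV[R]_N) (p : 'rV[R]_N -> R) :=
  exists (a : 'rV[R]_N) (b : R),
    forall x, K x -> p x = \sum_i a ord0 i * x ord0 i + b.

Definition is_interpolant (u p : 'rV[R]_N -> R) :=
  [/\ {within closure Omega, continuous p},
      forall K, T K -> affine_on K p &
      forall K x, T K -> is_vertex K x -> p x = u x].

Definition Pi_scalar (u : 'rV[R]_N -> R) : 'rV[R]_N -> R :=
  xget (fun=> 0) [set p | is_interpolant u p].

Definition PiT {m n : nat} (u : 'rV[R]_N -> 'M[R]_(m, n)) :
    'rV[R]_N -> 'M[R]_(m, n) :=
  fun x => \matrix_(i, j) Pi_scalar (fun y => u y i j) x.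

End interpolation.

Section derivatives.
Context {R : realType} {N : nat}.
Variable Omega : set 'rV[R]_N.
Implicit Types (f g phi : 'rV[R]_N -> R) (ds : seq 'I_N).

(* [partials [:: i1; ...; ik] f] is the iterated partial derivative
   d_i1 ... d_ik f. *)
Definition partials ds f : 'rV[R]_N -> R :=
  foldr (fun i g => 'D_(delta_mx ord0 i) g) f ds.

Definition test_function phi :=
  (forall ds x, differentiable (partials ds phi) x) /\
  exists2 K, compact K /\ K `<=` Omega & forall x, ~ K x -> phi x = 0.

Definition loc_integrable f :=
  measurable_fun Omega f /\
  forall K, compact K -> K `<=` Omega ->
    (lebesgue_rV R N).-integrable K (EFin \o f).

Definition weak_derivative ds f g :=
  [/\ loc_integrable f, loc_integrable g &
    forall phi, test_function phi ->
      \int[lebesgue_rV R N]_(x in Omega) (f x * partials ds phi x) =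
      (-1) ^+ size ds * \int[lebesgue_rV R N]_(x in Omega) (g x * phi x)].

(* A weak derivative (unique up to a null set) if there is one. *)
Definition weakD ds f : 'rV[R]_N -> R :=
  xget (fun=> 0) [set g | weak_derivative ds f g].

(* All derivatives of order at most 2 are required to extend continuously to the
   closure; this makes the second derivatives continuous in [Omega], and
   differentiability of the lower order ones follows from C^2 and guarantees
   that [partials] is not a junk value. *)
Definition C2_closure f :=
  [/\ {within closure Omega, continuous f},
      forall ds, (size ds <= 1)%N ->
        forall x, Omega x -> differentiable (partials ds f) x &
      forall ds, (size ds <= 2)%N ->
        exists2 g, {within closure Omega, continuous g} &
                   forall x, Omega x -> g x = partials ds f x].

Definition Lq (q : R) f := f \_ Omega \in Lfun (lebesgue_rV R N) q%:E.

Definition normL (p : \bar R) f : \bar R :=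
  ('N[lebesgue_rV R N]_p[EFin \o (f \_ Omega)])%E.

End derivatives.

Section vector_valued.
Context {R : realType} {N M : nat}.
Variable Omega : set 'rV[R]_N.
Implicit Types u v : 'rV[R]_N -> 'rV[R]_M.

Definition component u (j : 'I_M) : 'rV[R]_N -> R := fun x => u x ord0 j.

Definition C2_closure_vec u := forall j, C2_closure Omega (component u j).

Definition sobolev (k : nat) (q : R) u := forall j,
  Lq Omega q (component u j) /\
  forall ds, (size ds <= k)%N ->
    exists2 g, weak_derivative Omega ds (component u j) g & Lq Omega q g.

(* [v] is unique on the closure; it need not exist when [Omega] is not Lipschitz
   (for instance, two simplexes touching at a vertex only). *)
Definition continuous_representative u v :=
  {within closure Omega, continuous v} /\
  {ae lebesgue_rV R N, forall x, Omega x -> u x = v x}.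

Definition has_weakD (k : nat) u := forall j ds, size ds = k ->
  exists g, weak_derivative Omega ds (component u j) g.

Definition weak_jacobian u (x : 'rV[R]_N) : 'M[R]_(M, N) :=
  \matrix_(j, i) weakD Omega [:: i] (component u j) x.

Definition weak_D2_norm u (x : 'rV[R]_N) : R :=
  Num.sqrt (\sum_j \sum_i \sum_k weakD Omega [:: i; k] (component u j) x ^+ 2).

Definition norm0 (p : \bar R) u : \bar R := normL Omega p (fun x => enorm (u x)).

(* The norms of the gradient and of the Hessian are infinite when the weak
   derivatives do not exist; so an upper bound on them asserts existence. *)
Definition norm1 (p : \bar R) u : \bar R :=
  if `[< has_weakD 1 u >]
  then normL Omega p (fun x => opnorm (weak_jacobian u x)) else +oo%E.

Definition norm2 (p : \bar R) u : \bar R :=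
  if `[< has_weakD 2 u >] then normL Omega p (weak_D2_norm u) else +oo%E.

End vector_valued.

(* Main.v *)
(* On a simplex with vertices a_k and barycentric coordinates l_k, the interpolation error at
   x is sum_k l_k(x) R_k(x) and its gradient is sum_k R_k(x) grad l_k, where
   R_k(x) = v(a_k) - v(x) - Du(x)(a_k - x) is a first-order Taylor remainder; moreover
   |grad l_k| is at most the inverse of the diameter of the largest inscribed balls.

   The formula R_k(x) = int_0^1 (1 - r) D^2u(x + r(a_k - x))[a_k - x, a_k - x] dr holds for
   almost every x. Up to r = t < 1 it is proved without mollification: integrate against a
   test function, move the homothety x -> x + r(a_k - x) onto the test function by a change
   of variables, and use the fundamental lemma of the calculus of variations. Then t tends to
   1 by continuity of v at a_k.

   The L^q norm of the average of |D^2u| along the segments from x to a_k is bounded by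
   Hoelder's inequality with the weight (1 - r)^(1 - N/q), which is integrable because
   q > N/2, and by the change of variables above, whose Jacobian is (1 - r)^N. No reference
   simplex is needed.

   The interpolant is Lipschitz along the segments of the domain, so its difference quotients
   converge dominatedly and its weak gradient is the piecewise gradient. *)

Require Import Defs.
From HB Require Import structures.
From mathcomp Require Import all_boot all_order all_algebra.
From mathcomp Require Import all_classical all_reals all_analysis.
From mathcomp Require Import measurable_realfun ess_sup_inf.
From mathcomp Require Import ring lra.

Set Implicit Arguments.
Unset Strict Implicit.
Unset Printing Implicit Defensive.
Import Order.TTheory GRing.Theory Num.Theory.
Import numFieldNormedType.Exports.

Local Open Scope classical_set_scope.
Local Open Scope ring_scope.

(** * Lebesgue measure on row vectors *)

(** The remainder formula is used on one open simplex at a time, with homotheties centred at a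
    vertex. These map the open simplex into itself, so only values of [u] inside it occur and the
    shape of the boundary of [Omega] does not intervene. The formula is first stopped at [t < 1]
    because the homothety of ratio [1 - r] has Jacobian [(1 - r) ^+ n], whose inverse is unbounded
    near [r = 1], while Fubini's theorem asks for integrability on the product. The constants may
    not depend on the number of components, so remainders are estimated as vectors and not one
    component at a time. A remainder is at most [diam K ^+ 2] times an average of the Hessian; the
    gradients of the barycentric coordinates cost a further [s / diam K], which is how [h ^+ 2]
    becomes [s * h]. Averaging costs [(2 - n / q)^-1] in L^q, where [n / q < 2] is the condition on
    [q]; the powers of [n + 1] come from the number of vertices. The same pointwise estimate gives
    (ii), the average being then bounded by the essential supremum of the Hessian. *)

Section boxes.
Context {R : realType} {n : nat}.
Implicit Types (a b x : 'rV[R]_n).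

Definition box a b : set 'rV[R]_n :=
  [set x | forall i, a ord0 i < x ord0 i < b ord0 i].

Lemma measurable_box a b : measurable (box a b).
Proof.
rewrite (_ : box a b = \bigcap_(i in [set: 'I_n])
    ((fun x : 'rV[R]_n => x ord0 i : measurableTypeR R) @^-1`
       `]a ord0 i, b ord0 i[%classic)); last first.
  apply/seteqP; split => x /=; first by move=> H i _ /=; rewrite in_itv/=; exact: H.
  by move=> H i; have := H i I; rewrite /= in_itv.
apply: fin_bigcap_measurable => // i _.
by rewrite -[X in measurable X]setTI; apply: measurable_coord.
Qed.

Lemma ball_box x (e : R) : 0 < e -> ball x e = box (x - const_mx e) (x + const_mx e).
Proof.
move=> e0; suff H (y : 'rV[R]_n) :
    ball x e y <-> box (x - const_mx e) (x + const_mx e) y.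
  by apply/seteqP; split => y /H.
split.
  rewrite /ball/= => -[_ H] i; have /= : `|x ord0 i - y ord0 i| < e := H ord0 i.
  by rewrite !mxE ltr_distl => /andP[? ?]; apply/andP; split; lra.
move=> H; split => // i j; rewrite (ord1 i) {i}.
have := H j; rewrite !mxE => /andP[? ?].
by change (is_true (`|x ord0 j - y ord0 j| < e)); rewrite ltr_distl; apply/andP; split; lra.
Qed.

(** A countable base of the topology: cubes with rational centre and half-side [1 / (k + 1)].
    Countability serves both measurability of open sets and statements that hold almost
    everywhere. *)
Definition rat_box (p : 'rV[rat]_n * nat) : set 'rV[R]_n :=
  box (\row_i (ratr (p.1 ord0 i) - p.2.+1%:R^-1)) (\row_i (ratr (p.1 ord0 i) + p.2.+1%:R^-1)).

(** The closure is kept inside [U] because bumps on the cube must have compact support in [U]. *)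
Lemma open_rat_box (U : set 'rV[R]_n) x : open U -> U x ->
  exists p, rat_box p x /\ closure (rat_box p) `<=` U.
Proof.
move=> oU Ux.
have /nbhs_ballP[e /= e0 eU] : nbhs x U by exact: open_nbhs_nbhs.
(* Points of the cube are within [2 * d < e / 2] of [x], which leaves room for the points of its
   closure. *)
have [k ke] : exists k, k.+1%:R^-1 < e / 4.
  have [k] := ltr_add_invr (divr_gt0 e0 (ltr0n _ 4)).
  by rewrite add0r => ?; exists k.
have k0 : 0 < k.+1%:R^-1 :> R by rewrite invr_gt0.
have [d dk] : exists d, d = k.+1%:R^-1 :> R by exists k.+1%:R^-1.
rewrite -dk in k0 ke.
have H i : exists q : rat, x ord0 i - d < ratr q < x ord0 i + d.
  have : x ord0 i - d < x ord0 i + d by lra.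
  by move=> /rat_in_itvoo[q]; rewrite in_itv/= => ?; exists q.
have /choice[q hq] := H.
exists (\row_i q i, k); split.
  by move=> i; rewrite !mxE/= -dk; move/andP: (hq i) => [? ?]; apply/andP; split; lra.
move=> y cy; apply: eU.
have /(cy _) [z []] : nbhs y (ball y (e/4)) by apply: nbhsx_ballx; rewrite divr_gt0.
rewrite ball_box ?divr_gt0// ball_box// => H1 H2 i; move: (H1 i) (H2 i).
rewrite !mxE/= -dk; move/andP: (hq i) => [? ?] /andP[? ?] /andP[? ?].
by apply/andP; split; lra.
Qed.

Lemma open_measurable_rV (U : set 'rV[R]_n) : open U -> measurable U.
Proof.
move=> oU.
rewrite (_ : U = \bigcup_p (if `[< rat_box p `<=` U >] then rat_box p else set0)).
  apply: countable_bigcupT_measurable; first exact: countableP.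
  by move=> p; case: ifP => // _; exact: measurable_box.
apply/seteqP; split => [x Ux|x [p _]].
  have [p [px pU]] := open_rat_box oU Ux; exists p => //.
  rewrite ifT//; apply/asboolP; apply: subset_trans pU; exact: subset_closure.
by case: ifPn => // /asboolP; exact.
Qed.

Lemma closed_measurable_rV (U : set 'rV[R]_n) : closed U -> measurable U.
Proof. by move/closed_openC/open_measurable_rV/measurableC; rewrite setCK. Qed.

Lemma continuous_measurable_rV (D : set 'rV[R]_n) (f : 'rV[R]_n -> R) :
  measurable D -> {within D, continuous f} -> measurable_fun D f.
Proof.
move=> mD /continuousP cf; apply: (measurability _ (RGenOpens.measurableE R)).
move=> _ [_ [a [b ->] <-]].
have oab : open `]a, b[%classic by exact: interval_open.
have /open_subspaceP [V oV VD] := cf _ oab.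
by rewrite setIC -VD; apply: measurableI => //; exact: open_measurable_rV.
Qed.

Lemma continuous_measurableT_rV (f : 'rV[R]_n -> R) :
  continuous f -> measurable_fun setT f.
Proof.
by move=> cf; apply: continuous_measurable_rV => //; exact: continuous_subspaceT.
Qed.

End boxes.

(** * Affine changes of variables *)

Section affine1.
Context {R : realType}.
Local Notation mu := (@lebesgue_measure R).
Variables (c b : R).
Hypothesis c0 : 0 < c.
Let phi : measurableTypeR R -> measurableTypeR R := fun x => c * x + b.

Lemma measurable_affine1 : measurable_fun setT phi.
Proof. by apply: measurable_funD => //; exact: measurable_funM. Qed.

(** The scaled pushforward agrees with Lebesgue measure on half-open intervals, hence everywhere by
    uniqueness. *)
Lemma lebesgue_measure_affine (A : set (measurableTypeR R)) : measurable A ->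
  mu A = (c%:E * pushforward mu phi A)%E.
Proof.
move=> mA.
pose m : {measure set (measurableTypeR R) -> \bar R} :=
  mscale (NngNum (ltW c0)) (pushforward mu phi).
rewrite (@lebesgue_measure_unique _ (m measurable_affine1))// => _ [[x y]] /= _ <-.
rewrite /mscale/= /pushforward.
rewrite [X in (_ * mu X)%E](_ : _ = `](x - b) / c, (y - b) / c]%classic); last first.
  suff H (z : R) : (x < c * z + b <= y) = ((x - b) / c < z <= (y - b) / c).
    by apply/seteqP; split => z; have := H z; rewrite /= !in_itv/= /phi => ->.
  by rewrite ltr_pdivrMr// ler_pdivlMr// [z * c]mulrC ltrBlDr lerBrDr.
rewrite !lebesgue_measure_itv/= !lte_fin ltr_pM2r ?invr_gt0// ltrD2r.
case: ifP => _; last by rewrite mule0.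
by rewrite -!EFinD -EFinM; congr (_%:E); field; rewrite gt_eqF.
Qed.

Lemma ge0_integral_affine1 (f : measurableTypeR R -> \bar R) :
  measurable_fun setT f -> (forall x, (0 <= f x)%E) ->
  (\int[mu]_x f (phi x) = (c^-1)%:E * \int[mu]_x f x)%E.
Proof.
move=> mf f0.
pose m : {measure set (measurableTypeR R) -> \bar R} :=
  mscale (NngNum (ltW c0)) (pushforward mu phi).
have -> : (\int[mu]_x f x = \int[m measurable_affine1]_x f x)%E.
  apply: eq_measure_integral => //= A mA _.
  exact: lebesgue_measure_affine.
rewrite ge0_integral_mscale// ge0_integral_pushforward//=; last exact: measurable_affine1.
by rewrite muleA -EFinM mulVf ?mul1e// gt_eqF.
Qed.

End affine1.
Section affine_rV.
Context {R : realType}.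

Definition aff n (c : R) (b x : 'rV[R]_n) : 'rV[R]_n := c *: x + b.

Lemma measurable_affine_rV n (c : R) (b : 'rV[R]_n) :
  measurable_fun setT (aff c b).
Proof.
apply: measurable_fun_rV => i.
rewrite (_ : (fun x => _) = fun x : 'rV[R]_n => c * x ord0 i + b ord0 i); last first.
  by apply/funext => x; rewrite !mxE.
apply: measurable_funD => //; apply: measurable_funM => //; exact: measurable_coord.
Qed.

(** Induction on the dimension, following the construction of the measure: the outer integral over
    the first coordinate scales by [c], and each section by [c ^+ n]. *)
Lemma lebesgue_rV_affine n (c : R) (b : 'rV[R]_n) (A : set 'rV[R]_n) :
  0 < c -> measurable A ->
  lebesgue_rV R n A = ((c ^+ n)%:E * lebesgue_rV R n (aff c b @^-1` A))%E.
Proof.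
move=> c0; elim: n b A => [|n IH] b A mA.
  rewrite expr0 mul1e; congr (lebesgue_rV R 0 _).
  by apply/seteqP; split => x /=; rewrite [aff _ _ _]thinmx0 [x]thinmx0.
have mB : measurable (@cons_rV R n @^-1` A).
  by rewrite -[X in measurable X]setTI; exact: measurable_cons_rV.
rewrite /= /lebesgue_rVS /pushforward /product_measure1/=.
set B := _ @^-1` A in mB *.
pose f (y : measurableTypeR R) := lebesgue_rV R n (xsection B y).
transitivity (\int[lebesgue_measure]_y f y)%E; first by [].
have E : (\int[lebesgue_measure]_x f (c * x + b ord0 ord0)%R =
   c^-1%:E * \int[lebesgue_measure]_x f x)%E.
  apply: (ge0_integral_affine1 (b ord0 ord0) c0) => //.
  exact: measurable_fun_xsection.
have f0 y : (0 <= f y)%E by exact: measure_ge0.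
have -> : (\int[lebesgue_measure]_x f x = c%:E * \int[lebesgue_measure]_x f (c * x + b ord0 ord0)%R)%E.
  by rewrite E muleA -EFinM mulfV ?mul1e// gt_eqF.
rewrite exprS EFinM -muleA; congr (_ * _)%E.
rewrite -ge0_integralZl//; last 2 first.
- apply: measurable_fun_xsection; rewrite -[X in measurable X]setTI.
  apply: measurable_cons_rV => //; rewrite -[X in measurable X]setTI.
  exact: measurable_affine_rV.
- by rewrite lee_fin exprn_ge0// ltW.
apply: eq_integral => x _.
rewrite /f (IH (\row_j b ord0 (lift ord0 j))); last exact: measurable_xsection.
congr (_ * _)%E; congr (lebesgue_rV R n _).
suff H (y : 'rV[R]_n) :
    cons_rV (c * x + b ord0 ord0, aff c (\row_j b ord0 (lift ord0 j)) y) =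
    aff c b (cons_rV (x, y)).
  by apply/seteqP; split => y /=; rewrite !xsectionE/= /B/= H.
apply/rowP => i; rewrite !mxE/= -[0]/(ord0).
by case: (unliftP ord0 i) => [j|] -> //=; rewrite !mxE.
Qed.

Lemma ge0_integral_affine_rV n (c : R) (b : 'rV[R]_n) (f : 'rV[R]_n -> \bar R) :
  0 < c -> measurable_fun setT f -> (forall x, (0 <= f x)%E) ->
  (\int[lebesgue_rV R n]_x f x =
   (c ^+ n)%:E * \int[lebesgue_rV R n]_x f (aff c b x))%E.
Proof.
move=> c0 mf f0.
have cn0 : 0 <= c ^+ n by rewrite exprn_ge0// ltW.
pose m : {measure set 'rV[R]_n -> \bar R} :=
  mscale (NngNum cn0) (pushforward (lebesgue_rV R n) (aff c b)).
transitivity (\int[m (measurable_affine_rV c b)]_x f x)%E.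
  apply: eq_measure_integral => //= A mA _; exact: lebesgue_rV_affine.
rewrite ge0_integral_mscale// ge0_integral_pushforward//=.
exact: measurable_affine_rV.
Qed.

Lemma lebesgue_rV_box_lty n (a b : 'rV[R]_n) : (lebesgue_rV R n (box a b) < +oo)%E.
Proof.
elim: n a b => [|n IH] a b; first by rewrite /= /dirac indicE ltry.
rewrite /= /lebesgue_rVS /pushforward.
rewrite (_ : _ @^-1` _ = `]a ord0 ord0, b ord0 ord0[%classic `*`
   box (\row_j a ord0 (lift ord0 j)) (\row_j b ord0 (lift ord0 j))); last first.
  apply/seteqP; split => -[x y] /=.
    move=> H; split => [|i]; first by have := H ord0; rewrite !mxE unlift_none in_itv.
    by have := H (lift ord0 i); rewrite !mxE liftK.
  rewrite in_itv/= => -[H1 H2] i; rewrite !mxE/=.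
  by case: unliftP => [j|] -> //=; have := H2 j; rewrite !mxE.
rewrite product_measure1E//; last exact: measurable_box.
rewrite lte_mul_pinfty//.
rewrite [X in X \is a fin_num](_ : _ =
  lebesgue_measure `]a ord0 ord0, b ord0 ord0[%classic)// lebesgue_measure_itv/=.
by case: ifP.
Qed.

End affine_rV.

Section bounded_rV.
Context {R : realType} {n : nat}.
Local Notation mu := (lebesgue_rV R n).

Lemma ler_norm_coord (x : 'rV[R]_n) i : `|x ord0 i| <= `|x|.
Proof.
rewrite [leRHS]/Num.Def.normr/= mx_normrE.
exact: (le_bigmax _ (fun ij : 'I_1 * 'I_n => `|x ij.1 ij.2|) (ord0, i)).
Qed.

Lemma bounded_subset_box (A : set 'rV[R]_n) : bounded_set A ->
  exists2 r, 0 < r & A `<=` box (const_mx (- r)) (const_mx r).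
Proof.
move=> [M [_ HM]]; exists (`|M| + 2); first by rewrite ltr_wpDl.
move=> x Ax i; rewrite !mxE -ltr_norml.
have : `|x| <= `|M| + 1 by apply: HM => //; rewrite (le_lt_trans (ler_norm M))// ltrDl.
have := ler_norm_coord x i; lra.
Qed.

Lemma bounded_lebesgue_rV_lty (A : set 'rV[R]_n) :
  measurable A -> bounded_set A -> (mu A < +oo)%E.
Proof.
move=> mA /bounded_subset_box[r r0 Ar].
apply: le_lt_trans (lebesgue_rV_box_lty (const_mx (- r)) (const_mx r)).
by apply: le_measure; rewrite ?inE//; exact: measurable_box.
Qed.

End bounded_rV.

(** * Hyperplanes have measure zero *)

Section hyperplane_null.
Context {R : realType} {n : nat}.
Local Notation mu := (lebesgue_rV R n).

Lemma measurable_dot (a : 'rV[R]_n) :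
  measurable_fun setT (fun x : 'rV[R]_n => \sum_i a ord0 i * x ord0 i).
Proof.
apply: measurable_sum => i; apply: measurable_funM => //; exact: measurable_coord.
Qed.

Lemma measurable_hyperplane (a : 'rV[R]_n) b : measurable (hyperplane a b).
Proof.
rewrite -[X in measurable X]setTI.
exact: (measurable_dot a measurableT (measurable_set1 b)).
Qed.

(** The translates of a bounded piece by [a / (k + 1)] are pairwise disjoint, have the same measure
    and stay in one box of finite measure; so this common measure is 0. *)
Lemma hyperplane_null (a : 'rV[R]_n) b : a != 0 -> mu (hyperplane a b) = 0%E.
Proof.
move=> a0.
have aa0 : 0 < \sum_i a ord0 i * a ord0 i.
  have sq i : 0 <= a ord0 i * a ord0 i by rewrite -expr2 sqr_ge0.
  rewrite lt0r sumr_ge0 ?andbT//; apply: contra a0 => /eqP s0.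
  apply/eqP/rowP => i; rewrite mxE; apply/eqP.
  have /psumr_eq0P : forall i : 'I_n, true -> 0 <= a ord0 i * a ord0 i by [].
  by move=> /(_ s0) /(_ i isT) /eqP; rewrite mulf_eq0 orbb.
pose B (r : nat) : set 'rV[R]_n := box (const_mx (- r%:R)) (const_mx r%:R).
have mP r : measurable (hyperplane a b `&` B r).
  by apply: measurableI; [exact: measurable_hyperplane|exact: measurable_box].
suff Pr r : mu (hyperplane a b `&` B r) = 0%E.
  apply: measure_negligible; first exact: measurable_hyperplane.
  rewrite (_ : hyperplane a b = \bigcup_r (hyperplane a b `&` B r)).
    by apply: negligible_bigcup => r; apply/negligibleP; [exact: mP|exact: Pr].
  rewrite -setI_bigcupr setIidl// => x _.
  have [r r0 xr] : exists2 r, 0 < r & [set x] `<=` box (const_mx (- r)) (const_mx r).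
    by apply: bounded_subset_box; exists `|x|; split; [exact: normr_real|move=> M /ltW ? _ ->].
  exists (Num.truncn r).+1 => // i; have := xr x erefl i; rewrite !mxE.
  by have := truncnS_gt r => ? /andP[? ?]; apply/andP; split; lra.
pose w (k : nat) := k.+1%:R^-1 *: a.
pose Q k := aff 1 (- w k) @^-1` (hyperplane a b `&` B r).
have mQ k : measurable (Q k).
  by rewrite -[X in measurable X]setTI; exact: measurable_affine_rV.
have muQ k : mu (Q k) = mu (hyperplane a b `&` B r).
  by rewrite [RHS](lebesgue_rV_affine (c := 1) (- w k))// expr1n mul1e.
have tQ : trivIset setT Q.
  apply/trivIsetP => i j _ _ ij; rewrite -subset0 => x [[+ _] [+ _]].
  rewrite /hyperplane/=; under eq_bigr do rewrite !mxE mul1r mulrDr.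
  move=> H; under eq_bigr do rewrite !mxE mul1r mulrDr.
  rewrite -H !big_split/= => /addrI /eqP; rewrite -subr_eq0 -sumrB.
  under eq_bigr do rewrite !mulrN opprK [- _ + _]addrC !(mulrCA (a ord0 _)) -mulrBl.
  rewrite -mulr_sumr mulf_eq0 (gt_eqF aa0) orbF subr_eq0 => /eqP/invr_inj/eqP.
  by rewrite eqr_nat eqSS (negbTE ij).
have bQ : \bigcup_k Q k `<=` box (const_mx (- r%:R - `|a|)) (const_mx (r%:R + `|a|)).
  move=> x [k _ [_ +]] i => /(_ i); rewrite !mxE mul1r.
  have := ler_norm_coord a i.
  have : `|k.+1%:R^-1 * a ord0 i| <= `|a ord0 i|.
    by rewrite normrM ger0_norm// ler_piMl// invf_le1// ler1n.
  move: (k.+1%:R^-1 * _) (r%:R : R) => y s.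
  rewrite ler_norml => /andP[? ?] ? /andP[? ?]; apply/andP; split; lra.
have Ulty : (mu (\bigcup_k Q k) < +oo)%E.
  apply: le_lt_trans (lebesgue_rV_box_lty (const_mx (- r%:R - `|a|)) (const_mx (r%:R + `|a|))).
  apply: le_measure; rewrite ?inE//; last exact: measurable_box.
  exact: bigcupT_measurable.
have E : (mu (\bigcup_k Q k) = \sum_(k <oo) mu (hyperplane a b `&` B r))%E.
  rewrite measure_bigcup// (eq_eseriesl (Q := xpredT)); last by move=> k; rewrite in_setT.
  by apply: eq_eseriesr => k _; exact: muQ.
have [//|P0] := eqVneq (mu (hyperplane a b `&` B r)) 0%E.
have Pgt0 : (0 < mu (hyperplane a b `&` B r))%E by rewrite lt0e P0 measure_ge0.
have Pf : (mu (hyperplane a b `&` B r) < +oo)%E.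
  apply: le_lt_trans (lebesgue_rV_box_lty (const_mx (- r%:R)) (const_mx r%:R)).
  by apply: le_measure; rewrite ?inE//; exact: measurable_box.
(* A series with constant positive terms is infinite, against [Ulty]. *)
exfalso; move: Ulty; rewrite E ltNge => /negP; apply; rewrite leye_eq.
rewrite -(@fineK _ (mu _)) ?ge0_fin_numE//.
set e := fine _.
have e0 : 0 < e by rewrite fine_gt0// Pgt0.
apply/eqP/eqyP => A A0.
have [k kA] : exists k : nat, A <= k%:R * e.
  exists (Num.truncn (A / e)).+1; rewrite -ler_pdivrMr// ltW//; exact: truncnS_gt.
apply: (@le_trans _ _ (\sum_(0 <= i < k) e%:E)%E); last first.
  by apply: nneseries_lim_ge => // i _; rewrite lee_fin ltW.
by rewrite sumEFin lee_fin sumr_const_nat subn0 -mulr_natl.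
Qed.

End hyperplane_null.
(** * Smooth test functions *)

Section flat_exp.
Context {R : realType}.
Implicit Types (x : R) (k : nat).

Definition flat_exp k x : R := if 0 < x then x^-1 ^+ k * expR (- x^-1) else 0.

Lemma flat_exp_le0 k x : x <= 0 -> flat_exp k x = 0.
Proof. by rewrite /flat_exp ltNge => ->. Qed.

(** From [exp y >= (y / (k + 2)) ^ (k + 2)] at [y = 1 / x]. The bound makes every [flat_exp k]
    continuous at 0, from which differentiability there follows. *)
Lemma flat_exp_bound k x : `|flat_exp k x| <= (k.+2%:R ^+ k.+2) * x ^+ 2.
Proof.
have C0 : 0 <= k.+2%:R ^+ k.+2 :> R by rewrite exprn_ge0.
rewrite /flat_exp; case: ifPn => x0; last by rewrite normr0 mulr_ge0// sqr_ge0.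
have n0 : (0 : R) < k.+2%:R by rewrite ltr0n.
rewrite ger0_norm; last by rewrite mulr_ge0 ?expR_ge0// exprn_ge0// invr_ge0 ltW.
have H : (x^-1 / k.+2%:R) ^+ k.+2 <= expR (x^-1).
  have {2}-> : x^-1 = k.+2%:R * (x^-1 / k.+2%:R) by rewrite mulrCA mulfV ?mulr1// gt_eqF.
  rewrite expRM_natl.
  rewrite lerXn2r ?nnegrE ?expR_ge0// ?divr_ge0 ?invr_ge0 ?(ltW x0)//.
  by apply: le_trans (expR_ge1Dx _); rewrite ler_wpDl.
have y0 : 0 < x^-1 by rewrite invr_gt0.
rewrite expRN ler_pdivrMr ?expR_gt0//; apply: le_trans (ler_wpM2l _ H); last first.
  by rewrite mulr_ge0// sqr_ge0.
rewrite exprMn [k.+2%:R^-1 ^+ _]exprVn [(x^-1) ^+ k.+2 * _]mulrC mulrACA mulfV ?expf_neq0 ?gt_eqF//.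
by rewrite mul1r -[k.+2]addn2 exprD mulrCA -exprMn mulfV ?gt_eqF// expr1n mulr1.
Qed.

Lemma is_derive_flat_exp k x :
  is_derive x 1 (flat_exp k) (flat_exp k.+2 x - k%:R * flat_exp k.+1 x).
Proof.
have [x0|x0|->] := ltgtP x 0.
- rewrite !flat_exp_le0 ?ltW// mulr0 subr0.
  apply: (@near_eq_is_derive _ _ _ (cst 0)) => //.
  near=> y; rewrite flat_exp_le0//; apply: ltW; near: y; exact: lt_nbhsl.
- have xn0 : x != 0 by rewrite gt_eqF.
  apply: (near_eq_is_derive (f := fun y : R => y^-1 ^+ k * expR (- y^-1) : R)) => //.
    by near=> y; rewrite /flat_exp ifT//; near: y; exact: lt_nbhsr.
  have dV : is_derive x 1 (fun y : R => y^-1) (- x ^- 2 *: 1).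
    by apply: (@is_deriveV _ id) => //.
  have dE : is_derive x 1 (fun y : R => expR (- y^-1)) (expR (- x^-1) * - (- x ^- 2 *: 1)).
    by apply: (@is_derive1_comp _ expR (fun y => - y^-1)).
  have := is_deriveM (is_deriveX k dV) dE.
  rewrite (_ : _ * _ = fun y : R => y^-1 ^+ k * expR (- y^-1)); last first.
    by apply/funext => y; rewrite !fctE.
  move=> H; apply: (is_derive_eq H).
  rewrite /flat_exp x0 /= /GRing.scale/=.
  rewrite !fctE -exprVn; case: k {H} => [|k]; first by ring.
  by rewrite -[k.+1.-1]/k -natr1 !exprS; move: (expR (- x^-1)) => E; move: x^-1 => y; ring.
(* At 0 the difference quotient is [flat_exp k.+1], which tends to 0 by the quadratic bound. *)
- rewrite !flat_exp_le0// mulr0 subr0; apply/is_derive1_caratheodory.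
  exists (flat_exp k.+1); split; last by rewrite flat_exp_le0.
    move=> z; rewrite !subr0 (flat_exp_le0 k (lexx 0)) subr0 /flat_exp.
    case: ifPn => [z0|]; last by rewrite mul0r.
    by rewrite exprSr mulrAC mulfVK ?gt_eqF.
  rewrite /prop_for /continuous_at flat_exp_le0//; apply/cvgr0Pnorm_lt => e e0.
  have : (k.+3%:R ^+ k.+3) * y ^+ 2 @[y --> (0:R)] --> (k.+3%:R ^+ k.+3 * 0 ^+ 2 : R).
    by apply: cvgMr; exact: exprn_continuous.
  rewrite expr0n mulr0 => /cvgr0Pnorm_lt /(_ _ e0).
  apply: filterS => y; apply: le_lt_trans; rewrite [leRHS]ger0_norm ?flat_exp_bound//.
  by apply: mulr_ge0; [exact: exprn_ge0|exact: sqr_ge0].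
Unshelve. all: by end_near. Qed.

Lemma flat_exp0_lt1 x : 0 <= flat_exp 0 x <= 1.
Proof.
rewrite /flat_exp; case: ifPn => [x0|_]; last by rewrite lexx ler01.
by rewrite expr0 mul1r expR_ge0 -expR0 ler_expR oppr_le0 invr_ge0 ltW.
Qed.

Lemma cvg_flat_exp0 x : 0 < x -> flat_exp 0 (m.+1%:R * x) @[m --> \oo] --> (1 : R).
Proof.
move=> x0; rewrite -[X in _ --> X]expR0 -oppr0.
have H : (m.+1%:R * x)^-1 @[m --> \oo] --> (0 : R).
  have : m.+1%:R^-1 * x^-1 @[m --> \oo] --> (0 * x^-1 : R).
    by apply: cvgMl; exact: cvg_harmonic.
  by rewrite mul0r; under eq_fun do rewrite -invfM.
rewrite (_ : (fun m => _) = fun m : nat => expR (- (m.+1%:R * x)^-1)).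
  apply: continuous_cvg; first exact: continuous_expR.
  exact: cvgN.
by apply/funext => m; rewrite /flat_exp mulr_gt0// expr0 mul1r.
Qed.

End flat_exp.
Section smooth.
Context {R : realType} {n : nat}.
Implicit Types (f g : 'rV[R]_n -> R) (x v w : 'rV[R]_n).

(* A class of functions closed under partial derivatives and containing enough bumps;
   the derivatives of [exp (- 1 / x)] are combinations of the [flat_exp k]. *)
Inductive smooth : ('rV[R]_n -> R) -> Prop :=
| smooth_cst (c : R) : smooth (fun=> c)
| smooth_coord (i : 'I_n) : smooth (fun x => x ord0 i)
| smooth_flat_exp k f : smooth f -> smooth (fun x => flat_exp k (f x))
| smoothD f g : smooth f -> smooth g -> smooth (fun x => f x + g x)
| smoothM f g : smooth f -> smooth g -> smooth (fun x => f x * g x).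

Lemma eq_smooth g f : g =1 f -> smooth g -> smooth f.
Proof. by move/funext => ->. Qed.

Lemma smoothB f g : smooth f -> smooth g -> smooth (fun x => f x - g x).
Proof.
move=> sf sg; apply: eq_smooth (smoothD sf (smoothM (smooth_cst (-1)) sg)) => x.
by rewrite mulN1r.
Qed.

Lemma smooth_differentiable f x : smooth f -> differentiable f x.
Proof.
elim=> {f} [c|i|k f _ df|f g _ df _ dg|f g _ df _ dg].
- exact: differentiable_cst.
- exact: differentiable_coord.
- apply: (differentiable_comp df); apply/derivable1_diffP.
  by case: (is_derive_flat_exp k (f x)).
- exact: differentiableD.
- exact: differentiableM.
Qed.

Lemma derive_coord (i : 'I_n) x v : 'D_v (fun y : 'rV[R]_n => y ord0 i : R) x = v ord0 i.
Proof.
pose c (y : 'rV[R]_n) : R := y ord0 i.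
have lin : linear c by move=> u y z; rewrite /c !mxE.
pose L : {linear 'rV[R]_n -> R} := HB.pack c (GRing.isLinear.Build _ _ _ _ _ lin).
rewrite deriveE; last exact: differentiable_coord.
rewrite (_ : (fun y : 'rV[R]_n => y ord0 i : R) = L)// diff_lin//.
by move=> y; exact: coord_continuous.
Qed.

Lemma smooth_derive f v : smooth f -> smooth (fun x => 'D_v f x).
Proof.
elim=> {f} [c|i|k f sf df|f g sf df sg dg|f g sf df sg dg].
- apply: (eq_smooth (g := fun=> 0)); last exact: smooth_cst.
  by move=> x; rewrite derive_cst.
- apply: (eq_smooth (g := fun=> v ord0 i)); last exact: smooth_cst.
  by move=> x; rewrite [RHS]derive_coord.
- apply: (eq_smooth (g := fun x =>
    (flat_exp k.+2 (f x) + (- k%:R) * flat_exp k.+1 (f x)) * 'D_v f x)); last first.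
    by repeat constructor.
  move=> x; have dfx := smooth_differentiable x sf.
  have [d0 dE] := is_derive_flat_exp k (f x).
  have d1 : differentiable (flat_exp k) (f x) by exact/derivable1_diffP.
  rewrite [RHS]deriveE; last exact: (differentiable_comp dfx d1).
  transitivity ('d (flat_exp k \o f) x v) => //.
  rewrite (diff_comp dfx d1)/= -(deriveE v dfx) -[X in _ = 'd _ _ X]mulr1.
  rewrite [RHS]linearZ -(deriveE (1 : R) d1) dE mulrC mulNr.
  by [].
- apply: (eq_smooth (g := fun x => 'D_v f x + 'D_v g x)); last exact: smoothD.
  move=> x; rewrite -deriveD//; apply: diff_derivable;
  exact: smooth_differentiable.
- apply: (eq_smooth (g := fun x => f x * 'D_v g x + g x * 'D_v f x)); last first.
    by apply: smoothD; exact: smoothM.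
  move=> x; rewrite -[LHS]deriveM//; apply: diff_derivable;
  exact: smooth_differentiable.
Qed.

Lemma smooth_partials ds f : smooth f -> smooth (partials ds f).
Proof. by move=> sf; elim: ds => //= i ds IH; exact: smooth_derive. Qed.

Lemma smooth_sum (I : Type) (r : seq I) (P : pred I) (F : I -> 'rV[R]_n -> R) :
  (forall i, smooth (F i)) -> smooth (fun x => \sum_(i <- r | P i) F i x).
Proof.
move=> sF; elim: r => [|i r IH].
  by apply: eq_smooth (smooth_cst 0) => x; rewrite big_nil.
case: (boolP (P i)) => Pi.
  by apply: eq_smooth (smoothD (sF i) IH) => x; rewrite big_cons Pi.
by apply: eq_smooth IH => x; rewrite big_cons (negbTE Pi).
Qed.

Lemma smooth_prod (I : Type) (r : seq I) (F : I -> 'rV[R]_n -> R) :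
  (forall i, smooth (F i)) -> smooth (fun x => \prod_(i <- r) F i x).
Proof.
move=> sF; elim: r => [|i r IH].
  by apply: eq_smooth (smooth_cst 1) => x; rewrite big_nil.
by apply: eq_smooth (smoothM (sF i) IH) => x; rewrite big_cons.
Qed.

Lemma smooth_aff c b f : smooth f -> smooth (fun x => f (aff c b x)).
Proof.
elim=> {f} [e|i|k f sf df|f g sf df sg dg|f g sf df sg dg]; last 3 first.
- exact: (smooth_flat_exp k df).
- exact: (smoothD df dg).
- exact: (smoothM df dg).
- exact: smooth_cst.
- apply: (eq_smooth (g := fun x => c * x ord0 i + b ord0 i)); first by move=> x; rewrite !mxE.
  by repeat constructor.
Qed.

Lemma smooth_continuous f : smooth f -> continuous f.
Proof. by move=> sf x; exact: differentiable_continuous (smooth_differentiable x sf). Qed.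

Lemma derive_rV_sum f x w : differentiable f x ->
  'D_w f x = \sum_i w ord0 i * 'D_(delta_mx ord0 i) f x.
Proof.
move=> df; rewrite deriveE// {1}(row_sum_delta w) linear_sum.
by apply: eq_bigr => i _; rewrite linearZ/= -deriveE.
Qed.

Lemma derive_aff c b f x v : differentiable f (aff c b x) ->
  'D_v (fun y => f (aff c b y)) x = c * 'D_v f (aff c b x).
Proof.
move=> df.
have da : differentiable (aff c b) x.
  by apply: differentiableD => //; exact: differentiableZ.
rewrite deriveE; last exact: (differentiable_comp da df).
transitivity ('d (f \o aff c b) x v) => //.
rewrite (diff_comp da df)/= deriveE// -[X in _ = X]/(c *: _) -linearZ/=.
congr ('d f _ _); rewrite -deriveE//.
have := is_deriveD (is_deriveZ c (is_derive_id x v)) (is_derive_cst b x v).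
by rewrite addr0 => /(@derive_val _ _ _ _ _ _ _).
Qed.

Lemma is_derive_line f x w (s : R) : differentiable f (s *: w + x) ->
  is_derive s 1 (fun s : R => f (s *: w + x)) ('D_w f (s *: w + x)).
Proof.
move=> df.
have dl : differentiable (fun s : R => s *: w + x) s.
  by apply: differentiableD => //; exact: differentiableZl.
have dc := differentiable_comp dl df.
apply: DeriveDef; first exact/derivable1_diffP.
rewrite [LHS]deriveE//; transitivity ('d (f \o (fun s : R => s *: w + x)) s 1) => //.
rewrite (diff_comp dl df)/= [RHS]deriveE//; congr ('d f _ _).
rewrite -deriveE//.
have dw : is_derive s 1 (fun s : R => s *: w) w.
  apply: DeriveDef; first by apply/derivable1_diffP; exact: differentiableZl.
  rewrite deriveE; last exact: differentiableZl.
  have [_ ->] := is_diff_scalel s w; by rewrite scale1r.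
by have := is_deriveD dw (is_derive_cst x s 1); rewrite addr0 => /(@derive_val _ _ _ _ _ _ _).
Qed.

End smooth.

(** * Compact supports, bumps on boxes, boxes as generators *)

Section compact_support.
Context {R : realType} {n : nat}.
Local Notation mu := (lebesgue_rV R n).
Implicit Types (U K : set 'rV[R]_n) (f phi : 'rV[R]_n -> R).

Definition compact_supp U phi :=
  exists2 K, compact K /\ K `<=` U & forall x, ~ K x -> phi x = 0.

Lemma compact_measurable_rV K : compact K -> measurable K.
Proof. by move=> cK; apply: closed_measurable_rV; apply: compact_closed. Qed.

Lemma continuous_compact_bounded K phi :
  {within K, continuous phi} -> compact K -> [bounded phi x | x in K].
Proof.
move=> cphi cK; have /compact_bounded[M [Mr HM]] := continuous_compact cphi cK.
by exists M; split => // x /HM Hx y Ky; apply: Hx; exists y.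
Qed.

(** On the compact set [K] the factor [phi] is bounded and [f] is integrable; elsewhere the product
    vanishes. *)
Lemma integrable_compact_supp U f phi : measurable U -> measurable_fun U f ->
  (forall K, compact K -> K `<=` U -> mu.-integrable K (EFin \o f)) ->
  continuous phi -> compact_supp U phi ->
  mu.-integrable U (EFin \o (fun x => f x * phi x)).
Proof.
move=> mU mf fi cphi [K [cK KU] phi0].
have mK := compact_measurable_rV cK.
have H : mu.-integrable K (EFin \o (fun x => f x * phi x)).
  rewrite (_ : _ \o _ = (EFin \o phi) \* (EFin \o f))%E; last first.
    by apply/funext => x /=; rewrite -EFinM mulrC.
  apply: integrableMr => //; last exact: fi.
    by apply: measurable_funTS; exact: continuous_measurableT_rV.
  by apply: continuous_compact_bounded => //; exact: continuous_subspaceT.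
apply/integrable_mkcond => //; move/integrable_mkcond : H => /(_ mK).
rewrite (_ : (_ \_ K)%E = (EFin \o (fun x => f x * phi x)) \_ U)//.
apply/funext => x; rewrite /patch; case: ifPn => xK.
  by rewrite ifT// inE; apply: KU; rewrite inE in xK.
by case: ifP => // _ /=; rewrite phi0 ?mulr0// => Kx; move: xK; rewrite notin_setE.
Qed.

(** As [m] grows these functions tend pointwise to the indicator of the open box, and each of them
    vanishes outside it. One box thus carries the whole approximating sequence. *)
Definition box_bump (m : nat) (a b : 'rV[R]_n) (x : 'rV[R]_n) : R :=
  \prod_i (flat_exp 0 (m.+1%:R * (x ord0 i - a ord0 i)) *
           flat_exp 0 (m.+1%:R * (b ord0 i - x ord0 i))).

Lemma smooth_box_bump m a b : smooth (box_bump m a b).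
Proof.
apply: smooth_prod => i; apply: smoothM; apply: smooth_flat_exp; apply: smoothM;
  [exact: smooth_cst| |exact: smooth_cst|];
  by apply: smoothB; [exact: smooth_coord || exact: smooth_cst..].
Qed.

Lemma box_bump_itv m a b x : 0 <= box_bump m a b x <= 1.
Proof.
have H i : 0 <= flat_exp 0 (m.+1%:R * (x ord0 i - a ord0 i)) *
           flat_exp 0 (m.+1%:R * (b ord0 i - x ord0 i)) <= 1.
  have /andP[? ?] := flat_exp0_lt1 (m.+1%:R * (x ord0 i - a ord0 i)).
  have /andP[? ?] := flat_exp0_lt1 (m.+1%:R * (b ord0 i - x ord0 i)).
  by rewrite mulr_ge0//= mulr_ile1.
apply/andP; split; first by apply: prodr_ge0 => i _; case/andP: (H i).
by apply: prodr_ile1 => i _; exact: H.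
Qed.

Lemma box_bump_out m a b x : ~ box a b x -> box_bump m a b x = 0.
Proof.
move=> /existsNP[i /negP]; rewrite negb_and -!leNgt => H.
rewrite /box_bump (bigD1 i)//=; case/orP : H => H.
  by rewrite flat_exp_le0 ?mul0r// pmulr_rle0// subr_le0.
by rewrite [X in _ * X * _]flat_exp_le0 ?mulr0 ?mul0r// pmulr_rle0// subr_le0.
Qed.

Lemma cvg_box_bump a b x : box_bump m a b x @[m --> \oo] --> (\1_(box a b) x : R).
Proof.
have [xab|xab] := pselect (box a b x); last first.
  rewrite indicE memNset//; apply: cvg_near_cst; near=> m.
  by rewrite box_bump_out.
rewrite indicE mem_set//.
have -> : 1%:R = \prod_(i < n) 1 :> R by rewrite big1.
apply: cvg_big => [|i _]; first exact: mul_continuous.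
have /andP[ax xb] := xab i; rewrite -subr_gt0 in ax; rewrite -subr_gt0 in xb.
have E : (1 : R) * 1 = 1 by rewrite mulr1.
have H := cvgM (cvg_flat_exp0 ax) (cvg_flat_exp0 xb); rewrite E in H; exact: H.
Unshelve. all: by end_near. Qed.

Lemma rV_norm_le (x : 'rV[R]_n) (M : R) : 0 <= M ->
  (forall i, `|x ord0 i| <= M) -> `|x| <= M.
Proof.
move=> M0 xM; rewrite [leLHS]/Num.Def.normr/= mx_normrE.
by apply: bigmax_le => // -[i j] _ /=; rewrite (ord1 i).
Qed.

Lemma compact_closure_box (a b : 'rV[R]_n) : compact (closure (box a b)).
Proof.
apply: bounded_closed_compact; last exact: closed_closure.
exists (`|a| + `|b| + 1); split => // M HM x cx.
have /(cx _) [y [yab]] : nbhs x (ball x 1) by apply: nbhsx_ballx.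
move=> xy; have {}xy : box (x - const_mx 1) (x + const_mx 1) y by rewrite -ball_box.
have M0 : 0 <= M by rewrite (le_trans _ (ltW HM))// !addr_ge0.
apply: rV_norm_le => // j; apply: le_trans (ltW HM); have := xy j; have := yab j.
have := ler_norm_coord a j; have := ler_norm_coord b j.
rewrite !ler_norml !mxE => /andP[? ?] /andP[? ?] /andP[? ?] /andP[? ?].
have := normr_ge0 a; have := normr_ge0 b => ? ?.
by apply/andP; split; lra.
Qed.

Lemma boxI (a b c d : 'rV[R]_n) : box a b `&` box c d =
  box (\row_i Num.max (a ord0 i) (c ord0 i)) (\row_i Num.min (b ord0 i) (d ord0 i)).
Proof.
apply/seteqP; split => x /=.
  move=> [H1 H2] i; rewrite !mxE gt_max lt_min.
  by have /andP[-> ->] := H1 i; have /andP[-> ->] := H2 i.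
move=> H; split => i; have := H i; rewrite !mxE gt_max lt_min;
  by move=> /andP[/andP[? ?] /andP[? ?]]; apply/andP.
Qed.

Definition boxes := [set A : set 'rV[R]_n | exists a b, A = box a b].

(** Boxes are also stable under intersection by [boxI], so they form a pi-system that generates the
    sigma-algebra, as Dynkin's induction requires. *)
Lemma measurable_boxes : measurable = <<s boxes >>.
Proof.
apply/seteqP; split; last first.
  apply: smallest_sub; first exact: sigma_algebra_measurable.
  by move=> _ [a [b ->]]; exact: measurable_box.
have open_boxes (U : set 'rV[R]_n) : open U -> <<s boxes >> U.
  move=> oU.
  rewrite (_ : U = \bigcup_p (if `[< rat_box p `<=` U >] then rat_box p else set0)).
    apply: (@countable_bigcupT_measurable _ (g_sigma_algebraType boxes)).
      exact: countableP.
    move=> p; case: ifP => // _.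
    by apply: sub_sigma_algebra; rewrite /boxes/=; do 2 eexists.
  apply/seteqP; split => [x Ux|x [p _]].
    have [p [px pU]] := open_rat_box oU Ux; exists p => //.
    rewrite ifT//; apply/asboolP; apply: subset_trans pU; exact: subset_closure.
  by case: ifPn => // /asboolP; exact.
apply: smallest_sub; first exact: smallest_sigma_algebra.
move=> A; rewrite -bigcup_seq/= => -[i _] [B mB <-]; rewrite setTI.
have : measurable_fun setT
    ((fun v => v ord0 i) : g_sigma_algebraType boxes -> measurableTypeR R).
  apply: (measurability _ (RGenOpens.measurableE R)).
  move=> _ [_ [a [b ->] <-]]; rewrite setTI; apply: open_boxes.
  by apply: open_comp; [move=> y _; exact: coord_continuous|exact: interval_open].
by move=> /(_ measurableT _ mB); rewrite setTI.
Qed.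

End compact_support.
(** * The fundamental lemma of the calculus of variations *)

Section fundamental_lemma.
Context {R : realType} {n : nat}.
Local Notation mu := (lebesgue_rV R n).
Implicit Types (U K : set 'rV[R]_n) (f phi : 'rV[R]_n -> R).

Lemma ae_countable (I : countType) (P : I -> 'rV[R]_n -> Prop) :
  (forall i, {ae mu, forall x, P i x}) -> {ae mu, forall x, forall i, P i x}.
Proof.
move=> HP; pose F k := if unpickle k is Some i then ~` [set x | P i x] else set0.
suff : mu.-negligible (~` [set x | forall i, P i x]) by [].
have HF : ~` [set x | forall i, P i x] `<=` \bigcup_k F k.
  move=> x /= /existsNP[i Pi]; exists (pickle i) => //.
  by rewrite /F pickleK.
apply: negligibleS HF _; apply: negligible_bigcup => k; rewrite /F; case: unpickle => [i|].
  exact: HP.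
exact: negligible_set0.
Qed.

(** The bumps of the box are admissible test functions bounded by 1 and tend to its indicator;
    dominated convergence concludes. *)
Lemma integral_box_eq0 U f (a b : 'rV[R]_n) : open U -> measurable_fun U f ->
  (forall K, compact K -> K `<=` U -> mu.-integrable K (EFin \o f)) ->
  (forall phi, smooth phi -> compact_supp U phi ->
     \int[mu]_(x in U) (f x * phi x) = 0) ->
  closure (box a b) `<=` U -> (\int[mu]_(x in box a b) (f x)%:E = 0)%E.
Proof.
move=> oU mf fi f0 abU.
have mU := open_measurable_rV oU; have mb := measurable_box a b.
have boxU : box a b `<=` U by apply: subset_trans abU; exact: subset_closure.
have mfb : measurable_fun (box a b) f by exact: measurable_funS mf.
have bump_supp m : compact_supp U (box_bump m a b).
  exists (closure (box a b)); first by split => //; exact: compact_closure_box.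
  by move=> x xab; apply: box_bump_out => ?; apply: xab; exact: subset_closure.
have cbump m : continuous (box_bump m a b) by apply: smooth_continuous; exact: smooth_box_bump.
have fib : mu.-integrable (box a b) (EFin \o f).
  apply: (integrableS (E := closure (box a b))) => //.
  - exact: closed_measurable_rV (@closed_closure _ _).
  - exact: subset_closure.
  - by apply: fi => //; exact: compact_closure_box.
have fm0 m : (\int[mu]_(x in box a b) (f x * box_bump m a b x)%:E = 0)%E.
  have fbi := integrable_compact_supp mU mf fi (cbump m) (bump_supp m).
  transitivity (\int[mu]_(x in U) (f x * box_bump m a b x)%:E)%E.
    rewrite [LHS]integral_mkcond [RHS]integral_mkcond; congr (integral _ _ _).
    apply/funext => x; rewrite /patch; case: ifPn => xab.
      by rewrite ifT// inE; apply: boxU; rewrite inE in xab.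
    case: ifP => // _; rewrite box_bump_out ?mulr0// => ?.
    by move: xab; rewrite notin_setE.
  rewrite -[LHS]fineK; last exact: integrable_fin_num fbi.
  by have := f0 _ (smooth_box_bump m a b) (bump_supp m); rewrite /Rintegral => ->.
pose F m (x : 'rV[R]_n) := (f x * box_bump m a b x)%:E.
have mF m : measurable_fun (box a b) (F m).
  apply/measurable_EFinP; apply: measurable_funM => //.
  by apply: measurable_funTS; exact: continuous_measurableT_rV.
have mfE : measurable_fun (box a b) (EFin \o f) by exact/measurable_EFinP.
have Ff : {ae mu, forall x, box a b x -> F^~ x @ \oo --> (EFin \o f) x}.
  apply: aeW => x xab; apply: cvg_EFin; first by near=> m.
  have : f x * box_bump m a b x @[m --> \oo] --> (f x * \1_(box a b) x : R).
    by apply: cvgMr; exact: cvg_box_bump.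
  by rewrite indicE mem_set// mulr1.
have Fg : {ae mu, forall x m, box a b x -> (`|F m x| <= (abse \o (EFin \o f)) x)%E}.
  apply: aeW => x m xab /=; rewrite lee_fin normrM ler_piMr//.
  by have /andP[? ?] := box_bump_itv m a b x; rewrite ger0_norm.
have [_ _] := dominated_convergence mb mF mfE Ff (integrable_abse fib) Fg.
under eq_fun do rewrite fm0.
by move=> H; apply/esym; apply: (cvg_unique _ _ H) => //; exact: cvg_cst.
Unshelve. all: by end_near. Qed.

(** On a cube of the countable base with closure in [U], the integral of [f] vanishes over subboxes,
    hence over all measurable subsets by Dynkin's induction; so [f] vanishes almost everywhere
    there. Such cubes cover [U]. *)
Lemma fundamental_lemma U f : open U -> measurable_fun U f ->
  (forall K, compact K -> K `<=` U -> mu.-integrable K (EFin \o f)) ->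
  (forall phi, smooth phi -> compact_supp U phi ->
     \int[mu]_(x in U) (f x * phi x) = 0) ->
  {ae mu, forall x, U x -> f x = 0}.
Proof.
move=> oU mf fi f0; have mU := open_measurable_rV oU.
have H p : {ae mu, forall x, closure (@rat_box R n p) `<=` U -> rat_box p x -> f x = 0}.
  have [pU|npU] := pselect (closure (@rat_box R n p) `<=` U); last exact: aeW.
  set Q : set 'rV[R]_n := rat_box p in pU *.
  have mQ : measurable Q by exact: measurable_box.
  have QU : Q `<=` U by apply: subset_trans pU; exact: subset_closure.
  have fiQ : mu.-integrable Q (EFin \o f).
    apply: (integrableS (E := closure Q)) => //.
    - exact: closed_measurable_rV (@closed_closure _ _).
    - exact: subset_closure.
    - by apply: fi => //; exact: compact_closure_box.
  have fiA A : measurable A -> mu.-integrable (A `&` Q) (EFin \o f).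
    by move=> mA; apply: (integrableS (E := Q)) => //; exact: measurableI.
  have int0 A : measurable A -> (\int[mu]_(x in A `&` Q) (f x)%:E = 0)%E.
    rewrite measurable_boxes.
    apply: (@dynkin_induction _ _ boxes
      (fun A => \int[mu]_(x in A `&` Q) (f x)%:E = 0)%E).
    - exact: measurable_boxes.
    - move=> _ _ [a1 [b1 ->]] [a2 [b2 ->]]; rewrite boxI.
      by rewrite /boxes/=; do 2 eexists.
    - by rewrite setTI; exact: (integral_box_eq0 (U := U)).
    - move=> _ [a1 [b1 ->]]; rewrite /Q /rat_box boxI; apply: (integral_box_eq0 (U := U)) => //.
      by rewrite -boxI; apply: subset_trans pU; apply: closureS; exact: subIsetr.
    - move=> S mS S0.
      have : (\int[mu]_(x in (S `&` Q) `|` (~` S `&` Q)) (f x)%:E = 0)%E.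
        by rewrite -setIUl setUv setTI; exact: (integral_box_eq0 (U := U)).
      rewrite integral_setU ?S0 ?add0e//.
      + exact: measurableI.
      + by apply: measurableI => //; exact: measurableC.
      + apply/measurable_EFinP; apply: (measurable_funS mQ) => //; last exact: measurable_funS mf.
        by move=> x [] [].
      + by apply/disj_setPS => x [[Sx _] []].
    - move=> F mF tF F0; rewrite setI_bigcupl integral_bigcup//.
      + by rewrite eseries0// => k _ _; exact: F0.
      + apply/trivIsetP => i j _ _ ij; rewrite setIACA setIid.
        by move/trivIsetP : tF => /(_ i j I I ij) ->; rewrite set0I.
      + by move=> k; exact: measurableI.
      + by rewrite -setI_bigcupl; apply: fiA; exact: bigcupT_measurable.
  have := @integral_ae_eq _ _ _ mu Q mQ (cst 0%E) (EFin \o f) fiQ (measurable_cst _).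
  have E0 E : E `<=` Q -> measurable E ->
      (\int[mu]_(x in E) (EFin \o f) x = \int[mu]_(x in E) cst 0 x)%E.
    by move=> EQ mE; rewrite integral0 -(setIidl EQ); exact: int0.
  move=> /(_ E0); apply: filterS => x Hx _ Qx.
  by have [] := Hx Qx.
have := ae_countable H; apply: filterS => x Hx Ux.
by have [p [px pU]] := open_rat_box oU Ux; exact: Hx pU px.
Qed.

End fundamental_lemma.
(** * Taylor's formula for weak derivatives *)

Section euler_operator.
Context {R : realType} {n : nat}.
Variable a : 'rV[R]_n.
Implicit Types (f : 'rV[R]_n -> R) (x w : 'rV[R]_n) (i j : 'I_n).

(** The radial derivative about [a], the generator of the dilations centred at [a]. *)
Definition euler f x : R := \sum_i (x ord0 i - a ord0 i) * 'D_(delta_mx ord0 i) f x.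

(* The derivative at [c = 1] of [c ^+ k * f (a + c *: (x - a))]. *)
Definition euler_shift (k : nat) f x : R := k%:R * f x + euler f x.

Lemma smooth_shift i : smooth (fun x : 'rV[R]_n => x ord0 i - a ord0 i).
Proof. by apply: smoothB; [exact: smooth_coord|exact: smooth_cst]. Qed.

Lemma smooth_euler f : smooth f -> smooth (euler f).
Proof.
move=> sf; apply: smooth_sum => i; apply: smoothM; first exact: smooth_shift.
exact: smooth_derive.
Qed.

Lemma smooth_euler_shift k f : smooth f -> smooth (euler_shift k f).
Proof.
move=> sf; apply: smoothD; last exact: smooth_euler.
by apply: smoothM => //; exact: smooth_cst.
Qed.

Lemma derive_smoothM f g v x : smooth f -> smooth g ->
  'D_v (fun y => f y * g y) x = f x * 'D_v g x + g x * 'D_v f x.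
Proof.
by move=> sf sg; rewrite [LHS]deriveM//; apply: diff_derivable;
  exact: smooth_differentiable.
Qed.

Lemma derive_smooth_sum (F : 'I_n -> 'rV[R]_n -> R) v x : (forall i, smooth (F i)) ->
  'D_v (fun y => \sum_i F i y) x = \sum_i 'D_v (F i) x.
Proof.
move=> sF; rewrite (_ : (fun y => \sum_i F i y) = \sum_i F i); last first.
  by apply/funext => y; rewrite fct_sumE.
by rewrite derive_sum// => i; apply: diff_derivable; exact: smooth_differentiable.
Qed.

Lemma derive_shift i v x : 'D_v (fun y : 'rV[R]_n => y ord0 i - a ord0 i) x = v ord0 i.
Proof.
rewrite (_ : (fun y : 'rV[R]_n => y ord0 i - a ord0 i) =
   (fun y : 'rV[R]_n => y ord0 i : R) - cst (a ord0 i))//.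
rewrite deriveB//; last exact: diff_derivable (differentiable_coord _ _ _).
by rewrite derive_coord derive_cst subr0.
Qed.

(** The left side is the divergence of the vector field [f * (x - a)], so that integrating
    [u * euler_shift n f] produces the weak gradient of [u]. *)
Lemma euler_shift_div f x : smooth f ->
  \sum_i 'D_(delta_mx ord0 i) (fun y : 'rV[R]_n => (y ord0 i - a ord0 i) * f y) x =
  euler_shift n f x.
Proof.
move=> sf; rewrite /euler_shift /euler.
under eq_bigr => i _.
  rewrite derive_smoothM//; last exact: smooth_shift.
  rewrite derive_shift mxE !eqxx mulr1; over.
by rewrite big_split/= addrC sumr_const card_ord mulr_natl.
Qed.

(** The left side is the double divergence of the tensor [f * (x - a) (x - a)^T]. It rewrites the
    second derivative of a dilated test function by second partial derivatives, to which the
    definition of the weak Hessian applies. *)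
Lemma euler_shift_div2 f x : smooth f ->
  \sum_i \sum_j partials [:: i; j]
     (fun y : 'rV[R]_n => (y ord0 i - a ord0 i) * (y ord0 j - a ord0 j) * f y) x =
  euler_shift n.+1 (euler_shift n f) x.
Proof.
move=> sf.
pose g i (y : 'rV[R]_n) := (y ord0 i - a ord0 i) * f y.
have sg i : smooth (g i) by apply: smoothM => //; exact: smooth_shift.
(* The inner divergence also differentiates the factor of index [i]; this gives the extra [f], which
   finally turns [n] into [n + 1]. *)
have E i : (fun y : 'rV[R]_n => \sum_j 'D_(delta_mx ord0 j)
     (fun z : 'rV[R]_n => (z ord0 i - a ord0 i) * (z ord0 j - a ord0 j) * f z) y) =
   fun y : 'rV[R]_n => (y ord0 i - a ord0 i) * (euler_shift n f y + f y).
  apply/funext => y.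
  transitivity (\sum_j 'D_(delta_mx ord0 j) (fun z : 'rV[R]_n => (z ord0 j - a ord0 j) * g i z) y).
    have gE j : (fun z : 'rV[R]_n => (z ord0 i - a ord0 i) * (z ord0 j - a ord0 j) * f z) =
        (fun z : 'rV[R]_n => (z ord0 j - a ord0 j) * g i z).
      by apply/funext => z; rewrite /g mulrA [X in X * f z]mulrC.
    by apply: eq_bigr => j _; rewrite gE.
  rewrite euler_shift_div// /euler_shift /euler.
  under eq_bigr => j _.
    rewrite /g derive_smoothM//; last exact: smooth_shift.
    rewrite derive_shift mxE eqxx/= mulrDr; over.
  rewrite big_split/= [X in _ + (_ + X)](_ : _ = g i y); last first.
    rewrite (bigD1 i)//= eqxx mulr1 big1 ?addr0// => j ji.
    by rewrite eq_sym (negbTE ji) mulr0 mulr0.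
  rewrite [X in _ + (X + _)](_ : _ =
    (y ord0 i - a ord0 i) * \sum_j (y ord0 j - a ord0 j) * 'D_(delta_mx ord0 j) f y); last first.
    by rewrite mulr_sumr; apply: eq_bigr => j _; rewrite mulrCA.
  by rewrite /g; ring.
transitivity (\sum_i 'D_(delta_mx ord0 i) (fun y : 'rV[R]_n =>
    (y ord0 i - a ord0 i) * (euler_shift n f y + f y)) x).
  apply: eq_bigr => i _; rewrite -E derive_smooth_sum// => j.
  apply: smooth_derive; apply: smoothM => //; apply: smoothM; exact: smooth_shift.
have sL := smooth_euler_shift n sf.
rewrite euler_shift_div; last exact: smoothD.
have -> : euler_shift n (fun y => euler_shift n f y + f y) x =
    euler_shift n (euler_shift n f) x + euler_shift n f x.
  rewrite {1 3 5}/euler_shift mulrDr addrACA; congr (_ + _).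
  rewrite /euler -big_split/=; apply: eq_bigr => i _; rewrite -mulrDr; congr (_ * _).
  by rewrite [LHS]deriveD//; apply: diff_derivable; exact: smooth_differentiable.
by rewrite /euler_shift -natr1; ring.
Qed.

(** Each derivative raises the power of [(1 - r)^-1] by one, so the formula can be applied with
    [k = n] and again with [k = n + 1]. *)
Lemma is_derive_dilation (k : nat) f w (r : R) : smooth f -> r < 1 ->
  is_derive r 1 (fun r : R => (1 - r)^-1 ^+ k * f ((1 - r)^-1 *: w + a))
    ((1 - r)^-1 ^+ k.+1 * euler_shift k f ((1 - r)^-1 *: w + a)).
Proof.
move=> sf r1; have r0 : 1 - r != 0 by rewrite gt_eqF// subr_gt0.
set c := (1 - r)^-1.
have dc : is_derive r 1 (fun r : R => (1 - r)^-1) (c ^+ 2).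
  have d1 : is_derive r 1 (fun r : R => 1 - r) (-1).
    by have := is_deriveB (is_derive_cst (1 : R) r (1 : R)) (is_derive_id r (1 : R)); rewrite sub0r.
  have := @is_deriveV _ (fun r : R => 1 - r) _ _ _ r0 d1; rewrite -exprVn -/c.
  by move/is_derive_eq; apply; rewrite /GRing.scale/=; ring.
have dl : is_derive r 1 (fun r : R => f ((1 - r)^-1 *: w + a)) ('D_w f (c *: w + a) * c ^+ 2).
  apply: (@is_derive1_comp _ (fun s : R => f (s *: w + a)) (fun r : R => (1 - r)^-1)) => //.
  by apply: is_derive_line; exact: smooth_differentiable.
have := is_deriveM (is_deriveX k dc) dl.
rewrite (_ : _ * _ = fun r : R => (1 - r)^-1 ^+ k * f ((1 - r)^-1 *: w + a)); last first.
  by apply/funext => y; rewrite !fctE.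
move=> H; apply: (is_derive_eq H); rewrite !fctE -/c /GRing.scale/=.
have -> : euler_shift k f (c *: w + a) = k%:R * f (c *: w + a) + c * 'D_w f (c *: w + a).
  rewrite /euler_shift; congr (_ + _); rewrite derive_rV_sum; last exact: smooth_differentiable.
  by rewrite mulr_sumr; apply: eq_bigr => i _; rewrite !mxE addrK mulrA.
case: k {H} => [|k]; first by ring.
by rewrite -[k.+1.-1]/k !exprS; ring.
Qed.

(* [t - r] times the second derivative in [r] of [(1 - r) ^- n * f (a + (1 - r)^-1 *: w)]. *)
Definition dilation_kernel f w (t r : R) : R :=
  (t - r) * ((1 - r)^-1 ^+ n.+2 *
    euler_shift n.+1 (euler_shift n f) ((1 - r)^-1 *: w + a)).

(** Second-order Taylor formula with integral remainder, between 0 and [t], for the one-variable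
    function [G r = (1 - r) ^- n * f (a + (1 - r)^-1 *: w)]. *)
Lemma dilation_taylor f w (t : R) : smooth f -> 0 < t < 1 ->
  lebesgue_measure.-integrable `[0, t] (EFin \o dilation_kernel f w t) /\
  (\int[lebesgue_measure]_(r in `[0%R, t]) (dilation_kernel f w t r)%:E =
  ((1 - t)^-1 ^+ n * f ((1 - t)^-1 *: w + a) - f (w + a) - t * euler_shift n f (w + a))%:E)%E.
Proof.
move=> sf /andP[t0 t1].
pose c r : R := (1 - r)^-1.
(* This is [(t - r) * G' r + G r], with derivative [(t - r) * G'' r]. *)
pose F r : R := (t - r) * (c r ^+ n.+1 * euler_shift n f (c r *: w + a)) +
  c r ^+ n * f (c r *: w + a).
pose f' r : R := dilation_kernel f w t r.
have sL := smooth_euler_shift n sf; have sM := smooth_euler_shift n.+1 sL.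
have dtr (r : R) : is_derive r 1 (fun r : R => t - r) (-1).
  by have := is_deriveB (is_derive_cst t r (1 : R)) (is_derive_id r (1 : R)); rewrite sub0r.
have dF (r : R) : r < 1 -> is_derive r 1 F (f' r).
  move=> r1; have H1 := is_derive_dilation n.+1 w sL r1.
  have H2 := is_derive_dilation n w sf r1.
  have := is_deriveD (is_deriveM (dtr r) H1) H2.
  rewrite (_ : _ + _ = F); last by apply/funext => y; rewrite !fctE.
  move=> H; apply: (is_derive_eq H); rewrite /f' /dilation_kernel /GRing.scale/= -/(c r).
  by rewrite !exprS; ring.
have df' (r : R) : r < 1 -> differentiable f' r.
  move=> r1; have H1 := is_derive_dilation n.+2 w sM r1.
  have [H _] := is_deriveM (dtr r) H1; apply/derivable1_diffP.
  by rewrite (_ : f' = (fun r : R => t - r) * (fun r : R => c r ^+ n.+2 *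
       euler_shift n.+1 (euler_shift n f) (c r *: w + a))).
have rt (r : R) : r \in `[0, t] -> r < 1.
  by rewrite in_itv/= => /andP[_ rt]; exact: le_lt_trans t1.
have cF (r : R) : r < 1 -> {for r, continuous F}.
  move=> r1; apply: differentiable_continuous; apply/derivable1_diffP.
  by case: (dF r r1).
have cf' : {within `[0, t], continuous f'}.
  apply: continuous_in_subspaceT => r; rewrite inE/= => /rt r1.
  exact/differentiable_continuous/df'.
split; first exact: continuous_compact_integrable (@segment_compact _ _ _) cf'.
rewrite (@continuous_FTC2 _ f' F 0 t)//.
- rewrite /F subrr mul0r add0r /c !subr0 invr1 !expr1n !mul1r scale1r.
  by rewrite -EFinB; congr (_%:E); ring.
- split.
  + by move=> r /subset_itv_oo_cc/rt/dF[].
  + by apply: cvg_at_right_filter; exact: (cF 0).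
  + by apply: cvg_at_left_filter; exact: (cF t).
- by move=> r /subset_itv_oo_cc/rt/dF H; rewrite derive1E derive_val.
Qed.

End euler_operator.

(** * Integrability on products and under homotheties *)

Section real_integrals.
Context d (T : measurableType d) (R : realType) (mu : {measure set T -> \bar R}).
Implicit Types (f g : T -> R).

Lemma integrable_EFinD f g : mu.-integrable setT (EFin \o f) ->
  mu.-integrable setT (EFin \o g) -> mu.-integrable setT (EFin \o (fun x => f x + g x)).
Proof. by move=> fi gi; exact: (integrableD measurableT fi gi). Qed.

Lemma integrable_EFinZ (k : R) f : mu.-integrable setT (EFin \o f) ->
  mu.-integrable setT (EFin \o (fun x => k * f x)).
Proof. by move=> fi; exact: (integrableZl measurableT k fi). Qed.

Lemma integrable_EFinB f g : mu.-integrable setT (EFin \o f) ->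
  mu.-integrable setT (EFin \o g) -> mu.-integrable setT (EFin \o (fun x => f x - g x)).
Proof. by move=> fi gi; exact: (integrableB measurableT fi gi). Qed.

Lemma integrable_EFin_sum (I : Type) (r : seq I) (F : I -> T -> R) :
  (forall i, mu.-integrable setT (EFin \o F i)) ->
  mu.-integrable setT (EFin \o (fun x => \sum_(i <- r) F i x)).
Proof.
move=> Fi; rewrite (_ : _ \o _ = fun x => (\sum_(i <- r) (F i x)%:E)%E); last first.
  by apply/funext => x /=; rewrite sumEFin.
by apply: integrable_sum => // i _; exact: Fi.
Qed.

Lemma Rintegral_sum (I : Type) (r : seq I) (F : I -> T -> R) :
  (forall i, mu.-integrable setT (EFin \o F i)) ->
  \int[mu]_x (\sum_(i <- r) F i x) = \sum_(i <- r) \int[mu]_x F i x.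
Proof.
move=> Fi; elim: r => [|i r IH].
  rewrite big_nil (_ : (fun x => _) = cst 0); last by apply/funext => x; rewrite big_nil.
  by rewrite Rintegral_cst// mul0r.
rewrite big_cons -IH -RintegralD//; last exact: integrable_EFin_sum.
by congr Rintegral; apply/funext => x; rewrite big_cons.
Qed.

Lemma le_integrable_EFin f g : measurable_fun setT f -> (forall x, `|f x| <= g x) ->
  mu.-integrable setT (EFin \o g) -> mu.-integrable setT (EFin \o f).
Proof.
move=> mf fg; apply: le_integrable => //; first exact/measurable_EFinP.
by move=> x _ /=; rewrite lee_fin (le_trans (fg x))// ler_norm.
Qed.

Lemma integrable_EFinM f g (C : R) : measurable_fun setT f -> (forall x, `|f x| <= C) ->
  mu.-integrable setT (EFin \o g) -> mu.-integrable setT (EFin \o (fun x => g x * f x)).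
Proof.
move=> mf fC gi; have := integrable_EFinZ C (integrable_norm gi).
apply: le_integrable_EFin => [|x /=].
  apply: measurable_funM => //; apply/measurable_EFinP; exact: measurable_int gi.
by rewrite normrM mulrC ler_wpM2r.
Qed.

End real_integrals.

Section dilation.
Context {R : realType} {n : nat}.
Local Notation mu := (lebesgue_rV R n).

Lemma integrable_aff (c : R) (b : 'rV[R]_n) (F : 'rV[R]_n -> \bar R) : 0 < c ->
  mu.-integrable setT F -> mu.-integrable setT (fun x => F (aff c b x)).
Proof.
move=> c0 /integrableP[mF Foo]; apply/integrableP; split.
  by apply: measurableT_comp => //; exact: measurable_affine_rV.
have cn0 : 0 < c ^+ n by rewrite exprn_gt0.
move: Foo; rewrite (ge0_integral_affine_rV b c0)//; last exact: measurableT_comp.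
set I := (\int[mu]_x _)%E => H; rewrite ltey; apply: contraTN H => /eqP ->.
by rewrite gt0_muley ?lte_fin// ltxx.
Qed.

Lemma integral_aff (c : R) (b : 'rV[R]_n) (F : 'rV[R]_n -> \bar R) : 0 < c ->
  mu.-integrable setT F ->
  (\int[mu]_x F x = (c ^+ n)%:E * \int[mu]_x F (aff c b x))%E.
Proof.
move=> c0 Fi; have Fai := integrable_aff b c0 Fi.
have mF := measurable_int _ Fi.
rewrite [in LHS]integralE [in RHS]integralE muleBr//; last first.
  apply: fin_num_adde_defl; rewrite fin_numN.
  apply: integrable_fin_num => //.
  exact: (integrable_funeneg measurableT Fai).
congr (_ - _)%E.
  rewrite (ge0_integral_affine_rV b c0)//; last exact: measurable_funepos.
  by congr (_ * _)%E; apply: eq_integral => x _; rewrite !funeposE.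
rewrite (ge0_integral_affine_rV b c0)//; last exact: measurable_funeneg.
by congr (_ * _)%E; apply: eq_integral => x _; rewrite !funenegE.
Qed.

Lemma Rintegral_aff (c : R) (b : 'rV[R]_n) (f : 'rV[R]_n -> R) : 0 < c ->
  mu.-integrable setT (EFin \o f) ->
  \int[mu]_x f x = c ^+ n * \int[mu]_x f (aff c b x).
Proof.
move=> c0 fi; rewrite /Rintegral (integral_aff b c0 fi) fineM//.
by apply: integrable_fin_num => //; exact: integrable_aff c0 fi.
Qed.

Lemma aff_inv (c : R) (b x : 'rV[R]_n) : c != 0 ->
  aff c^-1 (- (c^-1 *: b)) (aff c b x) = x.
Proof. by move=> c0; rewrite /aff scalerDr scalerA mulVf// scale1r addrK. Qed.

Lemma aff_invK (c : R) (b x : 'rV[R]_n) : c != 0 ->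
  aff c b (aff c^-1 (- (c^-1 *: b)) x) = x.
Proof. by move=> c0; rewrite /aff scalerBr !scalerA mulfV// !scale1r subrK. Qed.

Lemma continuous_aff (c : R) (b : 'rV[R]_n) : continuous (aff c b).
Proof.
move=> x; apply: differentiable_continuous.
by apply: differentiableD => //; exact: differentiableZ.
Qed.

(** The support is carried along by [aff c b]. This makes a test function of [U], composed with the
    inverse homothety, a test function of [Omega]. *)
Lemma compact_supp_aff (U Omega : set 'rV[R]_n) (c : R) (b : 'rV[R]_n) phi : c != 0 ->
  compact_supp U phi -> (forall x, U x -> Omega (aff c b x)) ->
  compact_supp Omega (fun y => phi (aff c^-1 (- (c^-1 *: b)) y)).
Proof.
move=> c0 [K [cK KU] phi0] UO; exists (aff c b @` K).
  split; last by move=> _ [x /KU/UO Ox <-].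
  by apply: continuous_compact => //; apply: continuous_subspaceT; exact: continuous_aff.
move=> y Ky; apply: phi0 => Ky'; apply: Ky; exists (aff c^-1 (- (c^-1 *: b)) y) => //.
exact: aff_invK.
Qed.

Lemma compact_supp_derive (U : set 'rV[R]_n) phi v : compact_supp U phi ->
  compact_supp U (fun x => 'D_v phi x).
Proof.
move=> [K [cK KU] phi0]; exists K => // x Kx.
have : open (~` K) by apply: closed_openC; exact: compact_closed.
move=> oK; have : \forall y \near x, phi y = cst 0 y.
  have : nbhs x (~` K) by exact: open_nbhs_nbhs.
  by apply: filterS => y Ky; rewrite phi0.
by move/near_eq_derive => ->; rewrite derive_cst.
Qed.

Lemma compact_supp_partials (U : set 'rV[R]_n) phi ds : compact_supp U phi ->
  compact_supp U (partials ds phi).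
Proof. by elim: ds => //= i ds IH /IH; exact: compact_supp_derive. Qed.

Lemma compact_suppM (U : set 'rV[R]_n) (phi psi : 'rV[R]_n -> R) : compact_supp U phi ->
  compact_supp U (fun x => psi x * phi x).
Proof. by move=> [K KU phi0]; exists K => // x /phi0 ->; rewrite mulr0. Qed.

Lemma smooth_test_function (U : set 'rV[R]_n) phi : smooth phi -> compact_supp U phi ->
  test_function U phi.
Proof.
move=> sphi cphi; split => // ds x; apply: smooth_differentiable.
exact: smooth_partials.
Qed.

Lemma partials_aff2 (c : R) (b : 'rV[R]_n) phi i j y : smooth phi ->
  partials [:: i; j] (fun y => phi (aff c b y)) y =
  c ^+ 2 * partials [:: i; j] phi (aff c b y).
Proof.
move=> sphi /=.
rewrite (_ : (fun z => _) = fun z => c * (fun z => 'D_(delta_mx ord0 j) phi (aff c b z)) z); last first.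
  by apply/funext => z; rewrite derive_aff//; exact: smooth_differentiable.
have sd := smooth_derive (delta_mx ord0 j) sphi.
rewrite derive_smoothM//; [|exact: smooth_cst|exact: (smooth_aff c b sd)].
rewrite derive_cst mulr0 addr0.
have ds := smooth_differentiable (aff c b y) sd.
by rewrite (derive_aff (f := 'D_(delta_mx ord0 j) phi)) ?mulrA.
Qed.

End dilation.

Section restriction.
Context {R : realType} {n : nat}.
Local Notation mu := (lebesgue_rV R n).
Implicit Types (U : set 'rV[R]_n) (f psi : 'rV[R]_n -> R).

Lemma integrable_patch U f : measurable U -> mu.-integrable U (EFin \o f) ->
  mu.-integrable setT (EFin \o (f \_ U)).
Proof. by move=> mU fi; rewrite -restrict_EFin; apply: (integrable_mkcond _ mU).1. Qed.

Lemma Rintegral_patchM U f psi :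
  \int[mu]_(x in U) (f x * psi x) = \int[mu]_x ((f \_ U) x * psi x).
Proof.
rewrite Rintegral_mkcond; congr Rintegral; apply/funext => x.
by rewrite /patch; case: ifP => // _; rewrite mul0r.
Qed.

Lemma continuous_supp_bounded U f : continuous f -> compact_supp U f ->
  exists2 C : R, 0 <= C & forall x, `|f x| <= C.
Proof.
move=> cf [K [cK _] f0].
have [M0 [_ HM]] := continuous_compact_bounded (continuous_subspaceT cf) cK.
exists (`|M0| + 1) => [|x]; first by rewrite addr_ge0.
have [Kx|Kx] := pselect (K x); last by rewrite f0// normr0 addr_ge0.
by apply: HM => //; rewrite (le_lt_trans (ler_norm M0))// ltrDl.
Qed.

End restriction.

Section fubini_second.
Local Open Scope ereal_scope.
Context d1 d2 (T1 : measurableType d1) (T2 : measurableType d2) (R : realType).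
Variable m1 : {sigma_finite_measure set T1 -> \bar R}.
Variable m2 : {sigma_finite_measure set T2 -> \bar R}.

Lemma integrable_fubini_snd (f : T1 * T2 -> \bar R) :
  (m1 \x m2).-integrable setT f ->
  m2.-integrable setT (fun y => \int[m1]_x f (x, y)).
Proof.
move=> fi; have mf := measurable_int _ fi.
have mG := measurable_fubini_G fi; apply/integrableP; split => //.
apply: (@le_lt_trans _ _ (\int[m2]_y \int[m1]_x `|f (x, y)|)); last exact/integrable21ltyP.
apply: ge0_le_integral => //.
- by apply: measurableT_comp => //; exact: mG.
- by apply: (measurable_fun_fubini_tonelli_G (abse \o f)) => //=; exact: measurableT_comp.
- move=> y _; apply: le_abse_integral => //.
  exact/measurableT_comp.
Qed.

End fubini_second.
Section product_integrability.
Context {R : realType} {n : nat}.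
Local Notation mu := (lebesgue_rV R n).
Local Notation la := (@lebesgue_measure R).
Implicit Types (a x : 'rV[R]_n) (h : 'rV[R]_n -> R).

Definition toward a (r : R) : 'rV[R]_n -> 'rV[R]_n := aff (1 - r) (r *: a).

Lemma toward_inv a (r : R) y : r < 1 ->
  aff (1 - r)^-1 (- ((1 - r)^-1 *: (r *: a))) y = (1 - r)^-1 *: (y - a) + a.
Proof.
move=> r1; have r0 : 1 - r != 0 by rewrite gt_eqF// subr_gt0.
by apply/rowP => i; rewrite !mxE; field.
Qed.

Lemma measurable_toward a :
  measurable_fun setT (fun p : measurableTypeR R * 'rV[R]_n => toward a p.1 p.2).
Proof.
apply: measurable_fun_rV => i.
apply: (eq_measurable_fun (fun p : measurableTypeR R * 'rV[R]_n =>
    (1 - p.1) * p.2 ord0 i + p.1 * a ord0 i)); first by move=> p _; rewrite !mxE.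
have m1 : measurable_fun setT (fun p : measurableTypeR R * 'rV[R]_n => p.1 : R).
  exact: measurable_fst.
have m2 : measurable_fun setT (fun p : measurableTypeR R * 'rV[R]_n => p.2 ord0 i : R).
  by apply: (measurableT_comp (measurable_coord i)); exact: measurable_snd.
apply: measurable_funD; last exact: measurable_funM.
by apply: measurable_funM => //; exact: measurable_funB.
Qed.

Lemma measurable_indic_fst (t : R) : measurable_fun setT
  (fun p : measurableTypeR R * 'rV[R]_n => \1_`[0, t]%classic p.1 : R).
Proof.
have mI : measurable_fun setT (\1_`[0, t]%classic : measurableTypeR R -> R) by [].
exact: (measurableT_comp mI measurable_fst).
Qed.

Lemma integrable_product_bound (t C : R) (F : measurableTypeR R * 'rV[R]_n -> R) :
  measurable_fun setT F ->
  (forall r, (\int[mu]_x `|F (r, x)|%:E <= (\1_`[0, t]%classic r * C)%:E)%E) ->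
  (la \x mu)%E.-integrable setT (EFin \o F).
Proof.
move=> mF FC; apply/integrable12ltyP; first exact/measurable_EFinP.
have mI : measurable (`[0, t]%classic : set (measurableTypeR R)) by [].
apply: (@le_lt_trans _ _ (\int[la]_r (\1_`[0, t]%classic r * `|C|)%:E)%E).
  apply: ge0_le_integral => //.
  - by move=> r _; exact: integral_ge0.
  - apply: (measurable_fun_fubini_tonelli_F (fun p => (`|F p|)%:E)) => //.
    by apply/measurable_EFinP; exact: measurableT_comp.
  - apply/measurable_EFinP; apply: measurable_funM => //.
  - move=> r _; apply: le_trans (FC r) _; rewrite lee_fin ler_wpM2l ?ler_norm//.
have : la.-integrable setT (EFin \o (fun r : R => `|C| * \1_`[0, t]%classic r)).
  by apply: integrable_EFinZ; exact: integrable_indic_itv.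
move=> /integrableP[_]; apply: le_lt_trans; apply: ge0_le_integral => //.
- by apply/measurable_EFinP; apply: measurable_funM.
- by apply/measurable_EFinP; apply: measurableT_comp => //; apply: measurable_funM.
- by move=> r _ /=; rewrite lee_fin mulrC ler_norm.
Qed.

Lemma integrable_cylinder (t : R) h : mu.-integrable setT (EFin \o h) ->
  (la \x mu)%E.-integrable setT
    (EFin \o (fun p : measurableTypeR R * 'rV[R]_n => \1_`[0, t]%classic p.1 * h p.2)).
Proof.
move=> hi; have mh : measurable_fun setT h by apply/measurable_EFinP; exact: measurable_int hi.
have [_ hoo] := integrableP _ _ _ hi.
apply: (integrable_product_bound (t := t) (C := fine (\int[mu]_x `|(h x)%:E|))).
  apply: measurable_funM; last by apply: measurableT_comp mh _; exact: measurable_snd.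
  exact: measurable_indic_fst.
move=> r /=.
rewrite (eq_integral (fun x => (\1_`[0, t]%classic r)%:E * `|(h x)%:E|)%E); last first.
  by move=> x _; rewrite normrM EFinM ger0_norm.
rewrite ge0_integralZl//; last by apply: measurableT_comp => //; exact/measurable_EFinP.
rewrite EFinM fineK// ge0_fin_numE//; exact: integral_ge0.
Qed.

(** Integrating first in [x], the change of variables costs [(1 - r) ^- n], which is at most
    [(1 - t) ^- n] on [[0, t]]. This is where [t < 1] matters. *)
Lemma integrable_toward (t : R) a h : t < 1 -> mu.-integrable setT (EFin \o h) ->
  (la \x mu)%E.-integrable setT
    (EFin \o (fun p : measurableTypeR R * 'rV[R]_n =>
       \1_`[0, t]%classic p.1 * h (toward a p.1 p.2))).
Proof.
move=> t1 hi; have mh : measurable_fun setT h by apply/measurable_EFinP; exact: measurable_int hi.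
have [_ hoo] := integrableP _ _ _ hi.
apply: (integrable_product_bound (t := t)
    (C := (1 - t)^-1 ^+ n * fine (\int[mu]_x `|(h x)%:E|))).
  apply: measurable_funM; last by apply: measurableT_comp mh _; exact: measurable_toward.
  exact: measurable_indic_fst.
move=> r /=; rewrite indicE; case: (boolP (r \in _)) => rt; last first.
  by under eq_integral do rewrite mul0r normr0; rewrite integral0 mul0r.
have /andP[r0 rt'] : 0 <= r <= t by move: rt; rewrite inE/= in_itv.
under eq_integral do rewrite mul1r.
have r1 : 0 < 1 - r by rewrite subr_gt0 (le_lt_trans rt').
have E : (\int[mu]_x `|(h x)%:E| = ((1 - r) ^+ n)%:E * \int[mu]_x `|(h (toward a r x))%:E|)%E.
  rewrite (ge0_integral_affine_rV (r *: a) r1)//.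
  by apply: measurableT_comp => //; exact/measurable_EFinP.
have Eoo : (\int[mu]_x `|(h (toward a r x))%:E| < +oo)%E.
  move: hoo; rewrite E; set I := (\int[mu]_x _)%E => H.
  rewrite ltey; apply: contraTN H => /eqP ->.
  by rewrite gt0_muley ?lte_fin ?exprn_gt0// ltxx.
rewrite mul1r E fineM//; last by rewrite ge0_fin_numE//; exact: integral_ge0.
rewrite [fine (_%:E)]/= mulrA EFinM fineK; last by rewrite ge0_fin_numE//; exact: integral_ge0.
rewrite -[leLHS]mul1e lee_wpmul2r//; first exact: integral_ge0.
rewrite lee_fin -exprMn exprn_ege1// ler_pdivlMl ?subr_gt0// mulr1.
by rewrite lerD2l lerN2.
Qed.

End product_integrability.
Section smooth_bounds.
Context {R : realType} {n : nat}.
Local Notation mu := (lebesgue_rV R n).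
Implicit Types (V : set 'rV[R]_n) (f psi : 'rV[R]_n -> R).

Lemma smooth_bounded f V : smooth f -> compact_supp V f ->
  exists2 C : R, 0 <= C & forall x, `|f x| <= C.
Proof.
by move=> sf; apply: continuous_supp_bounded; exact: smooth_continuous.
Qed.

Lemma integrable_smoothM f psi V : mu.-integrable setT (EFin \o f) ->
  smooth psi -> compact_supp V psi ->
  mu.-integrable setT (EFin \o (fun y => f y * psi y)).
Proof.
move=> fi spsi /(smooth_bounded spsi)[C C0 psiC].
apply: (integrable_EFinM (C := C)) => //.
by apply: continuous_measurableT_rV; exact: smooth_continuous.
Qed.

Lemma integrable_smoothM_aff f psi V c b : mu.-integrable setT (EFin \o f) ->
  smooth psi -> compact_supp V psi ->
  mu.-integrable setT (EFin \o (fun y => f y * psi (aff c b y))).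
Proof.
move=> fi spsi /(smooth_bounded spsi)[C C0 psiC].
apply: (integrable_EFinM (C := C)) => //.
by apply: continuous_measurableT_rV; apply: smooth_continuous; exact: smooth_aff.
Qed.

End smooth_bounds.

(** * Taylor's formula up to [t < 1], by testing against smooth functions *)

Section weak_taylor.
Context {R : realType} {n : nat}.
Local Notation mu := (lebesgue_rV R n).
Local Notation la := (@lebesgue_measure R).
Variables (Omega U : set 'rV[R]_n) (a : 'rV[R]_n) (t : R).
Variables (u : 'rV[R]_n -> R) (g : 'I_n -> 'rV[R]_n -> R).
Variable H : 'I_n -> 'I_n -> 'rV[R]_n -> R.
Hypotheses (oO : open Omega) (oU : open U) (bU : bounded_set U) (t01 : 0 < t < 1).
Hypothesis towardO : forall x r, U x -> 0 <= r <= t -> Omega (toward a r x).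
Hypothesis ui : mu.-integrable Omega (EFin \o u).
Hypothesis Hi : forall i j, mu.-integrable Omega (EFin \o H i j).
Hypothesis wg : forall i, weak_derivative Omega [:: i] u (g i).
Hypothesis wH : forall i j, weak_derivative Omega [:: i; j] u (H i j).

Let mO : measurable Omega. Proof. exact: open_measurable_rV. Qed.
Let mU : measurable U. Proof. exact: open_measurable_rV. Qed.

Let ut := u \_ Omega.
Let Ht i j := H i j \_ Omega.

(** The integrand of the Taylor remainder, extended by 0 to the whole product space so that
    measurability and Fubini's theorem need no restriction of the domain. *)
Definition taylor_kernel (p : measurableTypeR R * 'rV[R]_n) : R :=
  \1_`[0, t]%classic p.1 * (\1_U p.2 * ((t - p.1) *
    \sum_i \sum_j (H i j \_ Omega) (toward a p.1 p.2) *
      ((p.2 ord0 i - a ord0 i) * (p.2 ord0 j - a ord0 j)))).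

Let UO : U `<=` Omega.
Proof.
move=> x Ux; have t0 : 0 <= (0 : R) <= t by rewrite lexx ltW//; case/andP : t01.
by have := towardO Ux t0; rewrite /toward /aff subr0 !scale0r scale1r addr0.
Qed.

Let uti : mu.-integrable setT (EFin \o ut). Proof. exact: integrable_patch. Qed.
Let Hti i j : mu.-integrable setT (EFin \o Ht i j). Proof. exact: integrable_patch. Qed.

Let mut : measurable_fun setT ut.
Proof. by apply/measurable_EFinP; exact: measurable_int uti. Qed.
Let mHt i j : measurable_fun setT (Ht i j).
Proof. by apply/measurable_EFinP; exact: measurable_int (Hti i j). Qed.

Let shift_bounded : exists2 D : R, 0 <= D & forall x i, U x -> `|x ord0 i - a ord0 i| <= D.
Proof.
have [r r0 Ur] := bounded_subset_box bU.
exists (r + `|a|) => [|x i Ux]; first by rewrite addr_ge0// ltW.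
apply: le_trans (ler_normB _ _) _; rewrite lerD ?ler_norm_coord//.
by have := Ur x Ux i; rewrite !mxE -ltr_norml => /ltW.
Qed.

Lemma measurable_taylor_kernel : measurable_fun setT taylor_kernel.
Proof.
have mc i : measurable_fun setT (fun p : measurableTypeR R * 'rV[R]_n => p.2 ord0 i : R).
  by apply: (measurableT_comp (measurable_coord i)); exact: measurable_snd.
apply: measurable_funM; first exact: measurable_indic_fst.
apply: measurable_funM.
  have mI : measurable_fun setT (\1_U : 'rV[R]_n -> R) by exact: measurable_indic.
  exact: (measurableT_comp mI measurable_snd).
apply: measurable_funM; first by apply: measurable_funB => //; exact: measurable_fst.
apply: measurable_sum => i; apply: measurable_sum => j; apply: measurable_funM.
  exact: (measurableT_comp (mHt i j) (measurable_toward a)).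
by apply: measurable_funM; apply: measurable_funB.
Qed.

Lemma integrable_taylor_kernel : (la \x mu)%E.-integrable setT (EFin \o taylor_kernel).
Proof.
have [D D0 HD] := shift_bounded.
have /andP[t0 t1] := t01.
pose h x := D ^+ 2 * \sum_i \sum_j `|Ht i j x|.
have hi : mu.-integrable setT (EFin \o h).
  apply: integrable_EFinZ; apply: integrable_EFin_sum => i.
  by apply: integrable_EFin_sum => j; exact: integrable_norm.
have h0 x : 0 <= h x.
  rewrite mulr_ge0 ?sqr_ge0//; apply: sumr_ge0 => i _; exact: sumr_ge0.
apply: le_integrable_EFin (integrable_toward (t := t) a t1 hi).
  exact: measurable_taylor_kernel.
move=> [r x]; rewrite /taylor_kernel [(r, x).1]/= [(r, x).2]/= normrM ger0_norm//.
rewrite indicE; case: (boolP (r \in _)) => rt; last by rewrite !mul0r.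
have /andP[r0 rt'] : 0 <= r <= t by move: rt; rewrite inE/= in_itv.
rewrite !mul1r indicE; case: (boolP (x \in _)) => Ux; last by rewrite mul0r normr0.
rewrite inE in Ux; rewrite mul1r normrM -[leRHS]mul1r ler_pM//.
  by rewrite ger0_norm ?subr_ge0//; lra.
rewrite /h mulr_sumr; apply: le_trans (ler_norm_sum _ _ _) _; apply: ler_sum => i _.
rewrite mulr_sumr; apply: le_trans (ler_norm_sum _ _ _) _; apply: ler_sum => j _.
rewrite normrM mulrC ler_wpM2r// normrM expr2 ler_pM// HD//.
Qed.

Definition taylor_remainder (x : 'rV[R]_n) : R := \int[la]_r taylor_kernel (r, x).

Lemma integrable_taylor_remainder : mu.-integrable setT (EFin \o taylor_remainder).
Proof.
apply: le_integrable (integrable_fubini_snd integrable_taylor_kernel) => //.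
  apply/measurable_EFinP; apply: (@measurableT_comp _ _ _ _ _ _ fine) => //.
  exact: (measurable_fubini_G integrable_taylor_kernel).
move=> x _; rewrite /taylor_remainder /Rintegral /=.
(* [fine] sends infinite values to 0, which preserves the bound by the inner integral. *)
by case: (integral _ _ _) => [r| |] //=; rewrite ?normr0 ?leey.
Qed.

(** The difference of the two sides of the formula, to be shown orthogonal to every test function of
    [U]. *)
Let taylor_defect (x : 'rV[R]_n) : R := ut (toward a t x) - ut x
  + t * \sum_i g i x * (x ord0 i - a ord0 i) - taylor_remainder x.

Section test.
Variable phi : 'rV[R]_n -> R.
Hypotheses (sphi : smooth phi) (cphi : compact_supp U phi).

Let shift2phi i j (x : 'rV[R]_n) :=
  (x ord0 i - a ord0 i) * (x ord0 j - a ord0 j) * phi x.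

Let sshift2phi i j : smooth (shift2phi i j).
Proof. by apply: smoothM => //; apply: smoothM; exact: smooth_shift. Qed.

Let L := euler_shift a n phi.
Let M := euler_shift a n.+1 L.

Let sL : smooth L. Proof. exact: smooth_euler_shift. Qed.
Let sM : smooth M. Proof. exact: smooth_euler_shift. Qed.

Let cL : compact_supp U L.
Proof.
have [K [cK KU] phi0] := cphi; exists K => // x Kx.
rewrite /L -euler_shift_div//; apply: big1 => i _.
pose psi (y : 'rV[R]_n) := (y ord0 i - a ord0 i) * phi y.
have [K2 [_ K2K] H2] : compact_supp K (fun x => 'D_(delta_mx ord0 i) psi x).
  by apply: compact_supp_derive; apply: compact_suppM; exists K => //; split.
by apply: H2 => /K2K.
Qed.

Let cM : compact_supp U M.
Proof.
have [K [cK KU] phi0] := cphi; exists K => // x Kx.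
rewrite /M /L -euler_shift_div2//; apply: big1 => i _; apply: big1 => j _.
have [K2 [_ K2K] ->//] : compact_supp K (partials [:: i; j] (shift2phi i j)).
  by apply: compact_supp_partials; apply: compact_suppM; exists K => //; split.
by move=> /K2K.
Qed.

(** The integrand with the homothety on the test function. For fixed [r] its integral in [x] is that
    of [taylor_kernel * phi]; for fixed [x] its integral in [r] is given by [dilation_taylor]. *)
Let P1 (p : measurableTypeR R * 'rV[R]_n) : R :=
  \1_`[0, t]%classic p.1 * (ut p.2 * ((t - p.1) * ((1 - p.1)^-1 ^+ n.+2 *
    M ((1 - p.1)^-1 *: (p.2 - a) + a)))).

Let integrable_P1 : (la \x mu)%E.-integrable setT (EFin \o P1).
Proof.
have /andP[t0 t1] := t01; clearbody M.
have [C C0 MC] := smooth_bounded sM cM.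
(* [(1 - r)^-1] is cut off at its singularity [r = 1]; on []-oo, 1[] it is continuous, hence
   measurable, and [P1] only sees [r <= t < 1]. *)
pose c : measurableTypeR R -> R := (fun r : R => (1 - r)^-1) \_ `]-oo, 1[%classic.
have mc : measurable_fun setT c.
  apply/(measurable_restrictT _ _).1; first exact: measurable_itv.
  apply: open_continuous_measurable_fun; first exact: interval_open.
  move=> r; rewrite inE/= in_itv/= => r1.
  apply: cvgV; first by rewrite gt_eqF// subr_gt0.
  by apply: cvgB => //; exact: cvg_cst.
have mc1 : measurable_fun setT (fun p : measurableTypeR R * 'rV[R]_n => c p.1).
  exact: (measurableT_comp mc measurable_fst).
have m1 : measurable_fun setT (fun p : measurableTypeR R * 'rV[R]_n => p.1 : R).
  exact: measurable_fst.
have m2 i : measurable_fun setT (fun p : measurableTypeR R * 'rV[R]_n => p.2 ord0 i : R).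
  by apply: (measurableT_comp (measurable_coord i)); exact: measurable_snd.
have mM : measurable_fun setT
    (fun p : measurableTypeR R * 'rV[R]_n => M (c p.1 *: (p.2 - a) + a)).
  have mM0 : measurable_fun setT M.
    by apply: continuous_measurableT_rV; exact: smooth_continuous.
  apply: (measurableT_comp mM0); apply: measurable_fun_rV => i.
  apply: (eq_measurable_fun (fun p : measurableTypeR R * 'rV[R]_n =>
    c p.1 * (p.2 ord0 i - a ord0 i) + a ord0 i)); first by move=> p _; rewrite !mxE.
  apply: measurable_funD => //; apply: measurable_funM => //; exact: measurable_funB.
have cE r : r < 1 -> c r = (1 - r)^-1.
  by move=> r1; rewrite /c /patch ifT// inE/= in_itv.
have P1E : P1 = fun p => \1_`[0, t]%classic p.1 * (ut p.2 * ((t - p.1) * (c p.1 ^+ n.+2 *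
    M (c p.1 *: (p.2 - a) + a)))).
  apply/funext => -[r x]; rewrite /P1 [(r, x).1]/= [(r, x).2]/= indicE.
  case: (boolP (r \in _)) => rt; last exact: etrans (mul0r _) (esym (mul0r _)).
  by rewrite cE//; move: rt; rewrite inE/= in_itv/= => /andP[_ /le_lt_trans]; exact.
have hi : mu.-integrable setT (EFin \o (fun x => (1 - t)^-1 ^+ n.+2 * C * `|ut x|)).
  by apply: integrable_EFinZ; exact: integrable_norm.
apply: le_integrable_EFin (integrable_cylinder t hi).
  rewrite P1E; apply: measurable_funM; first exact: measurable_indic_fst.
  apply: measurable_funM; first exact: (measurableT_comp mut measurable_snd).
  apply: measurable_funM; first exact: measurable_funB.
  by apply: measurable_funM => //; exact: measurable_funX.
move=> [r x]; rewrite /P1 [(r, x).1]/= [(r, x).2]/= normrM ger0_norm//.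
rewrite indicE; case: (boolP (r \in _)) => rt; last by rewrite !mul0r.
have /andP[r0 rt'] : 0 <= r <= t by move: rt; rewrite inE/= in_itv.
have r1 : 0 < 1 - r by rewrite subr_gt0 (le_lt_trans rt').
rewrite !mul1r normrM mulrC ler_wpM2r// normrM -[leRHS]mul1r ler_pM//.
  by rewrite ger0_norm ?subr_ge0//; lra.
rewrite normrM ler_pM// normrX ger0_norm ?invr_ge0 ?(ltW r1)//.
rewrite lerXn2r ?nnegrE ?invr_ge0 ?subr_ge0 ?(ltW t1) ?(ltW r1)//; first by rewrite -subr_ge0 ltW.
by rewrite lef_pV2 ?posrE ?subr_gt0// ?lerD2l ?lerN2// -subr_gt0.
Qed.

(* The homothety is moved onto the test function, which turns the second derivatives along
   the segment into weak second derivatives of [u]. *)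
Let kernel_swap r : (\int[mu]_x (P1 (r, x))%:E = \int[mu]_x (taylor_kernel (r, x) * phi x)%:E)%E.
Proof.
have /andP[t0 t1] := t01.
rewrite /P1 /taylor_kernel/=; rewrite indicE; case: (boolP (r \in _)) => rt; last first.
  rewrite integral0_eq; last by move=> x _; rewrite mul0r.
  by rewrite integral0_eq// => x _; rewrite !mul0r.
have /andP[r0 rt'] : 0 <= r <= t by move: rt; rewrite inE/= in_itv.
have r1 : r < 1 by exact: le_lt_trans rt' t1.
have c0 : 0 < 1 - r by rewrite subr_gt0.
have cn0 : 1 - r != 0 by rewrite gt_eqF.
set c := (1 - r)^-1.
have cc0 : 0 < c by rewrite invr_gt0.
pose b := - (c *: (r *: a)).
have affb y : c *: (y - a) + a = aff c b y by rewrite /b /c toward_inv.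
have sa f : smooth f -> smooth (fun y => f (aff c b y)) by move=> sf; exact: (smooth_aff c b sf).
have UOr x : U x -> Omega (aff (1 - r) (r *: a) x).
  by move=> Ux; apply: towardO => //; rewrite r0.
have suppa f : compact_supp U f -> compact_supp Omega (fun y => f (aff c b y)).
  by move=> cf; exact: (compact_supp_aff cn0 cf UOr).
have cs2 i j : compact_supp U (shift2phi i j) by exact: compact_suppM.
have Hai i j : mu.-integrable setT (EFin \o (fun x => Ht i j (toward a r x))).
  exact: (integrable_aff (r *: a) c0 (Hti i j)).
have Hsi i j : mu.-integrable setT
    (EFin \o (fun x => Ht i j (toward a r x) * shift2phi i j x)).
  exact: (integrable_smoothM (Hai i j) (sshift2phi i j) (cs2 i j)).
have upi i j : mu.-integrable setT
    (EFin \o (fun y => ut y * partials [:: i; j] (shift2phi i j) (aff c b y))).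
  exact: (integrable_smoothM_aff c b uti (smooth_partials [:: i; j] (sshift2phi i j))
    (compact_supp_partials [:: i; j] (cs2 i j))).
(* The factor [(1 - r) ^+ 2] compensates the chain rule and [(1 - r) ^+ n] is the Jacobian; together
   they cancel [c ^+ n.+2] in [P1]. *)
have step i j : \int[mu]_y (ut y * partials [:: i; j] (shift2phi i j) (aff c b y)) =
    (1 - r) ^+ 2 * ((1 - r) ^+ n * \int[mu]_x (Ht i j (toward a r x) * shift2phi i j x)).
  have [_ _ wHij] := wH i j.
  have E := wHij _ (smooth_test_function (sa _ (sshift2phi i j)) (suppa _ (cs2 i j))).
  rewrite !(Rintegral_patchM Omega) [size _]/= sqrrN expr1n mul1r in E.
  have Hi1 : mu.-integrable setT
      (EFin \o (fun y => Ht i j y * shift2phi i j (aff c b y))).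
    exact: (integrable_smoothM_aff c b (Hti i j) (sshift2phi i j) (cs2 i j)).
  have E2 : \int[mu]_y (ut y * partials [:: i; j] (fun y => shift2phi i j (aff c b y)) y) =
     c ^+ 2 * \int[mu]_y (ut y * partials [:: i; j] (shift2phi i j) (aff c b y)).
    rewrite -RintegralZl//; congr Rintegral; apply/funext => y.
    by rewrite partials_aff2// mulrCA.
  rewrite E2 in E.
  have -> : \int[mu]_y (ut y * partials [:: i; j] (shift2phi i j) (aff c b y)) =
     (1 - r) ^+ 2 * \int[mu]_y (Ht i j y * shift2phi i j (aff c b y)).
    by rewrite -E mulrA /c -exprMn mulfV// expr1n mul1r.
  congr (_ * _); rewrite (Rintegral_aff (r *: a) c0 Hi1); congr (_ * _).
  congr Rintegral; apply/funext => x; congr (_ * shift2phi i j _).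
  by rewrite /b /c aff_inv.
have E1 : \int[mu]_x (ut x * ((t - r) * (c ^+ n.+2 * M (c *: (x - a) + a)))) =
    \int[mu]_x ((t - r) * \sum_i \sum_j (Ht i j (toward a r x) * shift2phi i j x)).
  have -> : (fun x => ut x * ((t - r) * (c ^+ n.+2 * M (c *: (x - a) + a)))) =
     fun x => (t - r) * c ^+ n.+2 *
       \sum_i \sum_j (ut x * partials [:: i; j] (shift2phi i j) (aff c b x)).
    apply/funext => x; rewrite affb /M /L -euler_shift_div2//.
    under [in RHS]eq_bigr do rewrite -mulr_sumr.
    by rewrite -mulr_sumr; ring.
  rewrite RintegralZl//; last first.
    by apply: integrable_EFin_sum => i; exact: integrable_EFin_sum.
  rewrite RintegralZl//; last first.
    by apply: integrable_EFin_sum => i; exact: integrable_EFin_sum.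
  rewrite -mulrA; congr (_ * _).
  rewrite !Rintegral_sum; last 2 first.
  - by move=> i; exact: integrable_EFin_sum.
  - by move=> i; exact: integrable_EFin_sum.
  rewrite mulr_sumr; apply: eq_bigr => i _.
  rewrite !Rintegral_sum// mulr_sumr; apply: eq_bigr => j _.
  rewrite step [in LHS](mulrA ((1 - r) ^+ 2)) -exprD add2n mulrA -exprMn /c mulVf//.
  by rewrite expr1n mul1r.
have E2 (f1 f2 : 'rV[R]_n -> R) : mu.-integrable setT (EFin \o f1) ->
    mu.-integrable setT (EFin \o f2) -> \int[mu]_x f1 x = \int[mu]_x f2 x ->
    (\int[mu]_x (f1 x)%:E = \int[mu]_x (f2 x)%:E)%E.
  move=> fi1 fi2 f12; rewrite -[LHS]fineK; last exact: (integrable_fin_num measurableT fi1).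
  by rewrite -[RHS]fineK ?(integrable_fin_num measurableT fi2)//; congr (_%:E).
have M1 x : true%:R * (ut x * ((t - r) * (c ^+ n.+2 * M (c *: (x - a) + a)))) =
    ut x * ((t - r) * (c ^+ n.+2 * M (c *: (x - a) + a))) by exact: mul1r.
have M2 x : true%:R * (\1_U x * ((t - r) * \sum_(i < n) \sum_(j < n)
      ((H i j) \_ Omega) (toward a r x) *
      ((x ord0 i - a ord0 i) * (x ord0 j - a ord0 j)))) * phi x =
    (t - r) * \sum_i \sum_j (Ht i j (toward a r x) * shift2phi i j x).
  have [Ux|Ux] := pselect (U x); last first.
    have phi0 : phi x = 0 by have [K [_ KU] ->] := cphi => // /KU.
    rewrite phi0 mulr0 big1 ?mulr0// => i _; rewrite big1// => j _.
    by rewrite /shift2phi phi0 !mulr0.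
  rewrite indicE mem_set// !mul1r -mulrA; congr (_ * _).
  rewrite mulr_suml; apply: eq_bigr => i _; rewrite mulr_suml; apply: eq_bigr => j _.
  by rewrite /shift2phi !mulrA.
under eq_integral do rewrite M1.
under [in RHS]eq_integral do rewrite M2.
apply: E2 => //.
  have Mi := integrable_EFinZ ((t - r) * c ^+ n.+2) (integrable_smoothM_aff c b uti sM cM).
  rewrite (_ : (fun x => ut x * _) = fun x => (t - r) * c ^+ n.+2 * (ut x * M (aff c b x)))//.
  by apply/funext => x; rewrite affb; ring.
by apply: integrable_EFinZ; apply: integrable_EFin_sum => i; exact: integrable_EFin_sum.
Qed.

(** Fubini's theorem is used twice: integrating [taylor_kernel * phi] in [x] first allows the
    replacement by [P1] for each [r], and integrating [P1] in [r] first gives [dilation_taylor]. *)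
Lemma taylor_remainder_test :
  mu.-integrable setT (EFin \o (fun x => taylor_remainder x * phi x)) /\
  \int[mu]_x (taylor_remainder x * phi x) =
  \int[mu]_x (ut (toward a t x) * phi x) - \int[mu]_x (ut x * phi x)
  - t * \int[mu]_x (ut x * L x).
Proof.
have /andP[t0 t1] := t01.
have mphi : measurable_fun setT phi.
  by apply: continuous_measurableT_rV; exact: smooth_continuous.
have [C C0 phiC] := smooth_bounded sphi cphi.
have tki : (la \x mu)%E.-integrable setT (EFin \o (fun p => taylor_kernel p * phi p.2)).
  apply: (integrable_EFinM (C := C)) => //; last exact: integrable_taylor_kernel.
  exact: (measurableT_comp mphi measurable_snd).
(* Only almost everywhere, since the slice of the kernel at a given [x] may fail to be
   integrable. *)
have remE : {ae mu, forall x, setT x -> (\int[la]_r (taylor_kernel (r, x) * phi x)%:E)%E =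
    (taylor_remainder x * phi x)%:E}.
  apply: filterS (ae_integrable2 integrable_taylor_kernel) => x xi _.
  under eq_integral do rewrite EFinM.
  by rewrite integralZr// EFinM /taylor_remainder /Rintegral fineK// integrable_fin_num.
have mG : measurable_fun setT (fun x => \int[la]_r (taylor_kernel (r, x) * phi x)%:E)%E.
  exact: (measurable_fubini_G tki).
have remi := integrable_smoothM integrable_taylor_remainder sphi cphi.
have mremphi : measurable_fun setT (fun x => (taylor_remainder x * phi x)%:E).
  exact: measurable_int remi.
split=> //.
pose S x := (1 - t)^-1 ^+ n * phi ((1 - t)^-1 *: (x - a) + a) - phi x - t * L x.
have PS x : (\int[la]_r (P1 (r, x))%:E = (ut x * S x)%:E)%E.
  have [ki kE] := dilation_taylor a (x - a) sphi t01.
  rewrite subrK in kE; rewrite /S /L EFinM -kE -integralZl// [RHS]integral_mkcond.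
  apply: eq_integral => r _; rewrite /P1 /patch indicE; case: ifP => _.
    by rewrite mul1r -EFinM.
  by rewrite mul0r.
have cn0 : 0 < 1 - t by rewrite subr_gt0.
have Si1 := integrable_smoothM uti sphi cphi.
have Si2 := integrable_smoothM uti sL cL.
have Si3 := integrable_smoothM_aff (1 - t)^-1 (- ((1 - t)^-1 *: (t *: a))) uti sphi cphi.
have SE : \int[mu]_x (ut x * S x) =
    \int[mu]_x (ut (toward a t x) * phi x) - \int[mu]_x (ut x * phi x)
  - t * \int[mu]_x (ut x * L x).
  have -> : (fun x => ut x * S x) = fun x =>
      ((1 - t)^-1 ^+ n * (ut x * phi (aff (1 - t)^-1 (- ((1 - t)^-1 *: (t *: a))) x))
      - ut x * phi x) - t * (ut x * L x).
    by apply/funext => x; rewrite /S toward_inv//; ring.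
  rewrite RintegralB//; last 2 first.
  - by apply: integrable_EFinB => //; exact: integrable_EFinZ.
  - exact: integrable_EFinZ.
  rewrite RintegralZl//; congr (_ - _); rewrite RintegralB//; last exact: integrable_EFinZ.
  congr (_ - _); rewrite RintegralZl// (Rintegral_aff (t *: a) cn0 Si3).
  rewrite mulrA -exprMn mulVf ?gt_eqF// expr1n mul1r; congr Rintegral.
  by apply/funext => x; rewrite aff_inv// gt_eqF.
rewrite -SE /Rintegral; congr fine.
transitivity (\int[mu]_x \int[la]_r (taylor_kernel (r, x) * phi x)%:E)%E.
  by apply/esym/ae_eq_integral.
transitivity (\int[la]_r \int[mu]_x (P1 (r, x))%:E)%E.
  apply: etrans (esym (Fubini tki)) _; apply: eq_integral => r _; exact/esym/kernel_swap.
by rewrite (Fubini integrable_P1); apply: eq_integral => x _; exact: PS.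
Qed.

(** [L] is the divergence of [phi * (x - a)], so this is the definition of the weak gradient, one
    coordinate at a time. *)
Let gradient_test : \int[mu]_x (ut x * L x) =
  - \sum_i \int[mu]_x ((g i \_ Omega) x * ((x ord0 i - a ord0 i) * phi x)).
Proof.
pose chi i (x : 'rV[R]_n) := (x ord0 i - a ord0 i) * phi x.
have schi i : smooth (chi i) by apply: smoothM => //; exact: smooth_shift.
have cchi i : compact_supp U (chi i) by exact: compact_suppM.
have cchiO i : compact_supp Omega (chi i).
  by have [K [cK KU] K0] := cchi i; exists K => //; split=> // x /KU/UO.
have -> : (fun x => ut x * L x) = fun x => \sum_i ut x * partials [:: i] (chi i) x.
  by apply/funext => x; rewrite /L -euler_shift_div// mulr_sumr.
rewrite Rintegral_sum => [|i]; last first.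
  exact: (integrable_smoothM uti (smooth_partials [:: i] (schi i))
    (compact_supp_partials [:: i] (cchi i))).
rewrite -sumrN; apply: eq_bigr => i _; have [_ _ wgi] := wg i.
have := wgi _ (smooth_test_function (schi i) (cchiO i)).
by rewrite !(Rintegral_patchM Omega) [size _]/= expr1 mulN1r.
Qed.

Lemma taylor_defect_test : \int[mu]_(x in U) (taylor_defect x * phi x) = 0.
Proof.
have /andP[t0 t1] := t01.
have phi0 x : ~ U x -> phi x = 0.
  by move=> Ux; have [K [_ KU] ->] := cphi => // /KU.
pose gam i x := (g i \_ Omega) x * ((x ord0 i - a ord0 i) * phi x).
have gami i : mu.-integrable setT (EFin \o gam i).
  have [_ [mg gi] _] := wg i.
  have cchi : compact_supp Omega (fun x => (x ord0 i - a ord0 i) * phi x).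
    by have [K [cK KU] K0] := cphi; apply: compact_suppM; exists K => //; split => // x /KU/UO.
  have schi : smooth (fun x : 'rV[R]_n => (x ord0 i - a ord0 i) * phi x).
    by apply: smoothM => //; exact: smooth_shift.
  have := integrable_patch mO (integrable_compact_supp mO mg gi (smooth_continuous schi) cchi).
  rewrite (_ : _ \_ Omega = gam i)//; apply/funext => x; rewrite /gam /patch.
  by case: ifP => // _; rewrite mul0r.
have i1 : mu.-integrable setT (EFin \o (fun x => ut (toward a t x) * phi x)).
  have uta : mu.-integrable setT (EFin \o (fun x => ut (toward a t x))).
    by apply: (integrable_aff (t *: a) _ uti); rewrite subr_gt0.
  exact: (integrable_smoothM uta sphi cphi).
have i2 := integrable_smoothM uti sphi cphi.
have [i4 E4] := taylor_remainder_test.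
have i3 : mu.-integrable setT (EFin \o (fun x => t * \sum_i gam i x)).
  by apply: integrable_EFinZ; exact: integrable_EFin_sum.
have -> : \int[mu]_(x in U) (taylor_defect x * phi x) =
    \int[mu]_x (ut (toward a t x) * phi x - ut x * phi x + t * (\sum_i gam i x)
      - taylor_remainder x * phi x).
  rewrite Rintegral_mkcond; congr Rintegral; apply/funext => x; rewrite /patch.
  case: ifPn => [|]; last first.
    rewrite notin_setE => Ux; rewrite phi0// !mulr0 !subr0 add0r big1 ?mulr0//.
    by move=> i _; rewrite /gam phi0// !mulr0.
  rewrite inE => Ux; rewrite /taylor_defect !mulrDl !mulNr -mulrA; congr (_ + t * _ - _).
  rewrite mulr_suml; apply: eq_bigr => i _; rewrite /gam mulrA; congr (_ * _ * _).
  by rewrite /patch ifT// inE; exact: UO.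
rewrite RintegralB//; last first.
  by apply: integrable_EFinD => //; exact: integrable_EFinB.
rewrite RintegralD//; last exact: integrable_EFinB.
rewrite RintegralB// RintegralZl//; last exact: integrable_EFin_sum.
rewrite Rintegral_sum// E4 gradient_test.
by rewrite mulrN opprK; apply/eqP; rewrite subr_eq0.
Qed.

End test.

Lemma weak_taylor : {ae mu, forall x, U x ->
  u (toward a t x) - u x + t * \sum_i g i x * (x ord0 i - a ord0 i) =
  taylor_remainder x}.
Proof.
have /andP[t0 t1] := t01.
have c0 : 0 < 1 - t by rewrite subr_gt0.
have uta : mu.-integrable setT (EFin \o (fun x => ut (toward a t x))).
  exact: (integrable_aff (t *: a) c0 uti).
have mcoord i : measurable_fun U (fun x : 'rV[R]_n => x ord0 i - a ord0 i).
  by apply: measurable_funTS; apply: measurable_funB => //; exact: measurable_coord.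
have mgi i : measurable_fun U (g i).
  by have [_ [mg _] _] := wg i; exact: (measurable_funS mO UO mg).
have mdef : measurable_fun U taylor_defect.
  apply: measurable_funB; last first.
    apply: measurable_funTS; apply/measurable_EFinP.
    exact: measurable_int integrable_taylor_remainder.
  apply: measurable_funD.
    apply: measurable_funB; last exact: measurable_funTS.
    by apply: measurable_funTS; apply/measurable_EFinP; exact: measurable_int uta.
  by apply: measurable_funM => //; apply: measurable_sum => i; exact: measurable_funM.
(* Integrability is claimed on compact sets only, because a weak derivative is merely locally
   integrable. *)
have ideff K : compact K -> K `<=` U -> mu.-integrable K (EFin \o taylor_defect).
  move=> cK KU; have mK := compact_measurable_rV cK.
  have toK f : mu.-integrable setT (EFin \o f) -> mu.-integrable K (EFin \o f).
    by apply: integrableS => //.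
  have i3 : mu.-integrable K (EFin \o (fun x => t * \sum_i g i x * (x ord0 i - a ord0 i))).
    suff i3' : mu.-integrable K (EFin \o (fun x => \sum_i g i x * (x ord0 i - a ord0 i))).
      exact: (integrableZl mK t i3').
    rewrite (_ : _ \o _ = fun x => (\sum_i (g i x * (x ord0 i - a ord0 i))%:E)%E); last first.
      by apply/funext => x; rewrite sumEFin.
    apply: integrable_sum => // i _; have [_ [mg gi] _] := wg i.
    have gK : mu.-integrable K (EFin \o g i) by apply: gi => // x /KU/UO.
    have [D D0 HD] := shift_bounded.
    pose ci (x : 'rV[R]_n) := x ord0 i - a ord0 i.
    apply: (eq_integrable mK ((EFin \o ci) \* (EFin \o g i))%E).
      by move=> x _ /=; rewrite -EFinM mulrC.
    apply: integrableMr => //; first exact: (measurable_funS mU KU (mcoord i)).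
    exists D; split; first exact: num_real.
    by move=> M DM x Kx /=; rewrite (le_trans (HD _ _ (KU _ Kx)))// ltW.
  exact: (integrableB mK (integrableD mK (integrableB mK (toK _ uta) (toK _ uti)) i3)
    (toK _ integrable_taylor_remainder)).
have := fundamental_lemma oU mdef ideff taylor_defect_test.
apply: filterS => x Hx Ux; have := Hx Ux; rewrite /taylor_defect => /eqP; rewrite subr_eq0 => /eqP <-.
rewrite /ut /patch !ifT// inE; first exact: UO.
by apply: towardO => //; rewrite lexx ltW.
Qed.

End weak_taylor.
(** * Weighted averages along segments *)

Section weighted_average.
Context {R : realType}.
Local Notation la := (@lebesgue_measure R).

Lemma measurable_onem_powR (b : R) (D : set (measurableTypeR R)) :
  measurable_fun D (fun r : measurableTypeR R => (1 - r) `^ b).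
Proof.
apply: measurable_funTS; apply: (measurableT_comp (measurable_powR b)).
exact: measurable_funB.
Qed.

(** For [b < 0] the integrand is singular at 1, so the fundamental theorem of calculus is applied on
    [[0, 1 - 1 / (i + 1)]] and followed by monotone convergence. *)
Lemma integral_onem_powR (b : R) : -1 < b ->
  (\int[la]_(r in `[0%R, 1%R[) ((1 - r) `^ b)%:E <= ((b + 1)^-1)%:E)%E.
Proof.
move=> b1; have b0 : 0 < b + 1 by rewrite -ltrBlDr sub0r.
pose F (i : nat) : set (measurableTypeR R) := `[0, 1 - i.+1%:R^-1]%classic.
have mF i : measurable (F i) by exact: measurable_itv.
have ndF : nondecreasing_seq F.
  move=> i j ij; apply/subsetPset => r; rewrite /F/= !in_itv/= => /andP[-> /=].
  by move=> /le_trans; apply; rewrite lerD2l lerN2 lef_pV2 ?posrE// ler_nat.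
have mf i : measurable_fun (F i) (fun r : measurableTypeR R => ((1 - r) `^ b)%:E).
  by apply/measurable_EFinP; exact: measurable_onem_powR.
have f0 i (r : measurableTypeR R) : F i r -> (0 <= ((1 - r) `^ b)%:E)%E.
  by move=> _; rewrite lee_fin powR_ge0.
have H := ge0_nondecreasing_set_cvg_integral (mu := la) ndF mF mf f0.
rewrite itv_bnd_open_bigcup -(cvg_lim _ H)//; apply: lime_le.
  exact: cvgP H.
apply: nearW => i; have [->|i0] := eqVneq i 0%N.
  (* For [i = 0] the interval is a single point. *)
  by rewrite /F invr1 subrr set_itv1 integral_set1 lee_fin invr_ge0 ltW.
rewrite /F; set s : R := 1 - i.+1%:R^-1.
have s0 : 0 < s by rewrite subr_gt0 invf_lt1// ltr1n ltnS lt0n.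
have s1 : s < 1 by rewrite gtrDl oppr_lt0 invr_gt0.
pose G (r : R) : R := - ((b + 1)^-1 * (1 - r) `^ (b + 1)).
have dG (r : R) : r < 1 -> is_derive r 1 G ((1 - r) `^ b).
  move=> r1; have r0 : 0 < 1 - r by rewrite subr_gt0.
  have d1 : is_derive r 1 (fun r : R => 1 - r) (-1).
    by have := is_deriveB (is_derive_cst (1 : R) r (1 : R)) (is_derive_id r (1 : R)); rewrite sub0r.
  have d2 := @is_derive1_comp _ (fun y : R => y `^ (b + 1)) (fun r : R => 1 - r) r _ _
    (is_derive1_powR (b + 1) r0) d1.
  have d3 := is_deriveN (is_deriveZ (b + 1)^-1 d2).
  apply: (is_derive_eq d3); rewrite /GRing.scale/= addrK mulrN1 mulrN opprK mulrA.
  by rewrite mulVf ?mul1r// gt_eqF.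
have rs (r : R) : r \in `[0, s] -> r < 1.
  by rewrite in_itv/= => /andP[_ /le_lt_trans]; exact.
have cG (r : R) : r < 1 -> {for r, continuous G}.
  move=> r1; apply: differentiable_continuous; apply/derivable1_diffP.
  by case: (dG r r1).
rewrite (@continuous_FTC2 _ (fun r => (1 - r) `^ b) G 0 s)//.
- rewrite /G subr0 powR1 mulr1 -EFinB opprK lee_fin addrC gerDl oppr_le0.
  by rewrite mulr_ge0 ?powR_ge0// invr_ge0 ltW.
- apply: continuous_in_subspaceT => r; rewrite inE/= => /rs r1.
  have r0 : 0 < 1 - r by rewrite subr_gt0.
  have d1 : is_derive (r : R) 1 (fun r : R => 1 - r) (-1).
    by have := is_deriveB (is_derive_cst (1 : R) r (1 : R)) (is_derive_id r (1 : R)); rewrite sub0r.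
  have d2 := @is_derive1_comp _ (fun y : R => y `^ b) (fun r : R => 1 - r) r _ _
    (is_derive1_powR b r0) d1.
  by apply: differentiable_continuous; apply/derivable1_diffP; case: d2.
- split.
  + by move=> r /subset_itv_oo_cc/rs/dG[].
  + by apply: cvg_at_right_filter; exact: (cG 0).
  + by apply: cvg_at_left_filter; exact: (cG s).
- by move=> r /subset_itv_oo_cc/rs/dG H'; rewrite derive1E derive_val.
Qed.

End weighted_average.
Section weighted_hoelder.
Context {R : realType}.
Local Notation la := (@lebesgue_measure R).

(* For [b = 1 - n / q] the exponent of the weight on the right is [n + b], and the power [n]
   is the Jacobian of the homothety [toward a r]. *)
Lemma weighted_hoelder (q b : R) (k : measurableTypeR R -> R) : 1 < q -> -1 < b ->
  measurable_fun setT k -> (forall r, 0 <= k r) ->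
  ((\int[la]_(r in `[0%R, 1%R[) ((1 - r) * k r)%:E) `^ q <=
   ((b + 1)^-1 `^ (q - 1))%:E *
   \int[la]_(r in `[0%R, 1%R[) ((1 - r) `^ (q - b * (q - 1)) * k r `^ q)%:E)%E.
Proof.
move=> q1 b1 mk k0; have q0 : 0 < q by lra.
have qn0 : q != 0 by rewrite gt_eqF.
have b0 : 0 < b + 1 by lra.
pose D : set (measurableTypeR R) := `[0%R, 1%R[%classic.
have mD : measurable D by exact: measurable_itv.
pose w := 1 - q^-1.
have w0 : 0 < w by rewrite subr_gt0 invf_lt1.
have wn0 : w != 0 by rewrite gt_eqF.
have D1 r : D r -> 0 < 1 - r by rewrite /D/= in_itv/= subr_gt0 => /andP[].
(* The weight [1 - r] is split between [f] and [g] so that [f] raised to the conjugate exponent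
   [w^-1 = q / (q - 1)] is [(1 - r) ^ b]. *)
pose f : measurableTypeR R -> R := (fun r => (1 - r) `^ (b * w)) \_ D.
pose g : measurableTypeR R -> R := (fun r => (1 - r) `^ (1 - b * w) * k r) \_ D.
have mf : measurable_fun setT f.
  by apply/(measurable_restrictT _ _).1; [exact: mD|exact: measurable_onem_powR].
have mg : measurable_fun setT g.
  apply/(measurable_restrictT _ _).1; first exact: mD.
  apply: measurable_funM.
    exact: measurable_onem_powR.
  exact: measurable_funTS.
have pq : w^-1^-1 + q^-1 = 1 by rewrite invrK /w subrK.
have wi0 : 0 < w^-1 by rewrite invr_gt0.
have := hoelder la mf mg wi0 q0 pq.
have I1 : ('N[la]_1[EFin \o (f \* g)%R] = \int[la]_(r in `[0%R, 1%R[) ((1 - r) * k r)%:E)%E.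
  rewrite Lnorm1 [RHS]integral_mkcond; apply: eq_integral => r _ /=.
  rewrite /f /g /patch; case: ifPn => [|_]; last by rewrite mul0r normr0.
  rewrite inE => /D1 r0; rewrite mulrA -powRD; last by rewrite (gt_eqF r0) implybT.
  by rewrite (addrC (b * w)) subrK powRr1 ?(ltW r0)// ger0_norm// mulr_ge0// ltW.
have I2 : ('N[la]_(w^-1%:E)[EFin \o f] <= ((b + 1)^-1 `^ w)%:E)%E.
  rewrite -poweR_EFin -[X in (X <= _)%E]poweRe1 ?Lnorm_ge0//.
  rewrite -[in X in (X <= _)%E](mulVf wn0) poweRrM.
  rewrite gt0_ler_poweR ?(ltW w0)// ?in_itv/= ?leey ?poweR_ge0// ?lee_fin ?invr_ge0 ?(ltW b0)//.
  rewrite powR_Lnorm ?gt_eqF//; apply: le_trans (integral_onem_powR b1).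
  rewrite [leRHS]integral_mkcond le_eqVlt; apply/orP; left; apply/eqP.
  apply: eq_integral => r _; rewrite /= /f /patch; case: ifPn => [_|_].
    by rewrite ger0_norm ?powR_ge0// -powRrM mulfK.
  by rewrite normr0 powR0// invr_neq0.
have I3 : ('N[la]_(q%:E)[EFin \o g] `^ q =
    \int[la]_(r in `[0%R, 1%R[) ((1 - r) `^ (q - b * (q - 1)) * k r `^ q)%:E)%E.
  rewrite poweR_Lnorm// [RHS]integral_mkcond.
  apply: eq_integral => r _; rewrite /= /g /patch; case: ifPn => [|_]; last first.
    by rewrite normr0 powR0.
  rewrite inE => /D1 r0; rewrite ger0_norm ?mulr_ge0 ?powR_ge0//.
  rewrite powRM ?powR_ge0// -powRrM; congr ((_ `^ _ * _)%:E).
  by rewrite mulrBl mul1r -mulrA mulrBl mul1r mulVf.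
rewrite I1 => H; rewrite -I3.
have H1 := le_trans H (lee_wpmul2r (Lnorm_ge0 _ _ _) I2).
apply: (@le_trans _ _ ((((b + 1)^-1 `^ w)%:E * 'N[la]_(q%:E)[EFin \o g]) `^ q)%E).
  rewrite gt0_ler_poweR ?(ltW q0)// in_itv/= leey andbT.
    by apply: integral_ge0 => r /D1 r0; rewrite lee_fin mulr_ge0// ltW.
  by apply: mule_ge0; [rewrite lee_fin powR_ge0|exact: Lnorm_ge0].
rewrite poweRM ?lee_fin ?powR_ge0// ?Lnorm_ge0// poweR_EFin -powRrM.
by rewrite mulrBl mul1r mulVf.
Qed.
End weighted_hoelder.
Section segment_average.
Context {R : realType} {n : nat}.
Local Notation mu := (lebesgue_rV R n).
Local Notation la := (@lebesgue_measure R).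
Implicit Types (a x : 'rV[R]_n) (h k : 'rV[R]_n -> R) (w : measurableTypeR R -> R).

Definition segment_average a h x : \bar R :=
  (\int[la]_(r in `[0%R, 1%R[) ((1 - r) * h (toward a r x))%:E)%E.

Let D : set (measurableTypeR R) := `[0%R, 1%R[%classic.
Let mD : measurable D. Proof. exact: measurable_itv. Qed.
Let D1 r : D r -> 0 < 1 - r.
Proof. by rewrite /D/= in_itv/= subr_gt0 => /andP[]. Qed.

Lemma segment_average_ge0 a h x : (forall y, 0 <= h y) -> (0 <= segment_average a h x)%E.
Proof.
by move=> h0; apply: integral_ge0 => r /D1 r0; rewrite lee_fin mulr_ge0// ltW.
Qed.

Lemma measurable_toward_snd a x :
  measurable_fun setT (fun r : measurableTypeR R => toward a r x).
Proof.
exact: (measurableT_comp (measurable_toward a) (measurable_pair2 x)).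
Qed.

Let kernel w k a (p : measurableTypeR R * 'rV[R]_n) : \bar R :=
  ((w \_ D) p.1 * k (toward a p.1 p.2))%:E.

Let kernelE w k a x : (fun r => kernel w k a (r, x)) =
  (fun r => (w r * k (toward a r x))%:E) \_ D.
Proof.
by apply/funext => r; rewrite /kernel /patch/=; case: ifP => // _; rewrite mul0r.
Qed.

Let measurable_kernel w k a : measurable_fun D w -> measurable_fun setT k ->
  measurable_fun setT (kernel w k a).
Proof.
move=> mw mk; apply/measurable_EFinP; apply: measurable_funM.
  have mwD : measurable_fun setT (w \_ D).
    by apply/(measurable_restrictT _ _).1; [exact: mD|].
  exact: (measurableT_comp mwD measurable_fst).
exact: (measurableT_comp mk (measurable_toward a)).
Qed.

Let kernel_ge0 w k a : (forall r, D r -> 0 <= w r) -> (forall y, 0 <= k y) ->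
  forall p, (0 <= kernel w k a p)%E.
Proof.
move=> w0 k0 p; rewrite lee_fin mulr_ge0// /patch; case: ifP => // /set_mem; exact: w0.
Qed.

Lemma measurable_integral_toward w k a : measurable_fun D w -> measurable_fun setT k ->
  (forall r, D r -> 0 <= w r) -> (forall y, 0 <= k y) ->
  measurable_fun setT (fun x => \int[la]_(r in D) (w r * k (toward a r x))%:E)%E.
Proof.
move=> mw mk w0 k0.
apply: (eq_measurable_fun (fubini_G la (kernel w k a))).
  by move=> x _; rewrite /fubini_G kernelE -integral_mkcond.
by apply: measurable_fun_fubini_tonelli_G; [exact: measurable_kernel|exact: kernel_ge0].
Qed.

Lemma measurable_segment_average a h : measurable_fun setT h -> (forall y, 0 <= h y) ->
  measurable_fun setT (segment_average a h).
Proof.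
move=> mh h0; apply: measurable_integral_toward => //.
- exact: measurable_funB.
- by move=> r /D1/ltW.
Qed.

(** Tonelli's theorem, then for each [r] the change of variables by the homothety, whose Jacobian
    gives the factor [(1 - r) ^- n]. *)
Lemma integral_toward w k a : measurable_fun D w -> measurable_fun setT k ->
  (forall r, D r -> 0 <= w r) -> (forall y, 0 <= k y) ->
  (\int[mu]_x \int[la]_(r in D) (w r * k (toward a r x))%:E =
   \int[la]_(r in D) (w r * (1 - r) ^- n)%:E * \int[mu]_x (k x)%:E)%E.
Proof.
move=> mw mk w0 k0.
transitivity (\int[mu]_x \int[la]_r kernel w k a (r, x))%E.
  by apply: eq_integral => x _; rewrite kernelE -integral_mkcond.
rewrite -(@fubini_tonelli _ _ (measurableTypeR R) 'rV[R]_n R la mu (kernel w k a)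
  (measurable_kernel a mw mk) (kernel_ge0 a w0 k0)).
have mV : measurable_fun D (fun r => (w r * (1 - r) ^- n)%:E).
  apply/measurable_EFinP; apply: measurable_funM => //.
  apply: (eq_measurable_fun (fun r : measurableTypeR R => (1 - r) `^ (- n%:R))).
    by move=> r /set_mem/D1 r0; rewrite powRN powR_mulrn// ltW.
  exact: measurable_onem_powR.
have V0 r : D r -> (0 <= (w r * (1 - r) ^- n)%:E)%E.
  by move=> Dr; rewrite lee_fin mulr_ge0 ?w0// invr_ge0 exprn_ge0// ltW// D1.
rewrite -ge0_integralZr//; last by apply: integral_ge0 => x _; rewrite lee_fin.
rewrite [RHS]integral_mkcond; apply: eq_integral => r _.
rewrite /kernel /= /patch; case: ifPn => [/set_mem Dr|_]; last first.
  by rewrite integral0_eq// => x _; rewrite mul0r.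
have r0 := D1 Dr.
rewrite (ge0_integral_affine_rV (f := fun x => (k x)%:E) (r *: a) r0); last 2 first.
- exact/measurable_EFinP.
- by move=> x; rewrite lee_fin.
rewrite muleA -EFinM -mulrA mulVf ?gt_eqF ?exprn_gt0// mulr1.
rewrite -ge0_integralZl ?lee_fin ?w0//; last by move=> x _; rewrite lee_fin.
apply/measurable_EFinP; apply: (measurableT_comp mk); exact: measurable_affine_rV.
Qed.

(** The choice [b = 1 - n / q] makes the exponent left after the Jacobian, [q - b * (q - 1) - n],
    equal to [b] again. So Hoelder's inequality contributes [(b + 1)^-1] to the power [q - 1] and
    the remaining integral one more such factor. The condition [b > -1] is [q > n / 2]. *)
Lemma integral_segment_average_powR a h (q : R) : 1 < q -> n%:R / 2 < q ->
  measurable_fun setT h -> (forall y, 0 <= h y) ->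
  (\int[mu]_x (segment_average a h x `^ q) <=
   ((2 - n%:R / q)^-1 `^ q)%:E * \int[mu]_x (h x `^ q)%:E)%E.
Proof.
move=> q1 nq mh h0; have q0 : 0 < q by lra.
pose b := 1 - n%:R / q.
have nq2 : n%:R / q < 2 by rewrite ltr_pdivrMr// mulrC -ltr_pdivrMr.
have bE : b + 1 = 2 - n%:R / q by rewrite /b; ring.
have b1 : -1 < b by rewrite -subr_gt0 opprK bE subr_gt0.
have b0 : 0 < b + 1 by lra.
rewrite -bE; set kp := (b + 1)^-1.
have kp0 : 0 <= kp by rewrite invr_ge0 ltW.
pose w (r : measurableTypeR R) := (1 - r) `^ (q - b * (q - 1)).
pose k x := h x `^ q.
have mk : measurable_fun setT k by exact: (measurableT_comp (measurable_powR q)).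
have mw : measurable_fun D w by exact: measurable_onem_powR.
have w0 r : D r -> 0 <= w r by rewrite powR_ge0.
have k0 x : 0 <= k x by rewrite powR_ge0.
apply: (@le_trans _ _ (\int[mu]_x ((kp `^ (q - 1))%:E *
    \int[la]_(r in D) (w r * k (toward a r x))%:E))%E).
  apply: ge0_le_integral => //.
  - by move=> x _; exact: poweR_ge0.
  - by apply: (measurableT_comp (measurable_poweR q)); exact: measurable_segment_average.
  - apply: measurable_funeM; exact: measurable_integral_toward.
  - move=> x _; apply: weighted_hoelder => //.
    by apply: (measurableT_comp mh); exact: measurable_toward_snd.
rewrite ge0_integralZl//; last 3 first.
- exact: measurable_integral_toward.
- move=> x _; apply: integral_ge0 => r Dr; rewrite lee_fin mulr_ge0//.
  exact: w0.
- by rewrite lee_fin powR_ge0.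
rewrite integral_toward// muleA lee_wpmul2r//.
  by apply: integral_ge0 => x _; rewrite lee_fin.
have -> : (\int[la]_(r in D) (w r * (1 - r) ^- n)%:E =
    \int[la]_(r in `[0%R, 1%R[) ((1 - r) `^ b)%:E)%E.
  apply: eq_integral => r /set_mem/D1 r0; rewrite /w -powR_mulrn ?ltW// -powRN -powRD.
    congr ((_ `^ _)%:E); rewrite /b; field.
    by rewrite gt_eqF.
  by rewrite (gt_eqF r0) implybT.
have -> : kp `^ q = kp `^ (q - 1) * kp.
  rewrite -[X in _ = _ * X]powRr1// -powRD ?subrK//.
  by rewrite (gt_eqF q0).
by rewrite EFinM lee_wpmul2l ?lee_fin ?powR_ge0// integral_onem_powR.
Qed.

(** A bound almost everywhere says nothing on a given segment, which is a null set. But the excess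
    of [h] over [M] has integral 0, hence so has its average, which therefore vanishes almost
    everywhere. What remains is [M] times the integral of [1 - r], which is at most 1. *)
Lemma segment_average_le_ae a h (M : R) : 0 <= M ->
  measurable_fun setT h -> (forall y, 0 <= h y) -> {ae mu, forall x, h x <= M} ->
  {ae mu, forall x, (segment_average a h x <= M%:E)%E}.
Proof.
move=> M0 mh h0 hM.
pose k x := Num.max (h x - M) 0.
have mk : measurable_fun setT k.
  by apply: measurable_maxr => //; exact: measurable_funB.
have k0 x : 0 <= k x by rewrite le_max lexx orbT.
have k00 : (\int[mu]_x (k x)%:E = 0)%E.
  rewrite -(integral0 mu setT); apply: ae_eq_integral => //.
    exact/measurable_EFinP.
  apply: filterS hM => x hx _; congr (_%:E); apply/max_idPr.
  by rewrite subr_le0.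
have mw : measurable_fun D (fun r : measurableTypeR R => 1 - r) by exact: measurable_funB.
have w0 r : D r -> 0 <= 1 - r by move=> /D1/ltW.
have G0 : (\int[mu]_x segment_average a k x = 0)%E.
  by rewrite /segment_average integral_toward// k00 mule0.
have : ae_eq mu setT (segment_average a k) (cst 0%E).
  apply/ae_eq_integral_abs => //; first exact: measurable_segment_average.
  by rewrite -[RHS]G0; apply: eq_integral => x _; rewrite gee0_abs// segment_average_ge0.
apply: filterS => x /(_ I) /= Gk.
have -> : M%:E = (M%:E + segment_average a k x)%E by rewrite Gk adde0.
have mtow f : measurable_fun setT f ->
    measurable_fun D (fun r : measurableTypeR R => ((1 - r) * f (toward a r x))%:E).
  move=> mf; apply/measurable_EFinP; apply: measurable_funM => //.
  apply: measurable_funTS; exact: (measurableT_comp mf (measurable_toward_snd a x)).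
apply: (@le_trans _ _ (\int[la]_(r in D) (((1 - r) * M)%:E +
    ((1 - r) * k (toward a r x))%:E))%E).
  apply: ge0_le_integral => //.
  - by move=> r /w0 r0; rewrite lee_fin mulr_ge0.
  - exact: mtow.
  - by apply: emeasurable_funD; [exact: (mtow (fun=> M))|exact: mtow].
  - move=> r /w0 r0; rewrite -EFinD lee_fin -mulrDr ler_wpM2l//.
    by rewrite -lerBlDl le_max lexx.
rewrite ge0_integralD//; last 4 first.
- by move=> r /w0 r0; rewrite lee_fin mulr_ge0.
- exact: (mtow (fun=> M)).
- by move=> r /w0 r0; rewrite lee_fin mulr_ge0.
- exact: mtow.
rewrite leeD2r//.
under eq_integral do rewrite EFinM.
rewrite ge0_integralZr//; last exact/measurable_EFinP.
rewrite -[leRHS]mul1e lee_wpmul2r//.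
have H : (\int[la]_(r in `[0%R, 1%R[) ((1 - r) `^ 1)%:E <= (2^-1)%:E)%E.
  by apply: (@integral_onem_powR R 1); lra.
apply: le_trans (_ : (2^-1)%:E <= 1)%E; last by rewrite lee_fin invf_le1 ?ler1n.
apply: le_trans H; rewrite le_eqVlt; apply/orP; left; apply/eqP.
by apply: eq_integral => r /set_mem/w0 r0; rewrite powRr1.
Qed.

End segment_average.
(** * Euclidean and operator norms *)

Section euclidean_norm.
Context {R : realType}.

(** Lagrange's identity: the difference of the two sides is half a sum of squares. *)
Lemma Cauchy_Schwarz_sum (I : finType) (x y : I -> R) :
  (\sum_i x i * y i) ^+ 2 <= (\sum_i x i ^+ 2) * \sum_i y i ^+ 2.
Proof.
rewrite -subr_ge0.
have -> : (\sum_i x i ^+ 2) * (\sum_i y i ^+ 2) - (\sum_i x i * y i) ^+ 2 =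
    2^-1 * \sum_i \sum_j (x i * y j - x j * y i) ^+ 2.
  have -> : \sum_i \sum_j (x i * y j - x j * y i) ^+ 2 =
      \sum_i \sum_j x i ^+ 2 * y j ^+ 2 - \sum_i \sum_j x i * y j * (x j * y i) *+ 2 +
      \sum_i \sum_j x j ^+ 2 * y i ^+ 2.
    rewrite -sumrB -big_split/=; apply: eq_bigr => i _.
    rewrite -sumrB -big_split/=; apply: eq_bigr => j _.
    by rewrite sqrrB !exprMn.
  have -> : \sum_i \sum_j x i ^+ 2 * y j ^+ 2 = (\sum_i x i ^+ 2) * \sum_i y i ^+ 2.
    by rewrite mulr_suml; apply: eq_bigr => i _; rewrite mulr_sumr.
  have -> : \sum_i \sum_j x j ^+ 2 * y i ^+ 2 = (\sum_i x i ^+ 2) * \sum_i y i ^+ 2.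
    rewrite mulrC mulr_suml; apply: eq_bigr => i _; rewrite mulr_sumr.
    by apply: eq_bigr => j _; rewrite mulrC.
  have -> : \sum_i \sum_j x i * y j * (x j * y i) *+ 2 = (\sum_i x i * y i) ^+ 2 *+ 2.
    rewrite expr2 mulr_suml -sumrMnl; apply: eq_bigr => i _.
    by rewrite mulr_sumr -sumrMnl; apply: eq_bigr => j _; congr (_ *+ _); ring.
  by field.
rewrite mulr_ge0 ?invr_ge0//; apply: sumr_ge0 => i _; apply: sumr_ge0 => j _.
exact: sqr_ge0.
Qed.

Context {m n : nat}.
Implicit Types A B : 'M[R]_(m, n).

Lemma enorm_ge0 A : 0 <= enorm A.
Proof. exact: sqrtr_ge0. Qed.

Lemma sqr_enorm A : enorm A ^+ 2 = \sum_i \sum_j A i j ^+ 2.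
Proof.
by rewrite sqr_sqrtr//; apply: sumr_ge0 => i _; apply: sumr_ge0 => j _; exact: sqr_ge0.
Qed.

Lemma enormE A : enorm A = Num.sqrt (\sum_(p : 'I_m * 'I_n) A p.1 p.2 ^+ 2).
Proof. by rewrite /enorm pair_bigA. Qed.

Lemma enorm0 : enorm (0 : 'M[R]_(m, n)) = 0.
Proof.
rewrite /enorm big1 ?sqrtr0// => i _; rewrite big1// => j _.
by rewrite mxE expr0n.
Qed.

Lemma enormZ (c : R) A : enorm (c *: A) = `|c| * enorm A.
Proof.
rewrite /enorm -sqrtr_sqr -sqrtrM ?sqr_ge0//; congr Num.sqrt.
rewrite mulr_sumr; apply: eq_bigr => i _; rewrite mulr_sumr; apply: eq_bigr => j _.
by rewrite mxE exprMn.
Qed.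

Lemma enormN A : enorm (- A) = enorm A.
Proof. by rewrite -scaleN1r enormZ normrN1 mul1r. Qed.

Lemma ler_enormD A B : enorm (A + B) <= enorm A + enorm B.
Proof.
rewrite -(ler_pXn2r (n := 2))// ?nnegrE ?addr_ge0 ?enorm_ge0//.
rewrite sqrrD !sqr_enorm.
have -> : \sum_i \sum_j (A + B) i j ^+ 2 = \sum_i \sum_j A i j ^+ 2 +
    (\sum_(p : 'I_m * 'I_n) A p.1 p.2 * B p.1 p.2) *+ 2 + \sum_i \sum_j B i j ^+ 2.
  rewrite -(pair_bigA _ (fun i j => A i j * B i j))/= -sumrMnl -!big_split/=.
  apply: eq_bigr => i _; rewrite -sumrMnl -!big_split/=; apply: eq_bigr => j _.
  by rewrite mxE sqrrD.
rewrite lerD2r lerD2l lerMn2r/= (le_trans (ler_norm _))//.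
rewrite -sqrtr_sqr !enormE -sqrtrM ?ler_wsqrtr ?Cauchy_Schwarz_sum//.
by apply: sumr_ge0 => p _; exact: sqr_ge0.
Qed.

Lemma ler_enorm_sum (I : Type) (r : seq I) (P : pred I) (F : I -> 'M[R]_(m, n)) :
  enorm (\sum_(i <- r | P i) F i) <= \sum_(i <- r | P i) enorm (F i).
Proof.
elim/big_rec2 : _ => [|i x A _ le]; first by rewrite enorm0.
by apply: le_trans (ler_enormD _ _) _; rewrite lerD2l.
Qed.

Lemma enorm_coord A i j : `|A i j| <= enorm A.
Proof.
rewrite -(ler_pXn2r (n := 2)) ?nnegrE ?enorm_ge0// sqr_enorm real_normK ?num_real//.
rewrite (bigD1 i)//= (bigD1 j)//= -addrA lerDl addr_ge0//.
  by apply: sumr_ge0 => k _; exact: sqr_ge0.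
by apply: sumr_ge0 => k _; apply: sumr_ge0 => l _; exact: sqr_ge0.
Qed.

Lemma enorm_row (v : 'rV[R]_n) : enorm v = Num.sqrt (\sum_j v ord0 j ^+ 2).
Proof. by rewrite /enorm big_ord1. Qed.

Lemma enorm_tr A : enorm A^T = enorm A.
Proof.
rewrite /enorm exchange_big/=; congr Num.sqrt; apply: eq_bigr => i _; apply: eq_bigr => j _.
by rewrite mxE.
Qed.

Lemma enorm_mul p A (B : 'M[R]_(n, p)) : enorm (A *m B) <= enorm A * enorm B.
Proof.
rewrite -sqrtrM; last by apply: sumr_ge0 => i _; apply: sumr_ge0 => j _; exact: sqr_ge0.
rewrite ler_wsqrtr// mulr_suml; apply: ler_sum => i _.
rewrite [in leRHS]exchange_big/= mulr_sumr; apply: ler_sum => k _.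
by rewrite mxE; exact: Cauchy_Schwarz_sum.
Qed.

End euclidean_norm.

Section operator_norm.
Context {R : realType} {m n : nat}.
Implicit Types A B : 'M[R]_(m, n).

(** The Frobenius norm of [A] bounds the set, so its [sup] is a true least upper bound. *)
Lemma opnorm_ub A (w : 'cV[R]_n) : enorm w <= 1 -> enorm (A *m w) <= opnorm A.
Proof.
move=> w1; apply: ub_le_sup; last by exists w.
exists (enorm A) => _ [z z1 <-]; apply: le_trans (enorm_mul _ _) _.
by rewrite ler_piMr ?enorm_ge0.
Qed.

Lemma opnorm_le A (c : R) :
  (forall w : 'cV[R]_n, enorm w <= 1 -> enorm (A *m w) <= c) -> opnorm A <= c.
Proof.
move=> Ac; apply: ge_sup; last by move=> _ [w w1 <-]; exact: Ac.
by exists (enorm (A *m (0 : 'cV[R]_n))); exists 0 => //=; rewrite enorm0.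
Qed.

Lemma opnorm_ge0 A : 0 <= opnorm A.
Proof.
apply: le_trans (opnorm_ub A (w := 0) _); first by rewrite mulmx0 enorm_ge0.
by rewrite enorm0.
Qed.

Lemma ler_opnormD A B : opnorm (A + B) <= opnorm A + opnorm B.
Proof.
apply: opnorm_le => w w1; rewrite mulmxDl; apply: le_trans (ler_enormD _ _) _.
by rewrite lerD ?opnorm_ub.
Qed.

End operator_norm.
(** * Taylor remainders at a vertex *)

Section remainder_bound.
Context {R : realType}.

(** The Cauchy-Schwarz inequality over triples of indices, between [H] and the tensor with entries
    [r j * y i * y k], whose norm factors. *)
Lemma trilinear_bound (M n : nat) (r : 'I_M -> R) (H : 'I_M -> 'I_n -> 'I_n -> R) (y : 'I_n -> R) :
  `|\sum_j r j * \sum_i \sum_k H j i k * (y i * y k)| <=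
  Num.sqrt (\sum_j r j ^+ 2) * Num.sqrt (\sum_j \sum_i \sum_k H j i k ^+ 2) *
  \sum_i y i ^+ 2.
Proof.
pose I := ('I_M * ('I_n * 'I_n))%type.
have flat (F : 'I_M -> 'I_n -> 'I_n -> R) :
    \sum_j \sum_i \sum_k F j i k = \sum_(p : I) F p.1 p.2.1 p.2.2.
  rewrite -(pair_bigA _ (fun j (q : 'I_n * 'I_n) => F j q.1 q.2))/=.
  by apply: eq_bigr => j _; rewrite pair_bigA.
have y0 : 0 <= \sum_i y i ^+ 2 by apply: sumr_ge0 => i _; exact: sqr_ge0.
have r0 : 0 <= \sum_j r j ^+ 2 by apply: sumr_ge0 => i _; exact: sqr_ge0.
have -> : \sum_j r j * (\sum_i \sum_k H j i k * (y i * y k)) =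
    \sum_(p : I) (r p.1 * (y p.2.1 * y p.2.2)) * H p.1 p.2.1 p.2.2.
  rewrite -(flat (fun j i k => (r j * (y i * y k)) * H j i k)).
  apply: eq_bigr => j _; rewrite mulr_sumr; apply: eq_bigr => i _.
  by rewrite mulr_sumr; apply: eq_bigr => k _; ring.
have E : \sum_(p : I) (r p.1 * (y p.2.1 * y p.2.2)) ^+ 2 =
    (\sum_j r j ^+ 2) * (\sum_i y i ^+ 2) ^+ 2.
  have -> : (\sum_i y i ^+ 2) ^+ 2 = \sum_i \sum_k y i ^+ 2 * y k ^+ 2.
    by rewrite [LHS]expr2 mulr_suml; apply: eq_bigr => i _; rewrite mulr_sumr.
  rewrite -(flat (fun j i k => (r j * (y i * y k)) ^+ 2)) mulr_suml.
  apply: eq_bigr => j _; rewrite mulr_sumr; apply: eq_bigr => i _.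
  by rewrite mulr_sumr; apply: eq_bigr => k _; rewrite !exprMn.
rewrite mulrAC -[X in _ * X * _](ger0_norm y0) -[X in _ * X * _]sqrtr_sqr -sqrtrM// -E.
rewrite flat -sqrtrM; last by apply: sumr_ge0 => p _; exact: sqr_ge0.
by rewrite -sqrtr_sqr ler_wsqrtr// Cauchy_Schwarz_sum.
Qed.

Context {n M : nat}.
Local Notation mu := (lebesgue_rV R n).
Local Notation la := (@lebesgue_measure R).
Variables (Omega U : set 'rV[R]_n) (a : 'rV[R]_n).
Variable H : 'I_M -> 'I_n -> 'I_n -> 'rV[R]_n -> R.
Hypothesis UO : U `<=` Omega.
Hypothesis starU : forall x r, U x -> 0 <= r < 1 -> U (toward a r x).

Let h (x : 'rV[R]_n) := Num.sqrt (\sum_j \sum_i \sum_k H j i k x ^+ 2).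
Hypothesis mh : measurable_fun setT (h \_ U).

(** A bound on each component would introduce a factor depending on [M]. Pairing the remainder with
    itself reduces to a scalar integral, where [trilinear_bound] applies under the integral sign and
    [t - r <= 1 - r] gives the weight of [segment_average]; one factor [rho] is then cancelled. *)
Lemma taylor_remainder_bound (t D : R) (x : 'rV[R]_n) : U x -> 0 < t < 1 ->
  enorm (x - a) <= D ->
  (forall j, la.-integrable setT
    (fun r => (EFin \o taylor_kernel Omega U a t (H j)) (r, x))) ->
  ((enorm (\row_j taylor_remainder Omega U a t (H j) x))%:E <=
    (D ^+ 2)%:E * segment_average a (h \_ U) x)%E.
Proof.
move=> Ux /andP[t0 t1] xD Ki; have D0 : 0 <= D by exact: le_trans (enorm_ge0 _) xD.
pose r_ j := taylor_remainder Omega U a t (H j) x.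
set rho := enorm _.
have rho0 : 0 <= rho by exact: enorm_ge0.
have hU0 y : 0 <= (h \_ U) y by rewrite /patch; case: ifP => // _; rewrite sqrtr_ge0.
have G0 : (0 <= segment_average a (h \_ U) x)%E by exact: segment_average_ge0.
have rhoE : rho = Num.sqrt (\sum_j r_ j ^+ 2).
  by rewrite /rho enorm_row; congr Num.sqrt; apply: eq_bigr => j _; rewrite mxE.
have [->|rn0] := eqVneq rho 0; first by rewrite mule_ge0// lee_fin sqr_ge0.
have rgt0 : 0 < rho by rewrite lt_neqAle eq_sym rn0.
(* The remainder vector is tested against itself. *)
pose S (r : measurableTypeR R) := \sum_j r_ j * taylor_kernel Omega U a t (H j) (r, x).
have Kj j : la.-integrable setT (EFin \o (fun r => taylor_kernel Omega U a t (H j) (r, x))).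
  exact: Ki.
have Si : la.-integrable setT (EFin \o S).
  by apply: integrable_EFin_sum => j; exact: integrable_EFinZ.
have SE : \int[la]_r S r = rho ^+ 2.
  rewrite Rintegral_sum => [|j]; last exact: integrable_EFinZ.
  rewrite rhoE sqr_sqrtr; last by apply: sumr_ge0 => j _; exact: sqr_ge0.
  by apply: eq_bigr => j _; rewrite RintegralZl// expr2.
pose F : measurableTypeR R -> \bar R :=
  (fun r => ((rho * D ^+ 2) * ((1 - r) * (h \_ U) (toward a r x)))%:E) \_ `[0, 1[%classic.
have FE r : F r = if r \in `[0, 1[%classic
    then ((rho * D ^+ 2) * ((1 - r) * (h \_ U) (toward a r x)))%:E else 0%E by [].
have SF r : (`|(S r)%:E| <= F r)%E.
  rewrite FE /S /taylor_kernel/= indicE; case: (boolP (r \in _)) => rt; last first.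
    rewrite big1; last by move=> j _; rewrite mul0r mulr0.
    rewrite normr0; case: ifPn => // /set_mem; rewrite /= in_itv/= => /andP[_ r1].
    by rewrite lee_fin !mulr_ge0 ?sqr_ge0 ?subr_ge0// ltW.
  have /andP[r0 rt'] : 0 <= r <= t by move: rt; rewrite inE/= in_itv.
  have r1 : r < 1 by exact: le_lt_trans t1.
  rewrite ifT; last by rewrite inE/= in_itv/= r0.
  have Ur : U (toward a r x) by apply: starU => //; rewrite r0.
  have -> : (h \_ U) (toward a r x) = h (toward a r x) by rewrite /patch ifT// inE.
  rewrite indicE (mem_set Ux).
  under eq_bigr do rewrite !mul1r mulrCA.
  rewrite -mulr_sumr lee_fin normrM ger0_norm ?subr_ge0//.
  have -> : rho * D ^+ 2 * ((1 - r) * h (toward a r x)) =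
      (1 - r) * (rho * h (toward a r x) * D ^+ 2) by ring.
  apply: ler_pM => //; first by rewrite subr_ge0.
    by rewrite lerD2r ltW.
  have -> : \sum_j r_ j * \sum_i \sum_k (H j i k \_ Omega) (toward a r x) *
      ((x ord0 i - a ord0 i) * (x ord0 k - a ord0 k)) =
      \sum_j r_ j * \sum_i \sum_k H j i k (toward a r x) *
      ((x ord0 i - a ord0 i) * (x ord0 k - a ord0 k)).
    apply: eq_bigr => j _; congr (_ * _); apply: eq_bigr => i _; apply: eq_bigr => k _.
    by rewrite /patch ifT// inE; exact: UO.
  apply: le_trans (trilinear_bound r_ (fun j i k => H j i k (toward a r x))
    (fun i => x ord0 i - a ord0 i)) _.
  rewrite -rhoE ler_wpM2l ?mulr_ge0 ?sqrtr_ge0//.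
  have -> : \sum_i (x ord0 i - a ord0 i) ^+ 2 = enorm (x - a) ^+ 2.
    by rewrite sqr_enorm big_ord1; apply: eq_bigr => i _; rewrite !mxE.
  by rewrite lerXn2r ?nnegrE ?enorm_ge0.
have mF : measurable_fun setT F.
  apply/(measurable_restrictT _ _).1; first exact: measurable_itv.
  apply/measurable_EFinP; apply: measurable_funM => //; apply: measurable_funM.
    exact: measurable_funB.
  by apply: measurable_funTS; exact: (measurableT_comp mh (measurable_toward_snd a x)).
have key : ((rho ^+ 2)%:E <= (rho * D ^+ 2)%:E * segment_average a (h \_ U) x)%E.
  have -> : ((rho ^+ 2)%:E = \int[la]_r (S r)%:E)%E.
    by rewrite -SE /Rintegral fineK//; exact: (integrable_fin_num measurableT Si).
  apply: le_trans (lee_abs _) _; apply: le_trans (le_abse_integral _ measurableT _) _.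
    exact: measurable_int Si.
  apply: (@le_trans _ _ (\int[la]_r F r)%E).
    apply: ge0_le_integral => //; first exact: (measurableT_comp _ (measurable_int _ Si)).
  rewrite /F -integral_mkcond; under eq_integral do rewrite EFinM.
  rewrite ge0_integralZl//.
  - apply/measurable_EFinP; apply: measurable_funM; first exact: measurable_funB.
    by apply: measurable_funTS; exact: (measurableT_comp mh (measurable_toward_snd a x)).
  - move=> r; rewrite /= in_itv/= => /andP[_ r1].
    by rewrite lee_fin mulr_ge0// subr_ge0 ltW.
  - by rewrite lee_fin mulr_ge0// sqr_ge0.
have rfin : rho%:E \is a fin_num by [].
rewrite -(lee_pmul2l rfin) ?lte_fin//.
by rewrite -EFinM muleA -EFinM -expr2.
Qed.

End remainder_bound.

Lemma ae_aff (R : realType) (n : nat) (c : R) (b : 'rV[R]_n) (P : 'rV[R]_n -> Prop) : 0 < c ->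
  {ae lebesgue_rV R n, forall x, P x} -> {ae lebesgue_rV R n, forall x, P (aff c b x)}.
Proof.
move=> c0 [A [mA A0 PA]]; exists (aff c b @^-1` A); split.
- by rewrite -[X in measurable X]setTI; exact: measurable_affine_rV.
- have := lebesgue_rV_affine b c0 mA; rewrite A0 => /esym/eqP.
  by rewrite mule_eq0 eqe expf_eq0 (gt_eqF c0) andbF/= => /eqP.
- by move=> x /= nP; apply: PA.
Qed.
Section vertex_taylor.
Context {R : realType}.

Lemma cvg_sumr (T : Type) (F : set_system T) (FF : Filter F) (I : Type) (r : seq I)
    (f : I -> T -> R) (l : I -> R) : (forall i, f i x @[x --> F] --> l i) ->
  \sum_(i <- r) f i x @[x --> F] --> \sum_(i <- r) l i.
Proof.
move=> fl; elim: r => [|i r IH].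
  by rewrite big_nil; under eq_fun do rewrite big_nil; exact: cvg_cst.
by rewrite big_cons; under eq_fun do rewrite big_cons; exact: cvgD.
Qed.

Lemma within_continuous_cvg (S T : topologicalType) (A : set S) (f : S -> T) (a : S)
    (x : nat -> S) :
  {within A, continuous f} -> A a -> (forall m, A (x m)) -> x m @[m --> \oo] --> a ->
  f (x m) @[m --> \oo] --> f a.
Proof.
move=> cf Aa Ax xa.
have xs : x @ \oo --> (a : subspace A).
  apply/(subspace_cvgP _ Aa) => B wB.
  have HB : \forall m \near \oo, A (x m) -> B (x m) by exact: xa wB.
  suff : \forall m \near \oo, B (x m) by [].
  by apply: filterS HB => m; apply.
exact: (@cvg_comp nat (subspace A) T x f \oo (nbhs (a : subspace A)) (nbhs (f a)) xs (cf a)).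
Qed.

Lemma cvg_harmonic_onem : (1 - m.+2%:R^-1 : R) @[m --> \oo] --> (1 : R).
Proof.
rewrite -[X in _ --> X]subr0; apply: cvgB; first exact: cvg_cst.
have := @cvg_harmonic R; rewrite -(cvg_shiftS (@harmonic R)); exact.
Qed.

Context {n M : nat}.
Local Notation mu := (lebesgue_rV R n).
Local Notation la := (@lebesgue_measure R).
Variables (Omega U : set 'rV[R]_n) (a : 'rV[R]_n) (D : R).
Variables (u v : 'I_M -> 'rV[R]_n -> R) (g : 'I_M -> 'I_n -> 'rV[R]_n -> R).
Variable H : 'I_M -> 'I_n -> 'I_n -> 'rV[R]_n -> R.
Hypotheses (oO : open Omega) (oU : open U) (bU : bounded_set U) (UO : U `<=` Omega).
Hypothesis aO : closure Omega a.
Hypothesis starU : forall x r, U x -> 0 <= r < 1 -> U (toward a r x).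
Hypothesis UD : forall x, U x -> enorm (x - a) <= D.
Hypothesis D0 : 0 < D.
Hypothesis ui : forall j, mu.-integrable Omega (EFin \o u j).
Hypothesis Hi : forall j i k, mu.-integrable Omega (EFin \o H j i k).
Hypothesis wg : forall j i, weak_derivative Omega [:: i] (u j) (g j i).
Hypothesis wH : forall j i k, weak_derivative Omega [:: i; k] (u j) (H j i k).
Hypothesis cv : forall j, {within closure Omega, continuous (v j)}.
Hypothesis uv : forall j, {ae mu, forall x, Omega x -> u j x = v j x}.

Let h (x : 'rV[R]_n) := Num.sqrt (\sum_j \sum_i \sum_k H j i k x ^+ 2).
Hypothesis mh : measurable_fun setT (h \_ U).

(* Limit [t --> 1] of [weak_taylor], which exists because [v] is continuous at [a]. *)
Lemma vertex_taylor : {ae mu, forall x, U x ->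
  ((enorm (\row_j (v j a - v j x + \sum_i g j i x * (x ord0 i - a ord0 i))))%:E <=
    (D ^+ 2)%:E * segment_average a (h \_ U) x)%E}.
Proof.
(* The shift by 2 keeps [t m] strictly between 0 and 1 for all [m]. A sequence is taken so that
   countably many null sets are discarded. *)
pose t (m : nat) : R := 1 - m.+2%:R^-1.
have t01 m : 0 < t m < 1.
  by rewrite /t subr_gt0 invf_lt1 ?ltr0n// ltr1n gtrDl oppr_lt0 invr_gt0 ltr0n.
have towardO m x r : U x -> 0 <= r <= t m -> Omega (toward a r x).
  move=> Ux /andP[r0 rt]; apply/UO/starU => //; rewrite r0.
  by case/andP : (t01 m) => _; exact: le_lt_trans.
have A1 : {ae mu, forall x, forall mj : nat * 'I_M, U x ->
    u mj.2 (toward a (t mj.1) x) - u mj.2 x +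
      t mj.1 * \sum_i g mj.2 i x * (x ord0 i - a ord0 i) =
    taylor_remainder Omega U a (t mj.1) (H mj.2) x}.
  by apply: ae_countable => -[m j]; exact: (weak_taylor oO oU bU (t01 m) (towardO m)).
have A2 : {ae mu, forall x, forall mj : nat * 'I_M, la.-integrable setT
    (fun r => (EFin \o taylor_kernel Omega U a (t mj.1) (H mj.2)) (r, x))}.
  apply: ae_countable => -[m j].
  exact: (ae_integrable2 (integrable_taylor_kernel a oO oU bU (t01 m) (Hi j))).
have A3 : {ae mu, forall x, forall mj : nat * 'I_M,
    Omega (toward a (t mj.1) x) -> u mj.2 (toward a (t mj.1) x) = v mj.2 (toward a (t mj.1) x)}.
  apply: ae_countable => -[m j]; apply: (ae_aff _ _ (uv j)).
  by rewrite subr_gt0; case/andP : (t01 m).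
have A4 : {ae mu, forall x, forall j, Omega x -> u j x = v j x} by exact: ae_countable.
apply: filterS (filterI A1 (filterI A2 (filterI A3 A4))) => x [B1 [B2 [B3 B4]]] Ux.
have hU0 y : 0 <= (h \_ U) y by rewrite /patch; case: ifP => // _; rewrite sqrtr_ge0.
have := segment_average_ge0 a x hU0.
(* An infinite average makes the bound trivial, since [D > 0] excludes the product of 0 and
   [+oo]. *)
case E : (segment_average a (h \_ U) x) => [r| |] // r0; last first.
  by rewrite gt0_muley ?leey// lte_fin exprn_gt0.
rewrite -EFinM lee_fin; rewrite lee_fin in r0.
have C0 : 0 <= D ^+ 2 * r by rewrite mulr_ge0 ?sqr_ge0.
pose e m j := v j (toward a (t m) x) - v j x + t m * \sum_i g j i x * (x ord0 i - a ord0 i).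
have Ut m : U (toward a (t m) x).
  by apply: starU => //; case/andP : (t01 m) => t0 ->; rewrite ltW.
have eE m j : e m j = taylor_remainder Omega U a (t m) (H j) x.
  by rewrite -(B1 (m, j) Ux)/= (B3 (m, j))/= ?B4//; exact: UO.
have ebound m : \sum_j e m j ^+ 2 <= (D ^+ 2 * r) ^+ 2.
  have := taylor_remainder_bound UO starU mh Ux (t01 m) (UD Ux) (fun j => B2 (m, j)).
  rewrite E -EFinM lee_fin -(ler_pXn2r (n := 2)) ?nnegrE ?enorm_ge0//.
  rewrite sqr_enorm big_ord1 => /(le_trans _); apply.
  by apply: ler_sum => j _; rewrite mxE eE.
have tx : toward a (t m) x @[m --> \oo] --> a.
  rewrite /toward /aff -[X in _ --> X]add0r; apply: cvgD.
    rewrite -[X in _ --> X](scale0r x); apply: cvgZr_tmp.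
    rewrite -(subrr 1); apply: cvgB; [exact: cvg_cst|exact: cvg_harmonic_onem].
  rewrite -[X in _ --> X](scale1r a); apply: cvgZr_tmp; exact: cvg_harmonic_onem.
have ecvg j : e m j @[m --> \oo] --> v j a - v j x + \sum_i g j i x * (x ord0 i - a ord0 i).
  apply: cvgD; last first.
    by rewrite -[X in _ --> X]mul1r; apply: cvgMr_tmp; exact: cvg_harmonic_onem.
  apply: cvgB; last exact: cvg_cst.
  have tO m : closure Omega (toward a (t m) x) by apply: subset_closure; exact: UO.
  exact: (within_continuous_cvg (@cv j) aO tO tx).
have scvg : \sum_j e m j ^+ 2 @[m --> \oo] -->
    \sum_j (v j a - v j x + \sum_i g j i x * (x ord0 i - a ord0 i)) ^+ 2.
  by apply: cvg_sumr => j; rewrite expr2; under eq_fun do rewrite expr2; exact: cvgM.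
rewrite -(ler_pXn2r (n := 2)) ?nnegrE ?enorm_ge0// sqr_enorm big_ord1.
under eq_bigr do rewrite mxE.
rewrite -(cvg_lim _ scvg)//; apply: limr_le; first exact: cvgP scvg.
exact: nearW.
Qed.

End vertex_taylor.
(** * Barycentric coordinates *)

Section barycentric.
Context {R : realType} {n : nat}.
Implicit Types (V : 'M[R]_(n.+1, n)) (x w : 'rV[R]_n) (K : set 'rV[R]_n).

(** Homogeneous coordinates: with a leading 1, the affine relations between points become linear and
    the constraint that weights sum to 1 becomes one more column. *)
Definition homog m (Y : 'M[R]_(m, n)) : 'M[R]_(m, 1 + n) := row_mx (const_mx 1) Y.

Definition nondegenerate V := homog V \in unitmx.

(** The weights [w] solving [w *m homog V = homog x], that is, both [w *m V = x] and sum 1. *)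
Definition bary V x : 'rV[R]_n.+1 := homog x *m invmx (homog V).

(** Column [k] is the gradient of the [k]-th barycentric coordinate; the row removed from the
    inverse holds the constant terms. *)
Definition bary_grad V : 'M[R]_(n, n.+1) := @dsubmx R 1 n n.+1 (invmx (homog V)).

Definition osimplex V : set 'rV[R]_n := [set x | forall k, 0 < bary V x ord0 k].

Lemma homog_mul m (w : 'rV[R]_m) (Y : 'M[R]_(m, n)) : \sum_j w ord0 j = 1 ->
  homog (w *m Y) = w *m homog Y.
Proof.
move=> w1; rewrite /homog mul_mx_row; congr row_mx; apply/matrixP => i j.
by rewrite !ord1 !mxE -[LHS]w1; apply: eq_bigr => k _; rewrite mxE mulr1.
Qed.

Lemma homogD x w : homog (x + w) = homog x + row_mx 0 w.
Proof. by rewrite /homog add_row_mx addr0. Qed.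

Lemma row_homog m (Y : 'M[R]_(m, n)) j : row j (homog Y) = homog (row j Y).
Proof. by rewrite /homog row_row_mx row_const. Qed.

Lemma bary_comb V m (w : 'rV[R]_m) (Y : 'M[R]_(m, n)) k : \sum_j w ord0 j = 1 ->
  bary V (w *m Y) ord0 k = \sum_j w ord0 j * bary V (row j Y) ord0 k.
Proof.
move=> w1; rewrite /bary homog_mul// -mulmxA mxE; apply: eq_bigr => j _.
by rewrite -row_homog -row_mul [in RHS]mxE.
Qed.

Lemma baryD V x w : bary V (x + w) = bary V x + w *m bary_grad V.
Proof.
rewrite /bary homogD mulmxDl; congr (_ + _).
rewrite -[X in row_mx _ _ *m X](@vsubmxK _ 1 n).
by rewrite mul_row_col mul0mx add0r.
Qed.

Lemma bary_toward V a r x :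
  bary V (toward a r x) = (1 - r) *: bary V x + r *: bary V a.
Proof.
rewrite /toward /aff (_ : _ + _ = x + r *: (a - x)); last first.
  by apply/rowP => i; rewrite !mxE; ring.
rewrite baryD -scalemxAl (_ : a = x + (a - x)); last by rewrite addrC subrK.
by rewrite baryD addrAC subrr add0r scalerDr addrA -scalerDl subrK scale1r.
Qed.

Lemma bary_toward_coord V a r x k :
  bary V (toward a r x) ord0 k = (1 - r) * bary V x ord0 k + r * bary V a ord0 k.
Proof. by rewrite bary_toward [LHS]mxE; congr (_ + _); exact: mxE. Qed.

Lemma smooth_bary V k : smooth (fun x => bary V x ord0 k).
Proof.
apply: (eq_smooth (g := fun x : 'rV[R]_n =>
    bary V 0 ord0 k + \sum_i x ord0 i * bary_grad V i k)).
  by move=> x; rewrite -[in RHS](add0r x) baryD [in RHS]mxE; congr (_ + _); rewrite mxE.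
apply: smoothD; first exact: smooth_cst.
by apply: smooth_sum => i; apply: smoothM; [exact: smooth_coord|exact: smooth_cst].
Qed.

Lemma open_osimplex V : open (osimplex V).
Proof.
rewrite openE => x Ux; rewrite /interior/=.
have H k : nbhs x [set y : 'rV[R]_n | 0 < bary V y ord0 k].
  have ck : continuous (fun y : 'rV[R]_n => bary V y ord0 k).
    exact: smooth_continuous (smooth_bary V k).
  exact: (cvgr_gt _ (@ck x) _ (Ux k)).
exact: (filter_forall (nbhs_filter x) H).
Qed.

Lemma bary_sum V x : nondegenerate V -> \sum_k bary V x ord0 k = 1.
Proof.
move=> uV; have E : bary V x *m homog V = homog x by rewrite /bary mulmxKV.
have := congr1 (fun M : 'M[R]_(1, 1 + n) => M ord0 (lshift n ord0)) E.
rewrite /homog row_mxEl mul_mx_row row_mxEl !mxE => <-.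
by apply: eq_bigr => k _; rewrite [const_mx _ _ _]mxE mulr1.
Qed.

Lemma bary_mul V x : nondegenerate V -> bary V x *m V = x.
Proof.
move=> uV; have : bary V x *m homog V = homog x by rewrite /bary mulmxKV.
by rewrite /homog mul_mx_row => /eq_row_mx[_ ->].
Qed.

Lemma faceP V I x : nondegenerate V -> face V I x <->
  (forall k, 0 <= bary V x ord0 k) /\ (forall k, k \notin I -> bary V x ord0 k = 0).
Proof.
move=> uV; split=> [[w [w0 wI w1 ->]]|[x0 xI]].
  suff -> : bary V (w *m V) = w by [].
  by rewrite /bary homog_mul// mulmxK.
by exists (bary V x); split; rewrite ?bary_sum ?bary_mul.
Qed.

Lemma simplexP V x : nondegenerate V ->
  face V [set: 'I_n.+1]%SET x <-> forall k, 0 <= bary V x ord0 k.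
Proof.
move=> uV; rewrite faceP//; split=> [[]//|x0]; split => // k.
by rewrite inE.
Qed.

Lemma bary_row V i k : nondegenerate V -> bary V (row i V) ord0 k = (k == i)%:R.
Proof.
move=> uV; rewrite /bary -row_homog -row_mul mulmxV// row1 mxE eqxx.
by rewrite andTb.
Qed.

(** A vector in the kernel of [homog V] is an affine function vanishing at all vertices, hence on
    the simplex. As the simplex contains a ball, its linear part and then its constant term are
    0. *)
Lemma nondegenerateP V : interior (face V [set: 'I_n.+1]%SET) !=set0 -> nondegenerate V.
Proof.
move=> [c]; rewrite /interior/= => /nbhs_ballP[e /= e0 ce].
rewrite /nondegenerate unitmxE unitfE -det_tr; apply/negP => /det0P[v v0 vV].
have Vv : homog V *m v^T = 0 by rewrite -[homog V]trmxK -trmx_mul vV trmx0.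
have face0 x : face V [set: 'I_n.+1]%SET x -> homog x *m v^T = 0.
  by move=> [w [_ _ w1 ->]]; rewrite homog_mul// -mulmxA Vv mulmx0.
have c0 : homog c *m v^T = 0 by apply: face0; apply: ce; exact: ballxx.
have d0 (w : 'rV[R]_n) : (row_mx 0 w : 'M[R]_(1, 1 + n)) *m v^T = 0.
  (* Small enough for [c + s *: w] to stay in the ball. *)
  pose s := e / (2 * (`|w| + 1)).
  have w1 : 0 < `|w| + 1 by rewrite ltr_wpDl.
  have s0 : 0 < s by rewrite divr_gt0// mulr_gt0.
  have : homog (c + s *: w) *m v^T = 0.
    apply: face0; apply: ce; rewrite -ball_normE/= opprD addrA subrr sub0r normrN.
    rewrite normrZ gtr0_norm// /s mulrAC ltr_pdivrMr ?mulr_gt0// ltr_pM2l//.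
    have := normr_ge0 w; lra.
  rewrite homogD mulmxDl c0 add0r -[X in row_mx X _](scaler0 _ s) -scale_row_mx -scalemxAl.
  by move/eqP; rewrite scaler_eq0 gt_eqF//= => /eqP.
have vE : v^T = col_mx (@lsubmx _ 1 1 n v)^T (@rsubmx _ 1 1 n v)^T.
  by rewrite -tr_row_mx hsubmxK.
have v2 : (@rsubmx _ 1 1 n v)^T = 0.
  apply/row_matrixP => i; rewrite row0 rowE -(d0 (delta_mx ord0 i)) vE mul_row_col.
  by rewrite mul0mx add0r.
have v1 : (@lsubmx _ 1 1 n v)^T = 0.
  move: c0; rewrite vE /homog mul_row_col v2 mulmx0 addr0 => /matrixP H.
  by apply/matrixP => i j; have := H i j; rewrite !ord1 mxE big_ord1 mxE mul1r => ->.
by move: v0; rewrite -[v]trmxK vE v1 v2 col_mx0 trmx0 eqxx.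
Qed.

End barycentric.
Section simplex_geometry.
Context {R : realType} {n : nat}.
Local Notation mu := (lebesgue_rV R n).
Implicit Types (V W : 'M[R]_(n.+1, n)) (x w : 'rV[R]_n) (K : set 'rV[R]_n) (f p : 'rV[R]_n -> R).
Local Notation simplex V := (face V [set: 'I_n.+1]%SET).

Lemma bary_le1 V x k : nondegenerate V -> simplex V x -> bary V x ord0 k <= 1.
Proof.
move=> uV /(simplexP _ uV) x0; rewrite -(bary_sum x uV) (bigD1 k)//= lerDl.
exact: sumr_ge0.
Qed.

Lemma bary_eq1 V x k : nondegenerate V -> simplex V x -> bary V x ord0 k = 1 -> x = row k V.
Proof.
move=> uV /(simplexP _ uV) x0 k1.
have := bary_sum x uV; rewrite (bigD1 k)//= k1 => /eqP; rewrite -[X in _ == X]addr0 (inj_eq (addrI 1)).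
rewrite psumr_eq0// => /allP H; rewrite -(bary_mul x uV) rowE; congr (_ *m _).
apply/rowP => j; rewrite [RHS]mxE/=; have [->|jk] := eqVneq j k; first exact: k1.
by have := H j; rewrite mem_index_enum jk => /(_ isT)/eqP.
Qed.

Lemma row_simplex V i : nondegenerate V -> simplex V (row i V).
Proof. by move=> uV; apply/(simplexP _ uV) => k; rewrite bary_row. Qed.

(* The vertices of a simplex are extreme points, hence do not depend on its representation. *)
Lemma extreme_row V m (w : 'rV[R]_m) (Y : 'M[R]_(m, n)) k : nondegenerate V ->
  (forall j, 0 <= w ord0 j) -> \sum_j w ord0 j = 1 ->
  (forall j, w ord0 j != 0 -> simplex V (row j Y)) -> row k V = w *m Y ->
  exists2 j, w ord0 j != 0 & row j Y = row k V.
Proof.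
move=> uV w0 w1 YV kE.
have /eqP : \sum_j w ord0 j * (1 - bary V (row j Y) ord0 k) = 0.
  under eq_bigr do rewrite mulrBr mulr1.
  by rewrite sumrB w1 -bary_comb// -kE bary_row// eqxx subrr.
rewrite psumr_eq0; last first.
  move=> j _; have [->|wj] := eqVneq (w ord0 j) 0; first by rewrite mul0r.
  by rewrite mulr_ge0// subr_ge0 bary_le1//; exact: YV.
move=> /allP H.
have [j wj] : exists j, w ord0 j != 0.
  apply/existsP; apply: contraT; rewrite negb_exists => /forallP w00.
  have := w1; rewrite big1 => [/esym/eqP|j _]; first by rewrite oner_eq0.
  by have := w00 j; rewrite negbK => /eqP.
exists j => //; apply: bary_eq1 => //; first exact: YV.
have := H j (mem_index_enum _); rewrite mulf_eq0 (negbTE wj)/= subr_eq0.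
by move/eqP.
Qed.

Lemma simplex_vertices V W i : nondegenerate V -> nondegenerate W ->
  simplex V = simplex W -> exists j, row i W = row j V.
Proof.
move=> uV uW VW; have [w [w0 _ w1 wE]] : simplex V (row i W) by rewrite VW; exact: row_simplex.
have [|j _ jE] := extreme_row uW w0 w1 _ wE; last by exists j.
by move=> j _; rewrite -VW; exact: row_simplex.
Qed.

Definition interp V f x := \sum_k bary V x ord0 k * f (row k V).

Lemma interp_comb V f m (w : 'rV[R]_m) (Y : 'M[R]_(m, n)) : \sum_j w ord0 j = 1 ->
  interp V f (w *m Y) = \sum_j w ord0 j * interp V f (row j Y).
Proof.
move=> w1; rewrite /interp; under eq_bigr do rewrite bary_comb// mulr_suml.
rewrite exchange_big/=; apply: eq_bigr => j _; rewrite mulr_sumr.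
by apply: eq_bigr => k _; rewrite mulrA.
Qed.

Lemma interp_row V f i : nondegenerate V -> interp V f (row i V) = f (row i V).
Proof.
move=> uV; rewrite /interp (bigD1 i)//= bary_row// eqxx mul1r big1 ?addr0// => k ki.
by rewrite bary_row// (negbTE ki) mul0r.
Qed.

Lemma interpD V f x w : interp V f (x + w) =
  interp V f x + \sum_k (w *m bary_grad V) ord0 k * f (row k V).
Proof.
by rewrite /interp -big_split/=; apply: eq_bigr => k _; rewrite baryD [in LHS]mxE mulrDl.
Qed.

Lemma interp_affine V f K : affine_on K (interp V f).
Proof.
exists (\row_i \sum_k bary_grad V i k * f (row k V)), (interp V f 0) => x _.
rewrite -[x in LHS]add0r interpD addrC; congr (_ + _).
under eq_bigr do rewrite [X in X * _]mxE mulr_suml.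
rewrite exchange_big/=; apply: eq_bigr => i _; rewrite mxE mulr_suml.
by apply: eq_bigr => k _; ring.
Qed.

Lemma affine_interp V p x : nondegenerate V -> affine_on (simplex V) p -> simplex V x ->
  p x = interp V p x.
Proof.
move=> uV [a [b pE]] xV; rewrite pE// /interp.
under [in RHS]eq_bigr => k do rewrite (pE _ (row_simplex k uV)) mulrDr mulr_sumr.
rewrite big_split/= -mulr_suml bary_sum// mul1r; congr (_ + _).
rewrite -{1}(bary_mul x uV) exchange_big/=; apply: eq_bigr => i _.
rewrite [X in _ * X = _]mxE mulr_sumr; apply: eq_bigr => k _; rewrite [row _ _ _ _]mxE; ring.
Qed.

Lemma smooth_interp V f : smooth (interp V f).
Proof.
by apply: smooth_sum => k; apply: smoothM; [exact: smooth_bary|exact: smooth_cst].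
Qed.

Lemma continuous_interp V f : continuous (interp V f).
Proof. exact: smooth_continuous (smooth_interp V f). Qed.

Lemma closed_simplex V : nondegenerate V -> closed (simplex V).
Proof.
move=> uV; rewrite (_ : simplex V = \bigcap_(k in [set: 'I_n.+1]) [set x | 0 <= bary V x ord0 k]).
  apply: closed_bigI => k _.
  apply: (preimage_closed (f := fun x : 'rV[R]_n => bary V x ord0 k) (D := [set y | 0 <= y])).
    by move=> x _; apply: (smooth_continuous (smooth_bary V k)).
  exact: closed_ge.
by apply/seteqP; split=> x;
  [move=> /(simplexP _ uV) x0 k _|move=> x0; apply/(simplexP _ uV) => k]; exact: x0.
Qed.

Lemma simplex_enorm_le V x : simplex V x -> enorm x <= \sum_k enorm (row k V).
Proof.
move=> [w [w0 _ w1 ->]]; rewrite mulmx_sum_row; apply: le_trans (ler_enorm_sum _ _ _) _.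
apply: ler_sum => k _; rewrite enormZ ger0_norm// ler_piMl ?enorm_ge0//.
by rewrite -w1 (bigD1 k)//= lerDl sumr_ge0.
Qed.

Lemma osimplex_simplex V : nondegenerate V -> osimplex V `<=` simplex V.
Proof. by move=> uV x Ux; apply/(simplexP _ uV) => k; exact: ltW. Qed.

Lemma osimplex_toward V k x r : nondegenerate V -> osimplex V x -> 0 <= r < 1 ->
  osimplex V (toward (row k V) r x).
Proof.
move=> uV Ux /andP[r0 r1] j; rewrite bary_toward_coord bary_row// ltr_wpDr ?mulr_ge0//.
by rewrite mulr_gt0// subr_gt0.
Qed.

Lemma bary_grad_neq0 V k : (0 < n)%N -> nondegenerate V -> exists i, bary_grad V i k != 0.
Proof.
move=> n0 uV; apply/existsP; apply: contraT; rewrite negb_exists => /forallP B0.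
have E x y : bary V x ord0 k = bary V y ord0 k.
  have H z : bary V z ord0 k = bary V 0 ord0 k.
    rewrite -[z in LHS]add0r baryD [LHS]mxE [X in _ + X]mxE big1 ?addr0// => i _.
    by have := B0 i; rewrite negbK => /eqP ->; rewrite mulr0.
  by rewrite H (H y).
have [j jk] : exists j : 'I_n.+1, k != j.
  by exists (lift k (Ordinal n0)); exact: neq_lift.
have := E (row k V) (row j V); rewrite !bary_row// eqxx (negbTE jk) => /eqP.
by rewrite oner_eq0.
Qed.

(** A point of the difference has a vanishing barycentric coordinate, so it lies on one of [n + 1]
    hyperplanes, which are null. *)
Lemma simplex_osimplex_ae V : (0 < n)%N -> nondegenerate V ->
  {ae mu, forall x, simplex V x -> osimplex V x}.
Proof.
move=> n0 uV.
pose a k : 'rV[R]_n := \row_i bary_grad V i k.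
have a0 k : a k != 0.
  have [i Bi] := bary_grad_neq0 k n0 uV; apply: contra Bi => /eqP/rowP/(_ i).
  by rewrite !mxE => ->.
have N0 : mu.-negligible (\bigcup_(k : nat) (if insub k is Some k'
    then hyperplane (a k') (- bary V 0 ord0 k') else set0)).
  apply: negligible_bigcup => k; case: insubP => [k' _ _|_]; last exact: negligible_set0.
  exists (hyperplane (a k') (- bary V 0 ord0 k')); split=> //; last exact: hyperplane_null.
  exact: measurable_hyperplane.
apply: negligibleS N0 => x /= /not_implyP[/(simplexP _ uV) x0 /existsNP[k xk]].
exists (val k) => //; rewrite valK/= /hyperplane/=.
have : bary V x ord0 k = 0.
  by apply/eqP; rewrite eq_le x0 andbT leNgt; apply/negP.
rewrite -[x in bary V x]add0r baryD mxE [X in _ + X]mxE => /eqP.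
rewrite addrC addr_eq0 => /eqP <-; apply: eq_bigr => i _; rewrite [a k _ _]mxE mulrC//.
Qed.

End simplex_geometry.

(** * Diameters and slopes of the barycentric coordinates *)

Section diameters.
Context {R : realType} {n : nat}.
Implicit Types (V : 'M[R]_(n.+1, n)) (x y c w : 'rV[R]_n) (K : set 'rV[R]_n).
Local Notation simplex V := (face V [set: 'I_n.+1]%SET).

Lemma diam_simplex_ub V x y : simplex V x -> simplex V y -> enorm (x - y) <= diam (simplex V).
Proof.
move=> xV yV; apply: ub_le_sup; last by exists x => //; exists y.
exists ((\sum_k enorm (row k V)) + \sum_k enorm (row k V)) => _ [a aV [b bV <-]].
by apply: le_trans (ler_enormD _ _) _; rewrite enormN lerD// simplex_enorm_le.
Qed.

Lemma enorm_eq0 x : enorm x = 0 -> x = 0.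
Proof.
move=> x0; apply/rowP => i; rewrite mxE; apply/eqP; rewrite -normr_le0 -x0.
exact: enorm_coord.
Qed.

Lemma diam_simplex_gt0 V : (0 < n)%N -> nondegenerate V -> 0 < diam (simplex V).
Proof.
move=> n0 uV; pose i := lift ord0 (Ordinal n0).
have Vi := diam_simplex_ub (row_simplex ord0 uV) (row_simplex i uV).
apply: lt_le_trans Vi; rewrite lt_neqAle enorm_ge0 andbT eq_sym; apply/eqP => /enorm_eq0/eqP.
rewrite subr_eq0 => /eqP V0i.
have := bary_row ord0 ord0 uV; rewrite V0i bary_row// eqxx => /eqP.
by rewrite (negbTE (neq_lift _ _)) eq_sym oner_eq0.
Qed.

Lemma diam_eball c (r : R) : 0 < r -> diam (eball c r) <= r *+ 2.
Proof.
move=> r0; apply: ge_sup.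
  by exists (enorm (c - c)); exists c; rewrite /eball/= ?subrr ?enorm0//; exists c;
    rewrite /= ?subrr ?enorm0.
move=> _ [x xc [y yc <-]]; rewrite (_ : x - y = (x - c) + - (y - c)); last first.
  by rewrite opprB addrA subrK.
by apply: le_trans (ler_enormD _ _) _; rewrite enormN mulr2n lerD// ltW.
Qed.

(* The barycentric coordinates take values in [0, 1] on each ball inside the simplex. *)
Lemma bary_grad_inradius V w k : nondegenerate V -> enorm w <= 1 ->
  `|(w *m bary_grad V) ord0 k| * inradius_diam (simplex V) <= 1.
Proof.
move=> uV w1; set d := `|_|; have [->|d0] := eqVneq d 0; first by rewrite mul0r.
have dp : 0 < d by rewrite lt_neqAle eq_sym d0 normr_ge0.
rewrite mulrC -ler_pdivlMr// mul1r.
rewrite /inradius_diam; set S := [set _ | _ in _].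
(* If the simplex contains no ball, [sup] has its default value 0. *)
have [->|/set0P ne] := eqVneq S set0; first by rewrite sup0 invr_ge0 ltW.
apply: ge_sup => // _ [[c r]/= [r0 cV] <-]; apply: le_trans (diam_eball c r0) _.
(* If [2 * r] exceeded [1 / d], some [rho] strictly between [1 / (2 * d)] and [r] would exist, and
   the coordinate would vary by [2 * d * rho > 1] between the points [c - rho *: w] and
   [c + rho *: w] of the simplex. *)
rewrite leNgt; apply/negP => dr; pose e := d^-1 / 2.
have de : d * e = 2^-1 by rewrite /e mulrA mulfV ?mul1r.
have er : e < r by rewrite /e ltr_pdivrMr// mulr_natr.
have e0 : 0 < e by rewrite divr_gt0 ?invr_gt0.
pose rho := (e + r) / 2.
have rhoV (s : R) : `|s| <= 1 -> simplex V (c + (s * rho) *: w).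
  move=> s1; apply: cV; rewrite /eball/= addrAC subrr add0r enormZ.
  apply: (@le_lt_trans _ _ rho); last by rewrite /rho; lra.
  have rho0 : 0 <= rho by rewrite /rho; lra.
  rewrite -[leRHS]mulr1 ler_pM ?enorm_ge0// normrM (ger0_norm rho0).
  by rewrite ler_piMl.
have bd (s : R) : `|s| <= 1 -> 0 <= bary V (c + (s * rho) *: w) ord0 k <= 1.
  by move=> /rhoV sV; rewrite bary_le1// andbT; move: sV => /(simplexP _ uV).
have bE (s : R) : bary V (c + (s * rho) *: w) ord0 k =
    bary V c ord0 k + s * rho * (w *m bary_grad V) ord0 k.
  by rewrite baryD -scalemxAl [LHS]mxE; congr (_ + _); rewrite [LHS]mxE.
have := bd 1; have := bd (-1); rewrite !bE normrN normr1 lexx => /(_ isT) + /(_ isT).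
have : d * rho > 2^-1 by rewrite -de ltr_pM2l// /rho; lra.
rewrite /d; case: (ger0P ((w *m bary_grad V) ord0 k)); set z := (_ *m _) _ _ => ? ? ? ?; nra.
Qed.


End diameters.
(** * Triangulations and the interpolant *)

Lemma within_continuous_bigcup (S Y : topologicalType) (A : set (set S)) (p : S -> Y) :
  finite_set A -> (forall K, A K -> closed K) ->
  (forall K, A K -> {within K, continuous p}) -> {within \bigcup_(K in A) K, continuous p}.
Proof.
move=> /finite_seqP[s ->]; elim: s => [|K s IH] Ac Ap.
  by rewrite set_nil bigcup_set0; move=> x; apply: continuous_subspace0.
have -> : \bigcup_(L in [set` K :: s]) L = K `|` \bigcup_(L in [set` s]) L.
  apply/seteqP; split=> [x [L /=]|x [Kx|[L /= Ls Lx]]].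
  - by rewrite inE => /predU1P[->|Ls] Lx; [left|right; exists L].
  - by exists K => //=; rewrite mem_head.
  - by exists L => //=; rewrite inE Ls orbT.
apply: withinU_continuous.
- by apply: Ac; rewrite /= mem_head.
- apply: closed_bigcup; first exact: finite_seq.
  by move=> L /= Ls; apply: Ac; rewrite /= inE Ls orbT.
- by apply: Ap; rewrite /= mem_head.
- by apply: IH => L /= Ls; [apply: Ac|apply: Ap]; rewrite /= inE Ls orbT.
Qed.

Section triangulations.
Context {R : realType} {n : nat}.
Local Notation mu := (lebesgue_rV R n).
Implicit Types (V : 'M[R]_(n.+1, n)) (x : 'rV[R]_n) (K L : set 'rV[R]_n) (f : 'rV[R]_n -> R).
Local Notation simplex V := (face V [set: 'I_n.+1]%SET).

Lemma face_row V (I : {set 'I_n.+1}) i : i \in I -> face V I (row i V).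
Proof.
move=> iI; exists (delta_mx ord0 i); rewrite -rowE; split => //.
- by move=> j; rewrite mxE ler0n.
- by move=> j jI; rewrite mxE/=; have [ji|//] := eqVneq j i; rewrite ji iI in jI.
- rewrite (bigD1 i)//= mxE !eqxx big1 ?addr0// => j ji.
  by rewrite mxE (negbTE ji).
Qed.

Definition simplex_mx K : 'M[R]_(n.+1, n) := xget 0 [set V | is_simplex_of V K].

Lemma simplex_mxP K : nsimplex K -> K = simplex (simplex_mx K) /\ nondegenerate (simplex_mx K).
Proof.
move=> [exV iK]; have KE : K = simplex (simplex_mx K) by exact: xgetPex exV.
by split=> //; apply: nondegenerateP; rewrite -KE.
Qed.

Lemma interp_vertex K f x : nsimplex K -> is_vertex K x -> interp (simplex_mx K) f x = f x.
Proof.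
move=> nK [W [i [KW ->]]]; have [KE uV] := simplex_mxP nK.
have uW : nondegenerate W by apply: nondegenerateP; rewrite -KW; case: nK.
have [j ->] := simplex_vertices i uV uW (etrans (esym KE) KW).
exact: interp_row.
Qed.

Lemma is_vertex_row K k : nsimplex K -> is_vertex K (row k (simplex_mx K)).
Proof. by move=> /simplex_mxP[KE _]; exists (simplex_mx K), k. Qed.

Variables (Omega : set 'rV[R]_n) (T : set (set 'rV[R]_n)).
Hypothesis n0 : (0 < n)%N.
Hypothesis iO : Omega = interior (closure Omega).
Hypothesis tT : triangulation Omega T.

Let finT : finite_set T. Proof. by case: tT. Qed.
Let nT K : T K -> nsimplex K. Proof. by case: tT => _ + _ _; apply. Qed.

Lemma triangulation_cover x : closure Omega x <-> exists2 K, T K & K x.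
Proof. by case: tT => _ _ <- _. Qed.

(** The vertex is a convex combination of the vertices that span the common face in its description
    from [L]. These lie in [K], where the vertex is extreme, so it is one of them. *)
Lemma common_vertex K L V1 V2 I1 I2 j : T K ->
  is_simplex_of V1 K -> face V1 I1 = K `&` L -> is_simplex_of V2 L -> face V2 I2 = K `&` L ->
  j \in I1 -> is_vertex L (row j V1).
Proof.
move=> TK KV1 F1 LV2 F2 jI; have uV1 : nondegenerate V1.
  by apply: nondegenerateP; rewrite -KV1; case: (nT TK).
have : face V2 I2 (row j V1) by rewrite F2 -F1; exact: face_row.
move=> [w [w0 wI w1 jE]].
have [|l wl <-] := extreme_row uV1 w0 w1 _ jE; last by exists V2, l.
move=> l wl; rewrite -KV1; suff : (K `&` L) (row l V2) by case.
rewrite -F2; apply: face_row; apply: contraT => /wI wl0.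
by rewrite wl0 eqxx in wl.
Qed.

(** On the common face the two affine interpolants are determined by their values at the vertices of
    the face, which are vertices of both simplexes. *)
Lemma interp_agree K L f x : T K -> T L -> K x -> L x ->
  interp (simplex_mx K) f x = interp (simplex_mx L) f x.
Proof.
move=> TK TL Kx Lx; have [->//|/eqP KL] := eqVneq K L.
have [_ _ _ /(_ K L TK TL KL)] := tT => -[KL0|].
  by have : (K `&` L) x by []; rewrite KL0.
move=> [[V1 [I1 [KV1 F1]]] [V2 [I2 [LV2 F2]]]].
have : face V1 I1 x by rewrite -F1.
move=> [w [w0 wI w1 ->]]; rewrite !interp_comb//; apply: eq_bigr => j _.
have [wj|wj] := boolP (j \in I1); last by rewrite wI// !mul0r.
congr (_ * _); rewrite !interp_vertex//; try exact: nT.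
  by apply: (common_vertex TK KV1 (esym F1) LV2 (esym F2)).
by exists V1, j.
Qed.

(** The local interpolants agree on overlaps, so any choice of a simplex containing [x] gives the
    same value; continuity follows by pasting finitely many closed pieces. *)
Lemma interpolant_exists f : exists p, is_interpolant Omega T f p.
Proof.
pose Kof x := xget set0 [set K | T K /\ K x].
pose p x := interp (simplex_mx (Kof x)) f x.
have pE K x : T K -> K x -> p x = interp (simplex_mx K) f x.
  move=> TK Kx; have [TK' Kx'] : [set K | T K /\ K x] (Kof x).
    by apply: (xgetPex set0); exists K.
  exact: interp_agree.
exists p; split.
- have [_ _ <- _] := tT; apply: within_continuous_bigcup => // K TK.
    by have [KE uV] := simplex_mxP (nT TK); rewrite KE; exact: closed_simplex.
  apply: (@subspace_eq_continuous _ _ _ (interp (simplex_mx K) f)).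
    by move=> x /set_mem Kx; exact/esym/pE.
  by apply: continuous_subspaceT; exact: continuous_interp.
- move=> K TK; have [a [b ab]] := interp_affine (simplex_mx K) f K.
  by exists a, b => x Kx; rewrite (pE K)// ab.
- move=> K x TK vx; rewrite (pE K)// ?interp_vertex//; first exact: nT.
  by case: vx => V [i [-> ->]]; apply: face_row; rewrite inE.
Qed.

Lemma Pi_scalarE K f x : T K -> K x ->
  Pi_scalar Omega T f x = interp (simplex_mx K) f x.
Proof.
move=> TK Kx; have [_ aff vert] : is_interpolant Omega T f (Pi_scalar Omega T f).
  exact: (xgetPex (fun=> 0) (interpolant_exists f)).
have [KE uV] := simplex_mxP (nT TK).
rewrite (@affine_interp _ _ (simplex_mx K) (Pi_scalar Omega T f))//; last 2 first.
- by rewrite -KE; exact: aff.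
- by rewrite -KE.
apply: eq_bigr => k _; rewrite (vert K)//; apply: is_vertex_row; exact: nT.
Qed.

(** An open subset of the closure lies in its interior, which is [Omega] for a polyhedral set. *)
Lemma osimplex_sub K : T K -> osimplex (simplex_mx K) `<=` Omega.
Proof.
move=> TK; have [KE uV] := simplex_mxP (nT TK).
rewrite iO -open_subsetE; last exact: open_osimplex.
move=> x /(osimplex_simplex uV); rewrite -KE => Kx.
by apply/triangulation_cover; exists K.
Qed.

(** If two open simplexes meet, the common face contains an open set, whereas on a proper face some
    barycentric coordinate vanishes. So the common face is all of both simplexes. *)
Lemma osimplex_disjoint K L x : T K -> T L ->
  osimplex (simplex_mx K) x -> osimplex (simplex_mx L) x -> K = L.
Proof.
move=> TK TL; have [KE uK] := simplex_mxP (nT TK); have [LE uL] := simplex_mxP (nT TL).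
move=> xK xL; apply: contrapT => KL.
have sub y : osimplex (simplex_mx K) y -> osimplex (simplex_mx L) y -> (K `&` L) y.
  by move=> yK yL; rewrite KE LE; split; exact: osimplex_simplex.
have [_ _ _ /(_ K L TK TL KL)] := tT => -[KL0|[f1 f2]].
  by have := sub x xK xL; rewrite KL0.
have full M : nsimplex M -> is_face M (K `&` L) -> M = K `&` L.
  move=> nM [V [I [MV F]]]; have uV : nondegenerate V.
    by apply: nondegenerateP; rewrite -MV; case: nM.
  suff I1 : I = [set: 'I_n.+1]%SET by rewrite F I1.
  apply/setP => i; rewrite inE; apply: contraT => iI.
  have zero y : (K `&` L) y -> bary V y ord0 i = 0.
    by rewrite F => /(faceP _ _ uV)[_]; apply.
  have : \forall y \near x, (osimplex (simplex_mx K) `&` osimplex (simplex_mx L)) y.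
    by apply: open_nbhs_nbhs; split=> //; apply: openI; exact: open_osimplex.
  move=> /nbhs_ballP[e /= e0 xe].
  (* A small move from [x] towards the vertex [i] stays in both open simplexes and makes the
     vanishing coordinate positive. *)
  pose w := row i V - x; pose s := e / (2 * (`|w| + 1)).
  have w1 : 0 < `|w| + 1 by rewrite ltr_wpDl.
  have s0 : 0 < s by rewrite divr_gt0// mulr_gt0.
  have : (K `&` L) (toward (row i V) s x).
    suff [? ?] : (osimplex (simplex_mx K) `&` osimplex (simplex_mx L)) (toward (row i V) s x).
      exact: sub.
    apply: xe; rewrite -ball_normE/= (_ : x - _ = s *: (- w)); last first.
      by apply/rowP => j; rewrite /w !mxE; ring.
    rewrite normrZ normrN gtr0_norm// /s mulrAC ltr_pdivrMr ?mulr_gt0// ltr_pM2l//.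
    have := normr_ge0 w; lra.
  move=> /zero/eqP; rewrite bary_toward_coord bary_row// eqxx mulr1 (zero x (sub x xK xL)).
  by rewrite mulr0 add0r gt_eqF.
by apply: KL; rewrite (full K (nT TK) f1) {2}(full L (nT TL) f2).
Qed.

Lemma osimplex_cover_ae :
  {ae mu, forall x, Omega x -> exists2 K, T K & osimplex (simplex_mx K) x}.
Proof.
have [s Ts] := (finite_seqP T).1 finT.
have : {ae mu, forall x, forall i : 'I_(size s),
    (nth set0 s i) x -> osimplex (simplex_mx (nth set0 s i)) x}.
  apply: ae_countable => i; have Ti : T (nth set0 s i) by rewrite Ts; exact: mem_nth.
  have [KE uV] := simplex_mxP (nT Ti).
  by have := simplex_osimplex_ae n0 uV; rewrite -KE.
apply: filterS => x H Ox.
have [K TK Kx] := (triangulation_cover x).1 (subset_closure Ox).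
have Ks : K \in s by move: TK; rewrite Ts.
exists K => //; have := H (Ordinal (etrans (index_mem K s) Ks)).
by rewrite /= nth_index//; apply.
Qed.

End triangulations.
(** * Weak gradient of the interpolant *)

Section difference_quotients.
Context {R : realType} {n : nat}.
Local Notation mu := (lebesgue_rV R n).

(** A continuation argument: the supremum of the points up to which the bound holds satisfies it
    too, and if it were less than [b] the local bound would extend it further. *)
Lemma local_lipschitz_segment (g : R -> R) (L a b : R) : 0 <= L -> a <= b ->
  (forall c, a <= c <= b -> exists2 d, 0 < d &
    forall s, a <= s <= b -> `|s - c| < d -> `|g s - g c| <= L * `|s - c|) ->
  `|g b - g a| <= L * (b - a).
Proof.
move=> L0 ab loc.
pose S := [set s | a <= s <= b /\ `|g s - g a| <= L * (s - a)].
have Sa : S a by rewrite /S/= lexx ab !subrr normr0 mulr0.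
have ubS : has_ubound S by exists b => s [/andP[]].
have ac : a <= sup S by exact: ub_le_sup.
have cb : sup S <= b by apply: ge_sup; [exists a|move=> s [/andP[]]].
have [|d d0 locd] := loc (sup S); first by rewrite ac.
have [s [/andP[as_ sb] sL] ds] : exists2 s, S s & sup S - d < s.
  by apply: sup_adherent => //; split => //; exists a.
have sc : s <= sup S by apply: ub_le_sup => //; split=> //; rewrite as_.
have Sc : `|g (sup S) - g a| <= L * (sup S - a).
  have := locd s; rewrite as_ sb distrC ger0_norm ?subr_ge0// => /(_ isT).
  rewrite ltrBlDr -ltrBlDl ds distrC => /(_ isT) H.
  rewrite (_ : g (sup S) - g a = (g (sup S) - g s) + (g s - g a)); last by rewrite addrA subrK.
  by apply: le_trans (ler_normD _ _) _; apply: le_trans (lerD H sL) _; rewrite -mulrDr addrA subrK.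
have [->//|cnb] := eqVneq b (sup S).
have cltb : sup S < b by rewrite lt_neqAle eq_sym cnb.
pose t := Num.min b (sup S + d / 2).
have ct : sup S < t by rewrite lt_min cltb ltrDl divr_gt0.
have tb : t <= b by rewrite ge_min lexx.
have td : t <= sup S + d / 2 by rewrite ge_min lexx orbT.
have St : S t.
  split; first by rewrite tb (le_trans ac) ?(ltW ct).
  have := locd t; rewrite tb (le_trans ac (ltW ct)) => /(_ isT).
  rewrite ger0_norm ?subr_ge0 ?(ltW ct)// => H.
  have {}H := H (_ : t - sup S < d).
  rewrite (_ : g t - g a = (g t - g (sup S)) + (g (sup S) - g a)); last by rewrite addrA subrK.
  apply: le_trans (ler_normD _ _) _; apply: le_trans (lerD (H _) Sc) _; first by lra.
  by rewrite -mulrDr addrA subrK.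
by have := ub_le_sup ubS St; rewrite leNgt ct.
Qed.

(** The condition is open in the pair [(x, s)] and holds for [s = 0]; compactness makes the range of
    [s] uniform. *)
Lemma compact_margin (K O : set 'rV[R]_n) (w : 'rV[R]_n) : compact K -> open O -> K `<=` O ->
  exists2 d, 0 < d & forall x (s : R), K x -> `|s| <= d -> O (x + s *: w).
Proof.
move=> cK oO KO.
have H : \forall s \near (0 : R), K `<=` [set x | O (x + s *: w)].
  have NC := (compact_near_coveringP _).1 cK.
  apply: (NC R (nbhs (0 : R)) (fun (s : R) x => O (x + s *: w)) (nbhs_filter _)).
  move=> x Kx.
  have c : (fun p : 'rV[R]_n * R => p.1 + p.2 *: w) @ (nbhs x, nbhs (0 : R)) --> x + 0 *: w.
    by apply: cvgD; [exact: cvg_fst|apply: cvgZr_tmp; exact: cvg_snd].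
  by apply: c; rewrite scale0r addr0; apply: open_nbhs_nbhs; split=> //; exact: KO.
move: H => /nbhs_ballP[e /= e0 He].
exists (e / 2) => [|x s Kx se]; first by rewrite divr_gt0.
apply: He => //; rewrite -ball_normE/= sub0r normrN; lra.
Qed.

Lemma Rintegral_cvg (f_ : nat -> 'rV[R]_n -> R) (f g : 'rV[R]_n -> R) :
  (forall m, measurable_fun setT (f_ m)) -> measurable_fun setT f ->
  {ae mu, forall x, f_ m x @[m --> \oo] --> f x} ->
  mu.-integrable setT (EFin \o g) -> {ae mu, forall x, forall m, `|f_ m x| <= g x} ->
  \int[mu]_x f_ m x @[m --> \oo] --> \int[mu]_x f x.
Proof.
move=> mf_ mf cf gi fg.
have mf1 m : measurable_fun setT (EFin \o f_ m) by exact/measurable_EFinP.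
have mf2 : measurable_fun setT (EFin \o f) by exact/measurable_EFinP.
have cf1 : {ae mu, forall x, setT x -> (EFin \o f_ m) x @[m --> \oo] --> (EFin \o f) x}.
  by apply: filterS cf => x H _; apply: cvg_EFin H; exact: nearW.
have fg1 : {ae mu, forall x, forall m, setT x -> (`|(EFin \o f_ m) x| <= (EFin \o g) x)%E}.
  by apply: filterS fg => x H m _; rewrite /= lee_fin.
have [fi _] := dominated_convergence measurableT mf1 mf2 cf1 gi fg1.
move=> H; apply: fine_cvg.
by rewrite -/(Rintegral _ _ _) fineK//; exact: (integrable_fin_num measurableT fi).
Qed.

End difference_quotients.
Section weak_derivative_quotients.
Context {R : realType} {n : nat}.
Local Notation mu := (lebesgue_rV R n).
Variables (O : set 'rV[R]_n) (P G : 'rV[R]_n -> R) (i : 'I_n) (L : R).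
Local Notation e := (delta_mx ord0 i : 'rV[R]_n).
Hypothesis oO : open O.
Hypotheses (Pi : mu.-integrable O (EFin \o P)) (Gi : mu.-integrable O (EFin \o G)).
Hypothesis lipP : forall (x : 'rV[R]_n) (t : R), (forall s : R, 0 <= s <= 1 -> O (x + (s * t) *: e)) ->
  `|P (x + t *: e) - P x| <= L * `|t|.
Hypothesis derP : {ae mu, forall x : 'rV[R]_n, O x -> exists2 d : R, 0 < d &
  forall t : R, `|t| < d -> P (x + t *: e) - P x = t * G x}.

Let mO : measurable O. Proof. exact: open_measurable_rV. Qed.

Lemma integrable_loc_integrable (f : 'rV[R]_n -> R) :
  mu.-integrable O (EFin \o f) -> loc_integrable O f.
Proof.
move=> fi; split; first by apply/measurable_EFinP; exact: measurable_int fi.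
move=> K cK KO; apply: integrableS fi => //; exact: compact_measurable_rV.
Qed.

(** The hypotheses fit a piecewise affine [P]: a Lipschitz bound only along segments inside [O], and
    near almost every point exact affinity along the [i]-th direction. The first dominates the
    difference quotients, the second gives their limit. *)
Lemma weak_derivative_quotients : weak_derivative O [:: i] P G.
Proof.
split; [exact: integrable_loc_integrable|exact: integrable_loc_integrable|].
move=> phi [dphi [K [cK KO] phi0]]; rewrite [size _]/= expr1 mulN1r !(Rintegral_patchM O).
have mK : measurable K by exact: compact_measurable_rV.
pose P0 := P \_ O; pose G0 := G \_ O; rewrite -/P0 -/G0.
have P0i : mu.-integrable setT (EFin \o P0) by exact: integrable_patch.
have G0i : mu.-integrable setT (EFin \o G0) by exact: integrable_patch.
have mP0 : measurable_fun setT P0 by apply/measurable_EFinP; exact: measurable_int P0i.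
have mG0 : measurable_fun setT G0 by apply/measurable_EFinP; exact: measurable_int G0i.
have cphi : continuous phi.
  by move=> x; apply: differentiable_continuous; exact: (dphi [::] x).
pose Dphi := partials [:: i] phi.
have cD : continuous Dphi.
  by move=> x; apply: differentiable_continuous; exact: (dphi [:: i] x).
have sphi : compact_supp K phi by exists K => //; split.
have [B B0 phiB] := continuous_supp_bounded cphi sphi.
have [C C0 DC] := continuous_supp_bounded cD (@compact_supp_partials _ _ K phi [:: i] sphi).
(* Steps of length at most [d] keep the segments issued from the support inside [O], where [lipP]
   applies. *)
have [d d0 Kd] := compact_margin e cK oO KO.
pose t (m : nat) : R := d * m.+1%:R^-1.
have t0 m : 0 < t m by rewrite mulr_gt0// invr_gt0.
have td m : t m <= d by rewrite ler_piMr ?(ltW d0)// invf_le1 ?ler1n.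
have tcvg : t m @[m --> \oo] --> 0.
  by rewrite -[X in _ --> X](mulr0 d); apply: cvgMl_tmp; exact: cvg_harmonic.
have mphi : measurable_fun setT phi by exact: continuous_measurableT_rV.
have mD : measurable_fun setT Dphi by exact: continuous_measurableT_rV.
pose psi m (x : 'rV[R]_n) := (t m)^-1 * (phi (x + t m *: e) - phi x).
have mshift (f : 'rV[R]_n -> R) (s : R) : measurable_fun setT f ->
    measurable_fun setT (fun x : 'rV[R]_n => f (x + s *: e)).
  move=> mf; have := measurableT_comp mf (measurable_affine_rV 1 (s *: e)).
  by apply: eq_measurable_fun => x _; rewrite /= /aff scale1r.
have psiC m x : `|psi m x| <= C.
  have line (s : R) : is_derive s 1 (fun s : R => phi (s *: e + x)) (Dphi (s *: e + x)).
    by apply: is_derive_line; exact: (dphi [::]).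
  have [|c _ E] := @MVT_segment _ (fun s : R => phi (s *: e + x))
    (fun s => Dphi (s *: e + x)) 0 (t m) (ltW (t0 m)).
    apply: continuous_subspaceT => s; apply: differentiable_continuous.
    by apply/derivable1_diffP; case: (line s).
  rewrite scale0r add0r subr0 in E.
  by rewrite /psi (addrC x) E mulrCA mulVf ?gt_eqF// mulr1.
have psicvg x : psi m x @[m --> \oo] --> Dphi x.
  have dx : derivable phi x e by apply: diff_derivable; exact: (dphi [::]).
  have tx : t @ \oo --> (0 : R)^'.
    move=> A A0; have HA : \forall m \near \oo, t m != 0 -> A (t m) by exact: tcvg A0.
    by apply: filterS HA => m; apply; rewrite gt_eqF.
  have := @cvg_comp _ _ _ t (fun h : R => h^-1 *: ((phi \o shift x) (h *: e) - phi x))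
    \oo (0^') (nbhs (Dphi x)) tx dx.
  apply: cvg_trans; apply: near_eq_cvg; apply: nearW => m.
  by rewrite /psi /= (addrC x).
have lim1 : \int[mu]_x (P0 x * psi m x) @[m --> \oo] --> \int[mu]_x (P0 x * Dphi x).
  apply: (@Rintegral_cvg _ _ _ _ (fun x => C * `|P0 x|)).
  - move=> m; apply: measurable_funM => //; apply: measurable_funM => //.
    by apply: measurable_funB => //; exact: mshift.
  - exact: measurable_funM.
  - by apply: nearW => x; apply: cvgMl_tmp; exact: psicvg.
  - by apply: integrable_EFinZ; exact: integrable_norm.
  - by apply: nearW => x m; rewrite normrM mulrC ler_wpM2r.
pose Q m (x : 'rV[R]_n) := (t m)^-1 * (P0 (x + (- t m) *: e) - P0 x).
(* Summation by parts moves the difference quotient from [phi] to [P]. *)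
have IQ m : \int[mu]_x (P0 x * psi m x) = \int[mu]_x (Q m x * phi x).
  have phii s : mu.-integrable setT (EFin \o (fun x : 'rV[R]_n => P0 x * phi (x + s *: e))).
    by apply: (integrable_EFinM (C := B)) => //; exact: mshift.
  have E : \int[mu]_x (P0 x * phi (x + t m *: e)) =
      \int[mu]_x (P0 (x + (- t m) *: e) * phi x).
    rewrite (Rintegral_aff ((- t m) *: e) ltr01 (phii (t m))) expr1n mul1r.
    congr Rintegral; apply/funext => x; rewrite /aff scale1r -addrA -scalerDl addNr.
    by rewrite scale0r addr0.
  have i0 := phii 0; have i0E : mu.-integrable setT (EFin \o (fun x => P0 x * phi x)).
    by apply: (integrable_EFinM (C := B)).
  have i1 : mu.-integrable setT (EFin \o (fun x : 'rV[R]_n => P0 (x + (- t m) *: e) * phi x)).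
    apply: (integrable_EFinM (C := B)) => //.
    apply: eq_integrable (integrable_aff ((- t m) *: e) ltr01 P0i) => // x _.
    by rewrite /= /aff scale1r.
  have -> : (fun x : 'rV[R]_n => P0 x * psi m x) = fun x =>
      (t m)^-1 * (P0 x * phi (x + t m *: e) - P0 x * phi x).
    by apply/funext => x; rewrite /psi; ring.
  have -> : (fun x : 'rV[R]_n => Q m x * phi x) = fun x =>
      (t m)^-1 * (P0 (x + (- t m) *: e) * phi x - P0 x * phi x).
    by apply/funext => x; rewrite /Q; ring.
  rewrite !RintegralZl//; [|exact: integrable_EFinB|exact: integrable_EFinB].
  by rewrite !RintegralB// E.
have lim2 : \int[mu]_x (P0 x * psi m x) @[m --> \oo] --> \int[mu]_x (- (G0 x * phi x)).
  under eq_fun do rewrite IQ.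
  apply: (@Rintegral_cvg _ _ _ _ (fun x => L * `|phi x|)).
  - move=> m; apply: measurable_funM => //; apply: measurable_funM => //.
    by apply: measurable_funB => //; exact: mshift.
  - by apply: measurableT_comp => //; exact: measurable_funM.
  - apply: filterS derP => x Hx.
    have [Kx|Kx] := pselect (K x); last first.
      by rewrite phi0// mulr0 oppr0; under eq_fun do rewrite mulr0; exact: cvg_cst.
    (* By [derP] the quotient is equal to its limit from some [m] on. *)
    have [c c0 Hc] := Hx (KO _ Kx); apply: cvg_near_cst.
    have tc : \forall m \near \oo, t m < c by exact: (cvgr_lt _ tcvg).
    apply: filterS tc => m tmc; rewrite /Q /P0 /G0 /patch !ifT ?inE; last 3 first.
    + exact: KO.
    + exact: KO.
    + by apply: Kd => //; rewrite normrN gtr0_norm.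
    by rewrite Hc ?normrN ?gtr0_norm// mulrA mulrN mulVf ?gt_eqF// mulN1r mulNr.
  - apply: integrable_EFinZ; apply: integrable_norm.
    have i1 : mu.-integrable K (EFin \o phi).
      apply: measurable_bounded_integrable => //.
      + by apply: bounded_lebesgue_rV_lty => //; exact: compact_bounded.
      + exact: measurable_funTS.
      + exact: continuous_compact_bounded (continuous_subspaceT cphi) cK.
    have := (integrable_mkcond _ mK).1 i1; apply: eq_integrable => // x _.
    by rewrite /= /patch; case: ifPn => //; rewrite notin_setE => /phi0 ->.
  - apply: nearW => x m; rewrite normrM.
    have [Kx|Kx] := pselect (K x); last by rewrite phi0// normr0 !mulr0.
    rewrite ler_wpM2r// /Q normrM gtr0_norm ?invr_gt0// ler_pdivrMl//.
    have seg (s : R) : 0 <= s <= 1 -> O (x + (s * - t m) *: e).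
      move=> /andP[s0 s1]; apply: Kd => //; rewrite normrM normrN (ger0_norm s0) gtr0_norm//.
      by rewrite (le_trans _ (td m))// ler_piMl// ltW.
    have := lipP seg; rewrite (normrN (t m)) (gtr0_norm (t0 m)) [leRHS]mulrC => H.
    rewrite /P0 /patch !ifT ?inE//; first exact: KO.
    by have := seg 1; rewrite mul1r; apply; rewrite lexx ler01.
have <- := cvg_lim (@Rhausdorff R) lim1; rewrite (cvg_lim (@Rhausdorff R) lim2).
have Gphii : mu.-integrable setT (EFin \o (fun x => G0 x * phi x)).
  exact: (integrable_EFinM (C := B)).
under eq_fun do rewrite -mulN1r; rewrite RintegralZl//; first by rewrite mulN1r.
Qed.

End weak_derivative_quotients.
Definition simplexes {R : realType} {n : nat} (T : set (set 'rV[R]_n)) : seq (set 'rV[R]_n) :=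
  finmap.enum_fset (fset_set T).

Lemma simplexesP {R : realType} {n : nat} (T : set (set 'rV[R]_n)) K : finite_set T ->
  reflect (T K) (K \in simplexes T).
Proof.
move=> fT; rewrite (_ : (K \in simplexes T) = (K \in T)); last exact: in_fset_set.
by apply: (iffP idP) => [/set_mem|/mem_set].
Qed.

Lemma simplexes_uniq {R : realType} {n : nat} (T : set (set 'rV[R]_n)) : uniq (simplexes T).
Proof. exact: finmap.fset_uniq. Qed.

Section interpolant_derivative.
Context {R : realType} {n : nat}.
Local Notation mu := (lebesgue_rV R n).
Variables (Omega : set 'rV[R]_n) (T : set (set 'rV[R]_n)).
Hypothesis n0 : (0 < n)%N.
Hypothesis oO : open Omega.
Hypothesis bO : bounded_set Omega.
Hypothesis tT : triangulation Omega T.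
Implicit Types (f : 'rV[R]_n -> R).

Let finT : finite_set T. Proof. by case: tT. Qed.
Let nT K : T K -> nsimplex K. Proof. by case: tT => _ + _ _; apply. Qed.
Let mO : measurable Omega. Proof. exact: open_measurable_rV. Qed.
Let muO : (mu Omega < +oo)%E. Proof. exact: bounded_lebesgue_rV_lty. Qed.

Let vertex_slope f K (w : 'rV[R]_n) :=
  \sum_k (w *m bary_grad (simplex_mx K)) ord0 k * f (row k (simplex_mx K)).

Let vertex_slopeZ f K (t : R) w : vertex_slope f K (t *: w) = t * vertex_slope f K w.
Proof.
by rewrite mulr_sumr; apply: eq_bigr => k _; rewrite -scalemxAl [X in X * _]mxE mulrA.
Qed.

(** The piecewise gradient, as a finite sum over the disjoint open simplexes, so that measurability
    and boundedness are immediate; its value on the null set left uncovered is irrelevant. *)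
Definition Pi_grad f (i : 'I_n) (x : 'rV[R]_n) : R := \sum_(K <- simplexes T)
  \1_(osimplex (simplex_mx K)) x *
  \sum_k bary_grad (simplex_mx K) i k * f (row k (simplex_mx K)).

Let slope_coord f K i : vertex_slope f K (delta_mx ord0 i) =
  \sum_k bary_grad (simplex_mx K) i k * f (row k (simplex_mx K)).
Proof. by apply: eq_bigr => k _; rewrite -rowE mxE. Qed.

Lemma Pi_gradE f i K x : T K -> osimplex (simplex_mx K) x ->
  Pi_grad f i x = \sum_k bary_grad (simplex_mx K) i k * f (row k (simplex_mx K)).
Proof.
move=> TK Kx; rewrite /Pi_grad (bigD1_seq K) ?simplexes_uniq//=; last exact/simplexesP.
rewrite indicE mem_set// mul1r [X in _ + X]big_seq_cond [X in _ + X]big1 ?addr0//.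
move=> L /andP[/(simplexesP _ finT) TL LK]; rewrite indicE memNset ?mul0r// => Lx.
by move/eqP: LK; apply; exact: (osimplex_disjoint tT TL TK Lx Kx).
Qed.

(** Near a point of the segment only the simplexes containing that point occur, and on each of them
    the interpolant is affine. So the map is locally Lipschitz about every point of the segment,
    with the sum of all slopes as a common constant. *)
Lemma Pi_segment f x w : (forall s : R, 0 <= s <= 1 -> Omega (x + s *: w)) ->
  `|Pi_scalar Omega T f (x + w) - Pi_scalar Omega T f x| <=
  \sum_(K <- simplexes T) `|vertex_slope f K w|.
Proof.
move=> seg; set L := \sum_(K <- _) _.
have L0 : 0 <= L by exact: sumr_ge0.
have KL K : T K -> `|vertex_slope f K w| <= L.
  move=> TK; rewrite /L (bigD1_seq K) ?simplexes_uniq//=; last exact/simplexesP.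
  by rewrite lerDl; exact: sumr_ge0.
have := @local_lipschitz_segment _ (fun s => Pi_scalar Omega T f (x + s *: w)) L 0 1 L0 ler01.
rewrite scale1r scale0r addr0 subr0 mulr1; apply => c c01.
set y := x + c *: w.
(* The union of the simplexes that miss [y] is closed, by finiteness, so it also misses a
   neighbourhood of [y]. *)
pose C := \bigcup_(K in T `&` [set K | ~ K y]) K.
have cC : closed C.
  apply: closed_bigcup; first exact: finite_setIl.
  move=> K [TK _]; have [KE uV] := simplex_mxP (nT TK).
  by rewrite KE; exact: closed_simplex.
have ny : nbhs y (~` C).
  by apply: open_nbhs_nbhs; split; [exact: closed_openC|move=> [K [_ Ky]]].
have cl : (fun s : R => x + s *: w) @ c --> y.
  by apply: cvgD; [exact: cvg_cst|apply: cvgZr_tmp; exact: cvg_id].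
have /nbhs_ballP[d /= d0 dC] := cl _ ny.
exists d => // s s01 sc.
have nCz : ~ C (x + s *: w) by apply: dC; rewrite -ball_normE/= distrC.
have [K TK Kz] := (triangulation_cover tT _).1 (subset_closure (seg s s01)).
have Ky : K y by apply: contrapT => Ky; apply: nCz; exists K.
rewrite !(Pi_scalarE tT f TK)//.
have -> : x + s *: w = y + (s - c) *: w by rewrite /y scalerBl addrA addrAC addrK.
rewrite interpD addrC addKr -/(vertex_slope f K _) vertex_slopeZ normrM mulrC.
by rewrite ler_wpM2r// KL.
Qed.

Lemma integrable_continuous_closure f : {within closure Omega, continuous f} ->
  mu.-integrable Omega (EFin \o f).
Proof.
move=> cf; have ccO : compact (closure Omega).
  have [r _ Or] := bounded_subset_box bO.
  have clO : closed (closure Omega) by exact: closed_closure.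
  exact: (subclosed_compact clO (@compact_closure_box _ _ _ _) (closure_subset Or)).
apply: measurable_bounded_integrable => //.
  apply: (@measurable_funS _ _ _ _ (closure Omega)) => //.
    exact: closed_measurable_rV (@closed_closure _ _).
    exact: subset_closure.
  apply: continuous_measurable_rV => //; exact: closed_measurable_rV (@closed_closure _ _).
have [M [Mr HM]] := continuous_compact_bounded cf ccO.
by exists M; split => // N MN x /subset_closure Ox; exact: HM.
Qed.

Lemma continuous_Pi f : {within closure Omega, continuous Pi_scalar Omega T f}.
Proof.
by have [] : is_interpolant Omega T f (Pi_scalar Omega T f)
  by exact: (xgetPex (fun=> 0) (interpolant_exists tT f)).
Qed.

Lemma integrable_Pi_grad f i : mu.-integrable Omega (EFin \o Pi_grad f i).
Proof.
apply: measurable_bounded_integrable => //.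
  apply: measurable_sum => K; apply: measurable_funM => //.
  apply: measurable_funTS; apply: measurable_indic; apply: open_measurable_rV.
  exact: open_osimplex.
exists (\sum_(K <- simplexes T) `|\sum_k bary_grad (simplex_mx K) i k * f (row k (simplex_mx K))|).
split; first exact: num_real.
move=> M LM x _ /=; apply: le_trans (ltW LM); apply: le_trans (ler_norm_sum _ _ _) _.
apply: ler_sum => K _; rewrite normrM ler_piMl// indicE.
by case: (_ \in _); rewrite ?normr1 ?normr0.
Qed.

Lemma weak_derivative_Pi f i :
  weak_derivative Omega [:: i] (Pi_scalar Omega T f) (Pi_grad f i).
Proof.
apply: (@weak_derivative_quotients _ _ _ _ _ _ (\sum_(K <- simplexes T)
    `|vertex_slope f K (delta_mx ord0 i)|)) => //.
- by apply: integrable_continuous_closure; exact: continuous_Pi.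
- exact: integrable_Pi_grad.
- move=> x t seg; apply: le_trans (Pi_segment _ _) _.
    by move=> s s01; rewrite scalerA; exact: seg.
  rewrite mulr_suml; apply: ler_sum => K _.
  by rewrite vertex_slopeZ normrM mulrC.
apply: filterS (osimplex_cover_ae n0 tT) => x Hx /Hx[K TK Kx].
have [KE uV] := simplex_mxP (nT TK).
have cl : (fun s : R => x + s *: (delta_mx ord0 i : 'rV[R]_n)) @ (0 : R) -->
    x + (0 : R) *: (delta_mx ord0 i : 'rV[R]_n).
  by apply: cvgD; [exact: cvg_cst|apply: cvgZr_tmp; exact: cvg_id].
have nx : nbhs (x + (0 : R) *: (delta_mx ord0 i : 'rV[R]_n)) (osimplex (simplex_mx K)).
  by rewrite scale0r addr0; apply: open_nbhs_nbhs; split=> //; exact: open_osimplex.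
have /nbhs_ballP[d /= d0 dK] := cl _ nx.
exists d => // t td; have Kt : osimplex (simplex_mx K) (x + t *: delta_mx ord0 i).
  by apply: dK; rewrite -ball_normE/= sub0r normrN.
have sub y : osimplex (simplex_mx K) y -> K y.
  by move=> /(osimplex_simplex uV); rewrite -KE.
rewrite !(Pi_scalarE tT f TK); [|exact: sub|exact: sub].
rewrite interpD addrC addKr -/(vertex_slope f K _) vertex_slopeZ slope_coord.
by rewrite (Pi_gradE f i TK Kx).
Qed.

End interpolant_derivative.

(** * Differences and uniqueness of weak derivatives *)

Section weak_derivative_theory.
Context {R : realType} {n : nat}.
Local Notation mu := (lebesgue_rV R n).
Variable O : set 'rV[R]_n.
Hypothesis oO : open O.
Implicit Types (f g : 'rV[R]_n -> R) (ds : seq 'I_n).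

Let mO : measurable O. Proof. exact: open_measurable_rV. Qed.

Lemma loc_integrableB f g : loc_integrable O f -> loc_integrable O g ->
  loc_integrable O (fun x => f x - g x).
Proof.
move=> [mf fi] [mg gi]; split; first exact: measurable_funB.
move=> K cK KO; have mK := compact_measurable_rV cK.
exact: (integrableB mK (fi K cK KO) (gi K cK KO)).
Qed.

Lemma test_function_partials ds phi : test_function O phi ->
  continuous (partials ds phi) /\ compact_supp O (partials ds phi).
Proof.
move=> [dphi [K KO phi0]]; split.
  by move=> x; apply: differentiable_continuous; exact: dphi.
by apply: compact_supp_partials; exists K.
Qed.

Lemma Rintegral_testB f g psi : loc_integrable O f -> loc_integrable O g ->
  continuous psi -> compact_supp O psi ->
  \int[mu]_(x in O) ((f x - g x) * psi x) =
  \int[mu]_(x in O) (f x * psi x) - \int[mu]_(x in O) (g x * psi x).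
Proof.
move=> [mf fi] [mg gi] cpsi spsi; rewrite -RintegralB//; last 2 first.
- exact: integrable_compact_supp.
- exact: integrable_compact_supp.
by congr Rintegral; apply/funext => x; rewrite mulrBl.
Qed.

Lemma weak_derivativeB ds f1 f2 g1 g2 : weak_derivative O ds f1 g1 ->
  weak_derivative O ds f2 g2 ->
  weak_derivative O ds (fun x => f1 x - f2 x) (fun x => g1 x - g2 x).
Proof.
move=> [f1i g1i H1] [f2i g2i H2]; split; [exact: loc_integrableB|exact: loc_integrableB|].
move=> phi tphi; have [c0 s0] := test_function_partials [::] tphi.
have [cd sd] := test_function_partials ds tphi.
by rewrite !Rintegral_testB// H1// H2// mulrBr.
Qed.

(** The difference of two weak derivatives is orthogonal to all test functions. Uniqueness is what
    relates the derivative chosen by [weakD] to the explicit ones. *)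
Lemma weak_derivative_unique ds f g1 g2 : weak_derivative O ds f g1 ->
  weak_derivative O ds f g2 -> {ae mu, forall x, O x -> g1 x = g2 x}.
Proof.
move=> [_ g1i H1] [_ g2i H2]; have [mg gi] := loc_integrableB g1i g2i.
have := fundamental_lemma oO mg gi _; move=> H.
have {}H : {ae mu, forall x, O x -> g1 x - g2 x = 0}.
  apply: H => phi sphi cphi; have tphi := smooth_test_function sphi cphi.
  have [c0 s0] := test_function_partials [::] tphi.
  rewrite Rintegral_testB//; apply/eqP; rewrite subr_eq0; apply/eqP.
  apply: (mulfI (_ : (-1) ^+ size ds != 0 :> R)); first by rewrite signr_eq0.
  by rewrite -H1// -H2.
by apply: filterS H => x Hx /Hx/eqP; rewrite subr_eq0 => /eqP.
Qed.

Lemma weakDP ds f : (exists g, weak_derivative O ds f g) ->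
  weak_derivative O ds f (weakD O ds f).
Proof. by move=> H; exact: (xgetPex (fun=> 0) H). Qed.

Lemma weakD_ae ds f g : weak_derivative O ds f g ->
  {ae mu, forall x, O x -> weakD O ds f x = g x}.
Proof.
by move=> fg; apply: weak_derivative_unique (fg); apply: weakDP; exists g.
Qed.

Lemma ae_eq_integrable_EFin f g : measurable_fun O f ->
  {ae mu, forall x, O x -> f x = g x} -> mu.-integrable O (EFin \o g) ->
  mu.-integrable O (EFin \o f).
Proof.
move=> mf fg /integrableP[mg gi]; apply/integrableP; split; first exact/measurable_EFinP.
rewrite (@ae_eq_integral _ _ _ mu _ (fun x => `|(EFin \o g) x|)%E)//.
- by apply: measurableT_comp => //; exact/measurable_EFinP.
- exact: measurableT_comp.
- by apply: filterS fg => x H Ox /=; rewrite H.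
Qed.

End weak_derivative_theory.

Section barycentric_identities.
Context {R : realType} {n : nat}.
Implicit Types (V : 'M[R]_(n.+1, n)) (x w : 'rV[R]_n).

Lemma bary_grad_mul V : nondegenerate V -> bary_grad V *m V = 1%:M.
Proof.
move=> uV; apply/row_matrixP => i; rewrite row_mul row1.
have := bary_mul (0 + delta_mx ord0 i) uV; rewrite baryD mulmxDl bary_mul// !add0r.
by rewrite rowE.
Qed.

Lemma bary_grad_sum V i : nondegenerate V -> \sum_k bary_grad V i k = 0.
Proof.
move=> uV; have := bary_sum (0 + delta_mx ord0 i) uV; rewrite baryD.
rewrite (eq_bigr (fun k => bary V 0 ord0 k + bary_grad V i k)); last first.
  by move=> k _; rewrite [LHS]mxE -rowE; congr (_ + _); rewrite mxE.
by rewrite big_split/= bary_sum// => /eqP; rewrite -[X in _ == X]addr0 (inj_eq (addrI 1)) => /eqP.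
Qed.

Variable V : 'M[R]_(n.+1, n).
Hypothesis uV : nondegenerate V.
Variables (f : 'rV[R]_n -> R) (c : 'I_n -> R).

(* The first-order Taylor remainder at the vertex [row k V], for the slope [c] at [x]. *)
Definition vertex_remainder x k : R :=
  f (row k V) - f x + \sum_i c i * (x ord0 i - row k V ord0 i).

(** Because the barycentric coordinates sum to 1 and reproduce [x], the slope terms cancel for any
    choice of [c]. *)
Lemma interp_remainder x :
  interp V f x - f x = \sum_k bary V x ord0 k * vertex_remainder x k.
Proof.
rewrite /vertex_remainder.
under eq_bigr do rewrite mulrDr mulrBr.
rewrite big_split/= sumrB -/(interp V f x) -mulr_suml bary_sum// mul1r.
rewrite [X in _ = _ + X](_ : _ = 0) ?addr0//.
transitivity (\sum_i c i * (x ord0 i - (bary V x *m V) ord0 i)).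
  under eq_bigr do rewrite mulr_sumr.
  rewrite exchange_big/=; apply: eq_bigr => i _; rewrite [(_ *m _) _ _]mxE.
  rewrite -[X in X - _]mul1r -(bary_sum x uV) mulr_suml -sumrB mulr_sumr.
  by apply: eq_bigr => k _; rewrite [V k i in RHS](_ : _ = row k V ord0 i) ?mxE//; ring.
by rewrite bary_mul//; apply: big1 => i _; rewrite subrr mulr0.
Qed.

(** The gradients of the barycentric coordinates sum to 0, which removes [f x], and satisfy
    [bary_grad V *m V = 1%:M], which extracts the slope [c]. *)
Lemma slope_remainder x w :
  \sum_i (\sum_k bary_grad V i k * f (row k V) - c i) * w ord0 i =
  \sum_k (w *m bary_grad V) ord0 k * vertex_remainder x k.
Proof.
have wB k : (w *m bary_grad V) ord0 k = \sum_i w ord0 i * bary_grad V i k by rewrite mxE.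
transitivity (\sum_i w ord0 i * \sum_k bary_grad V i k * vertex_remainder x k); last first.
  under eq_bigr do rewrite mulr_sumr.
  rewrite exchange_big/=; apply: eq_bigr => k _; rewrite wB mulr_suml.
  by apply: eq_bigr => i _; rewrite mulrA.
apply: eq_bigr => i _; rewrite mulrC; congr (_ * _).
rewrite /vertex_remainder; under [in RHS]eq_bigr do rewrite mulrDr mulrBr.
rewrite big_split/= sumrB -[X in _ = _ - X + _]mulr_suml bary_grad_sum// mul0r subr0.
congr (_ + _); under eq_bigr do rewrite mulr_sumr.
rewrite exchange_big/=.
transitivity (\sum_j c j * (0 - (bary_grad V *m V) i j)).
  rewrite bary_grad_mul// (bigD1 i)//= mxE eqxx sub0r mulrN1 big1 ?addr0// => j ji.
  by rewrite mxE eq_sym (negbTE ji) subr0 mulr0.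
apply: eq_bigr => j _; rewrite [(_ *m _) _ _]mxE.
have {1}-> : (0 : R) = \sum_k bary_grad V i k * x ord0 j.
  by rewrite -mulr_suml bary_grad_sum// mul0r.
rewrite -sumrB mulr_sumr.
by apply: eq_bigr => k _; rewrite [row _ _ _ _]mxE; ring.
Qed.

End barycentric_identities.
(** * Error estimates *)

(* [f] need not be measurable, which spares the measurability of operator norms. *)
Lemma le_integral_ae d (X : measurableType d) (R : realType) (mu : {measure set X -> \bar R})
    (f g : X -> \bar R) : (forall x, (0 <= f x)%E) -> (forall x, (0 <= g x)%E) ->
  measurable_fun setT g -> {ae mu, forall x, (f x <= g x)%E} ->
  (\int[mu]_x f x <= \int[mu]_x g x)%E.
Proof.
move=> f0 g0 mg [N [mN N0 Nfg]].
(* Made infinite on the exceptional null set, the majorant is still measurable, has the same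
   integral and bounds [f] at every point. *)
pose g' x := (g x + ((fun=> +oo%E) \_ N) x)%E.
have mg' : measurable_fun setT g'.
  apply: emeasurable_funD => //; apply/(measurable_restrictT _ _).1 => //.
have fg' x : (f x <= g' x)%E.
  rewrite /g' /patch; case: ifPn => [_|/negP xN].
    by rewrite addey ?leey// gt_eqF// (lt_le_trans _ (g0 x)).
  by rewrite adde0; apply: contrapT => fgx; apply: xN; apply/mem_set/Nfg.
have g'0 x : (0 <= g' x)%E by exact: le_trans (f0 x) (fg' x).
have -> : (\int[mu]_x g x = \int[mu]_x g' x)%E.
  apply: ae_eq_integral => //; exists N; split => // x /= nH.
  apply: contrapT => xN; apply: nH => _; rewrite /g' /patch memNset// adde0//.
rewrite !ge0_integralTE//; apply: le_ereal_sup => _ [h /= hf <-].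
by exists h => //= x; exact: le_trans (hf x) (fg' x).
Qed.

Section broken_Lq_estimate.
Context {R : realType} {n : nat}.
Local Notation mu := (lebesgue_rV R n).
Variables (Omega : set 'rV[R]_n) (T : set (set 'rV[R]_n)) (q : R).
Hypothesis oO : open Omega.
Hypothesis iO : Omega = interior (closure Omega).
Hypothesis tT : triangulation Omega T.
Hypotheses (q1 : 1 < q) (nq : n%:R / 2 < q).
Variable h : 'rV[R]_n -> R.
Hypotheses (mh : measurable_fun Omega h) (h0 : forall x, 0 <= h x).

Let finT : finite_set T. Proof. by case: tT. Qed.
Let mO : measurable Omega. Proof. exact: open_measurable_rV. Qed.
Let q0 : 0 < q. Proof. exact: lt_trans q1. Qed.
Let qn0 : q != 0. Proof. by rewrite gt_eqF. Qed.

Let U (K : set 'rV[R]_n) := osimplex (simplex_mx K).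

Definition vertex_average (K : set 'rV[R]_n) k :=
  segment_average (row k (simplex_mx K)) (h \_ (osimplex (simplex_mx K))).

Lemma measurable_patch_simplex K : T K -> measurable_fun setT (h \_ (osimplex (simplex_mx K))).
Proof.
move=> TK; apply/(measurable_restrictT _ _).1; first exact: open_measurable_rV (@open_osimplex _ _ _).
by apply: (measurable_funS mO (osimplex_sub iO tT TK)).
Qed.

Lemma patch_ge0 (A : set 'rV[R]_n) x : 0 <= (h \_ A) x.
Proof. by rewrite /patch; case: ifP. Qed.

Let c0 : R := n.+1%:R ^+ 2 * (2 - n%:R / q)^-1.

(** Of the factor [n.+1 ^+ 2] in [c0], one [n.+1] bounds a sum over the vertices by the largest
    term, and the other bounds the [q]-th power of that term by the sum over all vertices after
    integration. The open simplexes being disjoint, their contributions add up to at most the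
    integral over [Omega]. *)
Lemma normL_le_averages (F : 'rV[R]_n -> R) (c : R) : 0 <= c -> (forall x, 0 <= F x) ->
  {ae mu, forall x, Omega x -> exists2 K, T K &
    ((F x)%:E <= c%:E * \sum_k vertex_average K k x)%E} ->
  (normL Omega q%:E F <= (c * c0)%:E * normL Omega q%:E h)%E.
Proof.
move=> c_ge0 F0 FK.
have kp0 : 0 <= (2 - n%:R / q)^-1.
  by rewrite invr_ge0 subr_ge0 ltW// ltr_pdivrMr// mulrC -ltr_pdivrMr.
have c00 : 0 <= c0 by rewrite mulr_ge0// exprn_ge0.
set kp := (2 - n%:R / q)^-1 in kp0 *.
have FP0 x : 0 <= (F \_ Omega) x by rewrite /patch; case: ifP.
have av0 K k x : (0 <= vertex_average K k x)%E.
  by apply: segment_average_ge0 => y; exact: patch_ge0.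
have mav K k : T K -> measurable_fun setT (vertex_average K k).
  move=> TK; apply: measurable_segment_average => [|y]; last exact: patch_ge0.
  exact: measurable_patch_simplex.
pose b := (c * n.+1%:R) `^ q.
have b0 : 0 <= b by exact: powR_ge0.
(* Measurability is known only for simplexes of [T]; the value 0 elsewhere makes it hold for all
   sets [K], as summation lemmas require. *)
pose w K k : 'rV[R]_n -> \bar R :=
  if K \in T then (fun x => b%:E * (vertex_average K k x `^ q))%E else cst 0%E.
have w0 K k x : (0 <= w K k x)%E.
  by rewrite /w; case: ifP => // _; rewrite mule_ge0 ?lee_fin ?poweR_ge0.
have mw K k : measurable_fun setT (w K k).
  rewrite /w; case: ifPn => [/set_mem TK|_]; last exact: measurable_cst.
  by apply: measurable_funeM; apply: (measurableT_comp (measurable_poweR q)); exact: mav.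
pose W x := (\sum_(K <- simplexes T) \sum_k w K k x)%E.
have mW : measurable_fun setT W.
  by apply: emeasurable_sum => K; apply: emeasurable_sum => k.
have W0 x : (0 <= W x)%E by apply: sume_ge0 => K _; apply: sume_ge0.
have mulSnE (y : \bar R) : ((n.+1%:R)%:E * y = \sum_(i < n.+1) y)%E.
  rewrite -[X in X%:R](card_ord n.+1) -sumr_const -sumEFin ge0_sume_distrl => [|i _].
    by apply: eq_bigr => i _; rewrite mul1e.
  by rewrite lee_fin.
have step1 : (\int[mu]_x (`|(EFin \o (F \_ Omega)) x| `^ q) <= \int[mu]_x W x)%E.
  apply: le_integral_ae => //; first by move=> x; exact: poweR_ge0.
  apply: filterS FK => x Hx; rewrite /= ger0_norm//.
  have [Ox|Ox] := pselect (Omega x); last by rewrite /patch memNset// powR0.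
  have [K TK FKx] := Hx Ox; rewrite /patch mem_set//.
  have [k _ kmax] := @arg_maxP _ _ _ (@ord0 n) xpredT (fun k => vertex_average K k x) isT.
  apply: (@le_trans _ _ (w K k x)).
    rewrite /w mem_set// -poweR_EFin /b -poweR_EFin -poweRM//; last by rewrite lee_fin mulr_ge0.
    rewrite gt0_ler_poweR ?(ltW q0)// ?in_itv/= ?leey ?andbT ?lee_fin//.
      by rewrite mule_ge0// lee_fin mulr_ge0.
    apply: le_trans FKx _; rewrite EFinM -muleA lee_wpmul2l ?lee_fin//.
    by rewrite mulSnE; apply: lee_sum => l _; exact: kmax.
  apply: (@le_trans _ _ (\sum_k w K k x)%E).
    by rewrite (bigD1 k)//= leeDl// sume_ge0.
  rewrite /W (bigD1_seq K) ?simplexes_uniq//=; last exact/simplexesP.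
  by rewrite leeDl// sume_ge0// => L _; exact: sume_ge0.
have step2 : (\int[mu]_x W x <=
    ((c * c0) `^ q)%:E * \int[mu]_x (`|(EFin \o (h \_ Omega)) x| `^ q))%E.
  rewrite ge0_integral_sum//; last 2 first.
  - by move=> K; apply: emeasurable_sum => k.
  - by move=> K x _; exact: sume_ge0.
  pose I K := (\int[mu]_x (((h \_ (U K)) x) `^ q)%:E)%E.
  have I0 K : (0 <= I K)%E by apply: integral_ge0 => x _; rewrite lee_fin powR_ge0.
  apply: (@le_trans _ _ (\sum_(K <- simplexes T) (n.+1%:R * (b * kp `^ q))%:E * I K)%E).
    rewrite big_seq [leRHS]big_seq; apply: lee_sum => K /(simplexesP _ finT) TK.
    rewrite ge0_integral_sum//.
    apply: (@le_trans _ _ (\sum_(k < n.+1) ((b * kp `^ q)%:E * I K))%E).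
      apply: lee_sum => k _; rewrite /w mem_set// ge0_integralZl//; last 2 first.
      - by apply: (measurableT_comp (measurable_poweR q)); exact: mav.
      - by move=> x _; exact: poweR_ge0.
      rewrite EFinM -muleA lee_wpmul2l ?lee_fin//.
      apply: integral_segment_average_powR => //; first exact: measurable_patch_simplex.
      exact: patch_ge0.
    by rewrite (EFinM n.+1%:R) -[X in (_ <= X)%E]muleA mulSnE.
  rewrite -ge0_sume_distrr//.
  (* The number of vertices is absorbed by [n.+1 <= n.+1 ^ q], valid since [q >= 1]. *)
  have bc : n.+1%:R * (b * kp `^ q) <= (c * c0) `^ q.
    have -> : c * c0 = n.+1%:R * (c * n.+1%:R * kp) by rewrite /c0 -/kp; ring.
    rewrite powRM ?mulr_ge0//.
    rewrite [X in _ <= _ * X]powRM ?mulr_ge0// ler_wpM2r ?mulr_ge0 ?powR_ge0//.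
    by rewrite -[leLHS]powRr1// ler_powR ?ler1n// ltW.
  apply: (@le_trans _ _ (((c * c0) `^ q)%:E * \sum_(K <- simplexes T) I K)%E).
    by rewrite lee_wpmul2r ?lee_fin// sume_ge0.
  rewrite lee_wpmul2l ?lee_fin ?powR_ge0//.
  have mI K : T K -> measurable_fun setT (fun x => ((h \_ (U K)) x `^ q)%:E).
    move=> TK; apply/measurable_EFinP; apply: (measurableT_comp (measurable_powR q)).
    exact: measurable_patch_simplex.
  pose J K : 'rV[R]_n -> \bar R :=
    if K \in T then (fun x => ((h \_ (U K)) x `^ q)%:E) else cst 0%E.
  have J0 K x : (0 <= J K x)%E by rewrite /J; case: ifP => // _; rewrite lee_fin powR_ge0.
  have mJ K : measurable_fun setT (J K).
    by rewrite /J; case: ifPn => [/set_mem/mI//|_]; exact: measurable_cst.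
  rewrite big_seq (eq_bigr (fun K => \int[mu]_x J K x)%E); last first.
    by move=> K /(simplexesP _ finT) TK; apply: eq_integral => x _; rewrite /J mem_set.
  rewrite -big_seq -ge0_integral_sum//.
  apply: ge0_le_integral => //.
  - by move=> x _; exact: sume_ge0.
  - exact: emeasurable_sum.
  - apply: (measurableT_comp (measurable_poweR q)); apply: measurableT_comp => //.
    apply/measurable_EFinP; apply/(measurable_restrictT _ _).1; [exact: mO|exact: mh].
  - move=> x _; rewrite /= ger0_norm ?patch_ge0//.
    have [[K TK Kx]|H] := pselect (exists2 K, T K & U K x).
      rewrite (bigD1_seq K) ?simplexes_uniq//=; last exact/simplexesP.
      rewrite big_seq_cond big1 ?adde0; last first.
        move=> L /andP[/(simplexesP _ finT) TL LK]; rewrite /J mem_set// /patch memNset ?powR0//.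
        by move=> Lx; move/eqP: LK; apply; exact: (osimplex_disjoint tT TL TK Lx Kx).
      by rewrite /J mem_set// /patch mem_set// mem_set//; exact: (osimplex_sub iO tT TK).
    rewrite big_seq big1 ?lee_fin ?powR_ge0// => K /(simplexesP _ finT) TK.
    by rewrite /J mem_set// /patch memNset ?powR0// => Kx; apply: H; exists K.
rewrite /normL unlock.
have -> : (c * c0)%:E = (((c * c0) `^ q)%:E `^ q^-1)%E.
  by rewrite poweR_EFin -powRrM mulfV// powRr1// mulr_ge0.
rewrite -poweRM ?lee_fin ?powR_ge0//; last by apply: integral_ge0 => x _; exact: poweR_ge0.
rewrite gt0_ler_poweR ?invr_ge0 ?(ltW q0)// ?in_itv/= ?leey ?andbT.
- by apply: integral_ge0 => x _; rewrite lee_fin powR_ge0.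
- rewrite mule_ge0 ?lee_fin ?powR_ge0//.
  by apply: integral_ge0 => x _; rewrite lee_fin powR_ge0.
- exact: le_trans step1 step2.
Qed.

End broken_Lq_estimate.
Section simplex_error.
Context {R : realType} {n M : nat}.
Variables (V : 'M[R]_(n.+1, n)) (f : 'I_M -> 'rV[R]_n -> R) (c : 'I_M -> 'I_n -> R).
Hypothesis uV : nondegenerate V.

Definition remainder_row x k : 'rV[R]_M := \row_j vertex_remainder V (f j) (c j) x k.

Lemma interp_error_bound x : face V [set: 'I_n.+1]%SET x ->
  enorm (\row_j (interp V (f j) x - f j x)) <= \sum_k enorm (remainder_row x k).
Proof.
move=> xV; have -> : \row_j (interp V (f j) x - f j x) =
    \sum_k bary V x ord0 k *: remainder_row x k.
  apply/rowP => j; rewrite mxE (interp_remainder uV (f j) (c j)) summxE; apply: eq_bigr => k _.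
  by rewrite [RHS]mxE; congr (_ * _); rewrite mxE.
apply: le_trans (ler_enorm_sum _ _ _) _; apply: ler_sum => k _.
have b0 : 0 <= bary V x ord0 k by apply/(simplexP x uV).1.
by rewrite enormZ ger0_norm// ler_piMl ?enorm_ge0// bary_le1.
Qed.

Lemma slope_error_bound x (d : R) :
  (forall (w : 'rV[R]_n) k, enorm w <= 1 -> `|(w *m bary_grad V) ord0 k| <= d) ->
  opnorm (\matrix_(j, i) (\sum_k bary_grad V i k * f j (row k V) - c j i)) <=
  d * \sum_k enorm (remainder_row x k).
Proof.
move=> Bd; apply: opnorm_le => w w1.
set J := \matrix_(_, _) _.
have -> : J *m w = \sum_k (w^T *m bary_grad V) ord0 k *: (remainder_row x k)^T.
  apply/matrixP => j z; rewrite ord1 summxE mxE.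
  transitivity (\sum_i (\sum_k bary_grad V i k * f j (row k V) - c j i) * w^T ord0 i).
    by apply: eq_bigr => i _; rewrite mxE [in RHS]mxE.
  rewrite (slope_remainder uV (f j) (c j) x); apply: eq_bigr => k _.
  by rewrite [RHS]mxE; congr (_ * _); rewrite !mxE.
apply: le_trans (ler_enorm_sum _ _ _) _; rewrite mulr_sumr; apply: ler_sum => k _.
by rewrite enormZ enorm_tr ler_wpM2r ?enorm_ge0// Bd// enorm_tr.
Qed.

End simplex_error.

Section pointwise_estimates.
Context {R : realType} {n M : nat}.
Local Notation mu := (lebesgue_rV R n).
Variables (Omega : set 'rV[R]_n) (T : set (set 'rV[R]_n)) (s h : R).
Variables (u v : 'rV[R]_n -> 'rV[R]_M).
Hypotheses (n0 : (0 < n)%N) (oO : open Omega) (bO : bounded_set Omega).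
Hypothesis iO : Omega = interior (closure Omega).
Hypotheses (s0 : 0 < s) (h0 : 0 < h) (rT : regular_triangulation Omega T s h).
Hypothesis cv : forall j, {within closure Omega, continuous (component v j)}.
Hypothesis uvE : {ae mu, forall x, Omega x -> u x = v x}.
Hypothesis wd1 : has_weakD Omega 1 u.
Hypothesis wd2 : has_weakD Omega 2 u.
Hypothesis Hi : forall j i k,
  mu.-integrable Omega (EFin \o weakD Omega [:: i; k] (component u j)).

Let tT : triangulation Omega T. Proof. by case: rT. Qed.
Let nT K : T K -> nsimplex K. Proof. by case: tT => _ + _ _; apply. Qed.
Let mO : measurable Omega. Proof. exact: open_measurable_rV. Qed.

Definition PiV x : 'rV[R]_M := \row_j Pi_scalar Omega T (component v j) x.

Lemma ae_component j : {ae mu, forall x, Omega x -> component u j x = component v j x}.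
Proof. by apply: filterS uvE => x Hx /Hx xE; rewrite /component xE. Qed.

Lemma weakD1P j i : weak_derivative Omega [:: i] (component u j)
  (weakD Omega [:: i] (component u j)).
Proof. by apply: weakDP; exact: wd1. Qed.

Lemma weakD2P j i k : weak_derivative Omega [:: i; k] (component u j)
  (weakD Omega [:: i; k] (component u j)).
Proof. by apply: weakDP; exact: wd2. Qed.

Lemma integrable_component j : mu.-integrable Omega (EFin \o component u j).
Proof.
have cvi := integrable_continuous_closure oO bO (@cv j).
apply: (ae_eq_integrable_EFin oO _ (ae_component j) cvi).
by have [[]] := weakD1P j (Ordinal n0).
Qed.

Lemma weak_D2_norm_ge0 x : 0 <= weak_D2_norm Omega u x.
Proof. exact: sqrtr_ge0. Qed.

Lemma measurable_weak_D2_norm : measurable_fun Omega (weak_D2_norm Omega u).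
Proof.
have ms : measurable_fun setT (@Num.sqrt R).
  by apply: continuous_measurable_fun; exact: sqrt_continuous.
apply: (measurableT_comp ms); apply: measurable_sum => j; apply: measurable_sum => i.
apply: measurable_sum => k; apply: measurable_funX.
by have [_ []] := weakD2P j i k.
Qed.

Let average := vertex_average (weak_D2_norm Omega u).
Let slope x j i := weakD Omega [:: i] (component u j) x.

(** There are finitely many simplexes and vertices, so a single null set serves them all. *)
Lemma remainder_ae : {ae mu, forall x, forall K, T K -> osimplex (simplex_mx K) x -> forall k,
  ((enorm (remainder_row (simplex_mx K) (component v) (slope x) x k))%:E <=
   (diam K ^+ 2)%:E * average K k x)%E}.
Proof.
have finT : finite_set T by case: tT.
have : {ae mu, forall x, forall p : 'I_(size (simplexes T)) * 'I_n.+1,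
  let K := nth set0 (simplexes T) p.1 in osimplex (simplex_mx K) x ->
  ((enorm (remainder_row (simplex_mx K) (component v) (slope x) x p.2))%:E <=
   (diam K ^+ 2)%:E * average K p.2 x)%E}.
  apply: ae_countable => -[l k]; rewrite [(l, k).1]/= [(l, k).2]/=.
  set K := nth set0 (simplexes T) l.
  have TK : T K by apply/(simplexesP _ finT); exact: mem_nth.
  have [KE uV] := simplex_mxP (nT TK).
  have UO := osimplex_sub iO tT TK.
  have sub y : osimplex (simplex_mx K) y -> K y.
    by move=> /(osimplex_simplex uV); rewrite -KE.
  have aK : K (row k (simplex_mx K)) by rewrite {1}KE; exact: row_simplex.
  apply: (vertex_taylor (Omega := Omega) (u := component u)
    (H := fun j i k => weakD Omega [:: i; k] (component u j))) => //.
  - exact: open_osimplex.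
  - by have [B [Br HB]] := bO; exists B; split => // B' BB' x /UO Ox; exact: HB.
  - by apply/(triangulation_cover tT); exists K.
  - by move=> x r; exact: osimplex_toward.
  - by move=> x /sub Kx; rewrite KE; apply: diam_simplex_ub; rewrite -KE.
  - by rewrite KE; exact: diam_simplex_gt0.
  - exact: integrable_component.
  - exact: weakD1P.
  - exact: weakD2P.
  - exact: ae_component.
  - by apply: (measurable_patch_simplex oO iO tT measurable_weak_D2_norm).
apply: filterS => x Hx K TK Kx k.
have Ks : K \in simplexes T by apply/simplexesP.
have := Hx (Ordinal (etrans (index_mem K (simplexes T)) Ks), k).
by rewrite /= nth_index//; apply.
Qed.

(** Both parts of the theorem reduce to this estimate. Regularity enters through [diam K <= h] and
    through the slope bound [s / diam K] of the barycentric coordinates. *)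
Lemma pointwise_error : {ae mu, forall x, Omega x -> exists2 K, T K &
  [/\ osimplex (simplex_mx K) x, u x = v x,
   ((enorm (u x - PiV x))%:E <= (h ^+ 2)%:E * \sum_k average K k x)%E &
   ((opnorm (\matrix_(j, i) (Pi_grad T (component v j) i x - slope x j i)))%:E <=
    (s * h)%:E * \sum_k average K k x)%E]}.
Proof.
apply: filterS (filterI remainder_ae (filterI uvE (osimplex_cover_ae n0 tT))) => x [Rx [uvx Ux]] Ox.
have [K TK Kx] := Ux Ox; exists K => //.
have [KE uV] := simplex_mxP (nT TK).
have xV := osimplex_simplex uV Kx; have Kx' : K x by rewrite KE.
have [_ /(_ K TK)[Dh Ds]] := rT.
have D0 : 0 < diam K by rewrite KE; exact: diam_simplex_gt0.
have e0 : enorm (u x - PiV x) <=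
    \sum_k enorm (remainder_row (simplex_mx K) (component v) (slope x) x k).
  have E : - (u x - PiV x) =
      \row_j (interp (simplex_mx K) (component v j) x - component v j x).
    by apply/rowP => j; rewrite opprB uvx// !mxE (Pi_scalarE tT _ TK).
  by rewrite -enormN E; exact: interp_error_bound.
have e1 : opnorm (\matrix_(j, i) (Pi_grad T (component v j) i x - slope x j i)) <= s / diam K *
    \sum_k enorm (remainder_row (simplex_mx K) (component v) (slope x) x k).
  have -> : \matrix_(j, i) (Pi_grad T (component v j) i x - slope x j i) =
      \matrix_(j, i) (\sum_k bary_grad (simplex_mx K) i k *
        component v j (row k (simplex_mx K)) - slope x j i).
    by apply/matrixP => j i; rewrite !mxE (Pi_gradE tT _ _ TK Kx).
  apply: slope_error_bound => // w k w1; rewrite ler_pdivlMr//.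
  have := bary_grad_inradius k uV w1; rewrite -KE => Bi.
  apply: le_trans (ler_wpM2l (normr_ge0 _) Ds) _.
  by rewrite mulrCA ler_piMr// ltW.
have av0 k : (0 <= average K k x)%E.
  apply: segment_average_ge0 => y; rewrite /patch; case: ifP => // _.
  exact: weak_D2_norm_ge0.
(* An infinite average makes both bounds trivial; otherwise all terms are real numbers. *)
have [inf|fin] := eqVneq (\sum_k average K k x)%E +oo%E.
  by split=> //; [exact: uvx|..]; rewrite inf gt0_muley ?leey// lte_fin ?exprn_gt0 ?mulr_gt0.
have avfin k : average K k x \is a fin_num.
  rewrite ge0_fin_numE// ltey; apply: contra fin => /eqP ak.
  by rewrite (bigD1 k)//= ak addye// gt_eqF// (lt_le_trans ltNy0)// sume_ge0.
pose r k := fine (average K k x).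
have rE k : average K k x = (r k)%:E by rewrite fineK.
have r0 k : 0 <= r k by exact: fine_ge0.
have Rr k : enorm (remainder_row (simplex_mx K) (component v) (slope x) x k) <= diam K ^+ 2 * r k.
  by have := Rx K TK Kx k; rewrite rE -EFinM lee_fin.
have sR : \sum_k enorm (remainder_row (simplex_mx K) (component v) (slope x) x k) <=
    diam K ^+ 2 * \sum_k r k.
  by rewrite mulr_sumr; apply: ler_sum => k _.
have sr0 : 0 <= \sum_k r k by exact: sumr_ge0.
have -> : (\sum_k average K k x = (\sum_k r k)%:E)%E.
  by rewrite -sumEFin; apply: eq_bigr => k _.
split=> //; first exact: uvx.
- rewrite -EFinM lee_fin; apply: le_trans e0 _; apply: le_trans sR _.
  by rewrite ler_wpM2r// lerXn2r ?nnegrE ?(ltW D0) ?(ltW h0).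
- rewrite -EFinM lee_fin; apply: le_trans e1 _.
  apply: (@le_trans _ _ (s / diam K * (diam K ^+ 2 * \sum_k r k))).
    by rewrite ler_wpM2l// divr_ge0// ltW.
  rewrite expr2 !mulrA divfK ?gt_eqF// ler_wpM2r// ler_wpM2l//; exact: ltW.
Qed.

End pointwise_estimates.

(** * The estimates in L^q and in L^oo *)

Section interpolation_estimates.
Context {R : realType} {n M : nat}.
Local Notation mu := (lebesgue_rV R n).
Variables (Omega : set 'rV[R]_n) (T : set (set 'rV[R]_n)) (s h : R).
Hypotheses (n2 : (2 <= n)%N) (pO : polyhedral Omega).
Hypotheses (s0 : 0 < s) (h0 : 0 < h) (rT : regular_triangulation Omega T s h).
Implicit Types u v : 'rV[R]_n -> 'rV[R]_M.

Let n0 : (0 < n)%N. Proof. exact: leq_trans n2. Qed.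
Let oO : open Omega. Proof. by case: pO. Qed.
Let bO : bounded_set Omega. Proof. by case: pO. Qed.
Let iO : Omega = interior (closure Omega). Proof. by case: pO. Qed.
Let tT : triangulation Omega T. Proof. by case: rT. Qed.
Let finT : finite_set T. Proof. by case: tT. Qed.
Let mO : measurable Omega. Proof. exact: open_measurable_rV. Qed.
Let muO : (mu Omega < +oo)%E. Proof. exact: bounded_lebesgue_rV_lty. Qed.

Lemma opnormN (A : 'M[R]_(M, n)) : opnorm (- A) = opnorm A.
Proof.
apply/eqP; rewrite eq_le; apply/andP; split; apply: opnorm_le => w w1.
  by rewrite mulNmx enormN opnorm_ub.
by have := opnorm_ub (- A) w1; rewrite mulNmx enormN.
Qed.

Lemma ler_norm_sqrt_sum3 (F : 'I_M -> 'I_n -> 'I_n -> R) j i k :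
  `|F j i k| <= Num.sqrt (\sum_j \sum_i \sum_k F j i k ^+ 2).
Proof.
have F0 a b c : 0 <= F a b c ^+ 2 by exact: sqr_ge0.
rewrite -sqrtr_sqr; apply: ler_wsqrtr.
rewrite (bigD1 j)//= (bigD1 i)//= (bigD1 k)//= -!addrA lerDl.
apply: addr_ge0; first exact: sumr_ge0.
apply: addr_ge0; first by apply: sumr_ge0 => b _; exact: sumr_ge0.
by apply: sumr_ge0 => a _; apply: sumr_ge0 => b _; exact: sumr_ge0.
Qed.

Lemma weak_D2_norm_coord u x j i k :
  `|weakD Omega [:: i; k] (component u j) x| <= weak_D2_norm Omega u x.
Proof.
exact: (ler_norm_sqrt_sum3 (fun j i k => weakD Omega [:: i; k] (component u j) x)).
Qed.

(** Supplies the integrability of each second derivative from a bound on their joint norm; used with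
    [1 + |D^2 u| ^ q] in the L^q case and with a constant in the L^oo case. *)
Lemma integrable_bounded_D2 u (B : 'rV[R]_n -> R) : has_weakD Omega 2 u ->
  mu.-integrable Omega (EFin \o B) ->
  {ae mu, forall x, Omega x -> weak_D2_norm Omega u x <= B x} ->
  forall j i k, mu.-integrable Omega (EFin \o weakD Omega [:: i; k] (component u j)).
Proof.
move=> wd2 /integrableP[mB Boo] uB j i k.
have [_ [mH _] _] : weak_derivative Omega [:: i; k] (component u j)
  (weakD Omega [:: i; k] (component u j)) by apply: weakDP; exact: wd2.
apply/integrableP; split; first exact/measurable_EFinP.
apply: le_lt_trans Boo; rewrite integral_mkcond [leRHS]integral_mkcond.
apply: le_integral_ae.
- by move=> x; rewrite /patch; case: ifP.
- by move=> x; rewrite /patch; case: ifP.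
- apply/(measurable_restrictT _ _).1; [exact: mO|exact: measurableT_comp].
apply: filterS uB => x Hx; rewrite /patch; case: ifPn => // /set_mem Ox.
rewrite /= lee_fin; apply: le_trans (weak_D2_norm_coord u x j i k) _.
exact: le_trans (Hx Ox) (ler_norm _).
Qed.

Lemma weak_jacobianB_Pi u v : has_weakD Omega 1 u ->
  (forall j, {within closure Omega, continuous (component v j)}) ->
  has_weakD Omega 1 (fun x => u x - PiV Omega T v x)%R /\
  {ae mu, forall x, Omega x -> weak_jacobian Omega (fun x => u x - PiV Omega T v x)%R x =
    - \matrix_(j, i) (Pi_grad T (component v j) i x - weakD Omega [:: i] (component u j) x)}.
Proof.
move=> wd1 cv.
have cE j : component (fun x => u x - PiV Omega T v x)%R j =
    fun x => component u j x - Pi_scalar Omega T (component v j) x.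
  by apply/funext => x; rewrite /component !mxE.
have wd j i : weak_derivative Omega [:: i] (component (fun x => u x - PiV Omega T v x)%R j)
    (fun x => weakD Omega [:: i] (component u j) x - Pi_grad T (component v j) i x).
  rewrite cE; apply: weak_derivativeB => //; first by apply: weakDP; exact: wd1.
  exact: weak_derivative_Pi.
split; first by move=> j [|i [|//]]// _; exists (fun x =>
  weakD Omega [:: i] (component u j) x - Pi_grad T (component v j) i x).
have : {ae mu, forall x, forall p : 'I_M * 'I_n, Omega x ->
    weakD Omega [:: p.2] (component (fun x => u x - PiV Omega T v x)%R p.1) x =
    weakD Omega [:: p.2] (component u p.1) x - Pi_grad T (component v p.1) p.2 x}.
  by apply: ae_countable => -[j i]; exact: weakD_ae.
apply: filterS => x Hx Ox; apply/matrixP => j i; rewrite !mxE opprB.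
exact: (Hx (j, i) Ox).
Qed.

Lemma weak_jacobian_Pi v : (forall j, {within closure Omega, continuous (component v j)}) ->
  has_weakD Omega 1 (PiV Omega T v) /\
  {ae mu, forall x, Omega x -> weak_jacobian Omega (PiV Omega T v) x =
    \matrix_(j, i) Pi_grad T (component v j) i x}.
Proof.
move=> cv.
have wd j i : weak_derivative Omega [:: i] (component (PiV Omega T v) j)
    (Pi_grad T (component v j) i).
  rewrite (_ : component _ j = Pi_scalar Omega T (component v j)).
    exact: weak_derivative_Pi.
  by apply/funext => x; rewrite /component mxE.
split; first by move=> j [|i [|//]]// _; exists (Pi_grad T (component v j) i).
have : {ae mu, forall x, forall p : 'I_M * 'I_n, Omega x ->
    weakD Omega [:: p.2] (component (PiV Omega T v) p.1) x = Pi_grad T (component v p.1) p.2 x}.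
  by apply: ae_countable => -[j i]; exact: weakD_ae.
apply: filterS => x Hx Ox; apply/matrixP => j i; rewrite !mxE.
exact: (Hx (j, i) Ox).
Qed.

Lemma normL_ge0 p (f : 'rV[R]_n -> R) : (0 <= normL Omega p f)%E.
Proof. exact: Lnorm_ge0. Qed.

Lemma norm2_ge0 p u : (0 <= norm2 Omega p u)%E.
Proof. by rewrite /norm2; case: ifP => // _; exact: normL_ge0. Qed.

Lemma norm1_ge0 p u : (0 <= norm1 Omega p u)%E.
Proof. by rewrite /norm1; case: ifP => // _; exact: normL_ge0. Qed.

Lemma interpolation_Lq q u v : n%:R / 2 < q -> sobolev Omega 2 q u ->
  continuous_representative Omega u v ->
  (norm0 Omega q%:E (fun x => u x - PiV Omega T v x)%R <=
     (n.+1%:R ^+ 2 * (2 - n%:R / q)^-1 * h ^+ 2)%:E * norm2 Omega q%:E u)%E /\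
  (norm1 Omega q%:E (fun x => u x - PiV Omega T v x)%R <=
     (n.+1%:R ^+ 2 * (2 - n%:R / q)^-1 * s * h)%:E * norm2 Omega q%:E u)%E.
Proof.
move=> nq Su [cv uvE].
(* Here the dimension is at least 2, so [q > n / 2] gives the [q > 1] of Hoelder's inequality. *)
have q1 : 1 < q.
  by apply: le_lt_trans nq; rewrite ler_pdivlMr// mul1r ler_nat.
have q0 : 0 < q by exact: lt_trans q1.
have wd k : (k <= 2)%N -> has_weakD Omega k u.
  move=> k2 j ds dk; have [_ /(_ ds)] := Su j.
  by rewrite dk => /(_ k2)[g gH _]; exists g.
have wd1 := wd 1%N isT; have wd2 := wd 2%N isT.
have cvj j : {within closure Omega, continuous (component v j)}.
  move=> x; exact: (@continuous_comp _ _ _ (from_subspace (closure Omega) v)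
    (fun y : 'rV[R]_M => y ord0 j) x (cv x) (@coord_continuous _ _ _ _ _ _)).
have C0 : 0 < n.+1%:R ^+ 2 * (2 - n%:R / q)^-1.
  by rewrite mulr_gt0 ?exprn_gt0// invr_gt0 subr_gt0 ltr_pdivrMr// mulrC -ltr_pdivrMr.
have [inf|fin] := eqVneq (norm2 Omega q%:E u) +oo%E.
  have Ch : 0 < n.+1%:R ^+ 2 * (2 - n%:R / q)^-1 * h ^+ 2 by rewrite mulr_gt0// exprn_gt0.
  have Cs : 0 < n.+1%:R ^+ 2 * (2 - n%:R / q)^-1 * s * h.
    by rewrite mulr_gt0// mulr_gt0.
  by rewrite inf; split; rewrite gt0_muley ?leey// lte_fin.
have n2E : norm2 Omega q%:E u = normL Omega q%:E (weak_D2_norm Omega u).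
  by rewrite /norm2 asboolT.
have mW := measurable_weak_D2_norm wd2.
have W0 x := weak_D2_norm_ge0 Omega u x.
have i1 : mu.-integrable Omega (EFin \o cst (1 : R)).
  apply: measurable_bounded_integrable => //; exists 1; split => // B B1 x _.
  by rewrite /= normr1 ltW.
have i2 : mu.-integrable Omega (EFin \o (fun x => weak_D2_norm Omega u x `^ q)).
  apply/integrableP; split.
    by apply/measurable_EFinP; apply: (measurableT_comp (measurable_powR q)).
  have : (norm2 Omega q%:E u `^ q < +oo)%E by apply: poweR_lty; rewrite ltey.
  rewrite n2E /normL poweR_Lnorm ?gt_eqF//; apply: le_lt_trans.
  rewrite [X in (X <= _)%E]integral_mkcond le_eqVlt; apply/orP; left; apply/eqP.
  apply: eq_integral => x _; rewrite /= /patch; case: ifP => _; last by rewrite normr0 powR0// gt_eqF.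
  by rewrite !ger0_norm// powR_ge0.
(* [y <= 1 + y ^ q] for [y >= 0], and [Omega] has finite measure; so second derivatives in L^q are
   integrable. *)
have Wi : mu.-integrable Omega (EFin \o (fun x => 1 + weak_D2_norm Omega u x `^ q)).
  exact: (integrableD mO i1 i2).
have Hi : forall j i k, mu.-integrable Omega (EFin \o weakD Omega [:: i; k] (component u j)).
  apply: (integrable_bounded_D2 wd2 Wi); apply: nearW => x _.
  have [x1|x1] := leP (weak_D2_norm Omega u x) 1.
    by rewrite (le_trans x1)// lerDl powR_ge0.
  rewrite -[leLHS]powRr1//; apply: (@le_trans _ _ (weak_D2_norm Omega u x `^ q)).
    by apply: ler_powR; exact: ltW.
  by rewrite lerDr.
have PE := pointwise_error n0 oO bO iO s0 h0 rT cvj uvE wd1 wd2 Hi.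
split.
- rewrite n2E (mulrC _ (h ^+ 2)).
  apply: (normL_le_averages oO iO tT q1 nq mW W0); first exact: exprn_ge0 (ltW h0).
    by move=> x; exact: enorm_ge0.
  by apply: filterS PE => x Hx /Hx[K TK [_ _ H _]]; exists K.
- have [wdP JE] := weak_jacobianB_Pi wd1 cvj.
  rewrite n2E /norm1 asboolT// -(mulrA _ s h) (mulrC _ (s * h)).
  apply: (normL_le_averages oO iO tT q1 nq mW W0); first by rewrite mulr_ge0// ltW.
    by move=> x; exact: opnorm_ge0.
  apply: filterS (filterI PE JE) => x [Hx Jx] Ox; have [K TK [_ _ _ H]] := Hx Ox.
  by exists K => //; rewrite Jx// opnormN.
Qed.

Lemma Lnorm_oo_ge (f : 'rV[R]_n -> R) :
  {ae mu, forall x, Omega x -> (`|f x|%:E <= normL Omega +oo f)%E}.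
Proof.
rewrite /normL unlock; case: ifPn => [_|].
  apply: filterS (ess_sup_ge mu (abse \o (EFin \o (f \_ Omega)))) => x /= Hx Ox.
  by move: Hx; rewrite /patch mem_set.
(* The essential supremum norm is 0 by convention when the whole space is null, and then everything
   holds almost everywhere. *)
rewrite -leNgt => m0; exists setT; split => //.
by apply/eqP; rewrite eq_le m0/=.
Qed.

Lemma Lnorm_oo_le (f : 'rV[R]_n -> R) (y : \bar R) : (0 <= y)%E ->
  {ae mu, forall x, Omega x -> (`|f x|%:E <= y)%E} -> (normL Omega +oo f <= y)%E.
Proof.
move=> y0 fy; rewrite /normL unlock; case: ifPn => // _.
apply/ess_supP; apply: filterS fy => x Hx /=; rewrite /patch.
by case: ifPn => [/set_mem/Hx//|_]; rewrite normr0.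
Qed.

(** [u] serves as its own continuous representative. The gradient of the interpolant is that of [u]
    plus the error of [pointwise_error], where each of the [n + 1] averages is at most the essential
    supremum of the Hessian. *)
Lemma interpolation_Linf u : (forall j, {within closure Omega, continuous (component u j)}) ->
  (norm1 Omega +oo (PiV Omega T u) <=
   norm1 Omega +oo u + (n.+1%:R * s * h)%:E * norm2 Omega +oo u)%E.
Proof.
move=> cu; have C0 : 0 < n.+1%:R * s * h by rewrite !mulr_gt0.
(* If a norm on the right is infinite, including by convention when weak derivatives do not exist,
   there is nothing to prove. *)
have [inf|fin] := eqVneq (norm2 Omega +oo u) +oo%E.
  rewrite inf gt0_muley ?lte_fin// addey ?leey// gt_eqF// (lt_le_trans ltNy0)//.
  exact: norm1_ge0.
have [inf1|fin1] := eqVneq (norm1 Omega +oo u) +oo%E.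
  rewrite inf1 addye ?leey// gt_eqF// (lt_le_trans ltNy0)// mule_ge0 ?norm2_ge0//.
  by rewrite lee_fin ltW.
have wd1 : has_weakD Omega 1 u.
  by apply: contrapT => H; move: fin1; rewrite /norm1 asboolF.
have wd2 : has_weakD Omega 2 u.
  by apply: contrapT => H; move: fin; rewrite /norm2 asboolF.
have n1E : norm1 Omega +oo u = normL Omega +oo (fun x => opnorm (weak_jacobian Omega u x)).
  by rewrite /norm1 asboolT.
have n2E : norm2 Omega +oo u = normL Omega +oo (weak_D2_norm Omega u).
  by rewrite /norm2 asboolT.
have := norm2_ge0 +oo u; case E : (norm2 Omega +oo u) fin => [m| |]// _ m0.
rewrite lee_fin in m0.
have mW := measurable_weak_D2_norm wd2.
have W0 x := weak_D2_norm_ge0 Omega u x.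
have Wm : {ae mu, forall x, Omega x -> weak_D2_norm Omega u x <= m}.
  apply: filterS (Lnorm_oo_ge (weak_D2_norm Omega u)) => x Hx /Hx.
  by rewrite -n2E E lee_fin ger0_norm.
have Hi : forall j i k, mu.-integrable Omega (EFin \o weakD Omega [:: i; k] (component u j)).
  apply: (integrable_bounded_D2 (B := cst m) wd2 _ Wm).
  by apply: measurable_bounded_integrable => //; exists `|m|; split => // B Bm x _; exact: ltW.
have uu : {ae mu, forall x, Omega x -> u x = u x} by exact: nearW.
have PE := pointwise_error n0 oO bO iO s0 h0 rT cu uu wd1 wd2 Hi.
have Gm : {ae mu, forall x, forall p : 'I_(size (simplexes T)) * 'I_n.+1,
    (vertex_average (weak_D2_norm Omega u) (nth set0 (simplexes T) p.1) p.2 x <= m%:E)%E}.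
  apply: ae_countable => -[l k]; rewrite [(l, k).1]/= [(l, k).2]/=.
  set K := nth set0 (simplexes T) l.
  have TK : T K by apply/(simplexesP _ finT); exact: mem_nth.
  apply: segment_average_le_ae => //.
  - exact: (measurable_patch_simplex oO iO tT mW).
  - by move=> y; exact: patch_ge0.
  apply: filterS Wm => x Hx; rewrite /patch; case: ifPn => // /set_mem Kx.
  by apply: Hx; exact: (osimplex_sub iO tT TK).
have [wdP JE] := weak_jacobian_Pi cu.
rewrite {1}/norm1 asboolT//; apply: Lnorm_oo_le.
  by rewrite adde_ge0 ?norm1_ge0// mule_ge0 ?lee_fin// ltW.
rewrite n1E; have Jge := Lnorm_oo_ge (fun x => opnorm (weak_jacobian Omega u x)).
apply: filterS (filterI PE (filterI JE (filterI Gm Jge))) => x [Px [Jx [Gx Ux]]] Ox.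
have [K TK [_ _ _ H]] := Px Ox.
have Ks : K \in simplexes T by apply/simplexesP.
have GK k : (vertex_average (weak_D2_norm Omega u) K k x <= m%:E)%E.
  have := Gx (Ordinal (etrans (index_mem K (simplexes T)) Ks), k).
  by rewrite /= nth_index.
rewrite Jx// ger0_norm ?opnorm_ge0//.
set A := \matrix_(_, _) _; set B := \matrix_(_, _) _ in H.
have -> : A = weak_jacobian Omega u x + B.
  by apply/matrixP => j i; rewrite !mxE addrC subrK.
apply: (@le_trans _ _ ((opnorm (weak_jacobian Omega u x))%:E + (opnorm B)%:E)%E).
  by rewrite -EFinD lee_fin ler_opnormD.
apply: leeD; first by have := Ux Ox; rewrite ger0_norm ?opnorm_ge0.
apply: le_trans H _; rewrite -mulrA (mulrC _ (s * h)) (EFinM (s * h)) -muleA lee_wpmul2l//.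
  by rewrite lee_fin mulr_ge0 ?ltW.
apply: (@le_trans _ _ (\sum_(k < n.+1) m%:E)%E); first exact: lee_sum.
by rewrite sumEFin sumr_const card_ord -EFinM mulr_natl.
Qed.

End interpolation_estimates.
Lemma PiT_row (R : realType) (n M : nat) (Omega : set 'rV[R]_n) T (v : 'rV[R]_n -> 'rV[R]_M) :
  PiT Omega T v = PiV Omega T v.
Proof.
by apply/funext => x; apply/rowP => j; rewrite !mxE.
Qed.

(** Interpolation acts entry by entry, so flattening a matrix commutes with it; this reduces the
    matrix case to the vector case. *)
Lemma mxvec_PiT (R : realType) (n M1 M2 : nat) (Omega : set 'rV[R]_n) T
    (v : 'rV[R]_n -> 'M[R]_(M1, M2)) x :
  mxvec (PiT Omega T v x) = PiV Omega T (fun x => mxvec (v x)) x.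
Proof.
apply/rowP => k; case/mxvec_indexP: k => i j; rewrite mxvecE !mxE.
by congr (Pi_scalar _ _ _ x); apply/funext => y; rewrite /component mxvecE.
Qed.

Theorem theorem2p12 (R : realType) (N : nat) (hN : (2 <= N)%N) :
  (forall q : R, N%:R / 2 < q ->
    exists C : R,
    forall (Omega : set 'rV[R]_N) (T : set (set 'rV[R]_N)) (s h : R),
    polyhedral Omega -> 0 < s -> 0 < h -> regular_triangulation Omega T s h ->
    (forall (M1 : nat) (u v : 'rV[R]_N -> 'rV[R]_M1), (0 < M1)%N ->
      sobolev Omega 2 q u -> continuous_representative Omega u v ->
      (norm0 Omega q%:E (fun x => u x - PiT Omega T v x)%R
         <= (C * h ^+ 2)%:E * norm2 Omega q%:E u)%E /\
      (norm1 Omega q%:E (fun x => u x - PiT Omega T v x)%R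
         <= (C * s * h)%:E * norm2 Omega q%:E u)%E) /\
    (forall (N1 M1 : nat) (u v : 'rV[R]_N -> 'M[R]_(N1, M1)),
      (0 < N1)%N -> (0 < M1)%N ->
      sobolev Omega 2 q (fun x => mxvec (u x)) ->
      continuous_representative Omega
        (fun x => mxvec (u x)) (fun x => mxvec (v x)) ->
      (norm0 Omega q%:E (fun x => mxvec (u x - PiT Omega T v x))%R
         <= (C * h ^+ 2)%:E * norm2 Omega q%:E (fun x => mxvec (u x)))%E /\
      (norm1 Omega q%:E (fun x => mxvec (u x - PiT Omega T v x))%R
         <= (C * s * h)%:E * norm2 Omega q%:E (fun x => mxvec (u x)))%E)) /\
  (forall s : R, 0 < s ->
    exists C : R,
    forall (Omega : set 'rV[R]_N) (T : set (set 'rV[R]_N)) (h : R),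
    polyhedral Omega -> 0 < h -> regular_triangulation Omega T s h ->
    (forall (M1 : nat) (u : 'rV[R]_N -> 'rV[R]_M1), (0 < M1)%N ->
      C2_closure_vec Omega u ->
      (norm1 Omega +oo (PiT Omega T u)
         <= norm1 Omega +oo u + (C * h)%:E * norm2 Omega +oo u)%E) /\
    (forall (N1 M1 : nat) (u : 'rV[R]_N -> 'M[R]_(N1, M1)),
      (0 < N1)%N -> (0 < M1)%N ->
      C2_closure_vec Omega (fun x => mxvec (u x)) ->
      (norm1 Omega +oo (fun x => mxvec (PiT Omega T u x))
         <= norm1 Omega +oo (fun x => mxvec (u x))
            + (C * h)%:E * norm2 Omega +oo (fun x => mxvec (u x)))%E)).
Proof.
split=> [q nq|s s0].
  (* The constant of [c0] in [normL_le_averages]; it depends on [N] and [q] only. *)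
  exists (N.+1%:R ^+ 2 * (2 - N%:R / q)^-1) => Omega T s h pO s0 h0 rT; split.
    move=> M u v _ Su uv; rewrite PiT_row; exact: interpolation_Lq.
  move=> M1 M u v _ _ Su uv.
  have E : (fun x => mxvec (u x - PiT Omega T v x)) =
      (fun x => mxvec (u x) - PiV Omega T (fun x => mxvec (v x)) x).
    by apply/funext => x; rewrite linearB/= mxvec_PiT.
  by rewrite E; exact: interpolation_Lq.
(* One term [s * h] for each of the [N + 1] vertices. *)
exists (N.+1%:R * s) => Omega T h pO h0 rT; split.
  move=> M u _ Cu; rewrite PiT_row; apply: interpolation_Linf => // j.
  by case: (Cu j).
move=> M1 M u _ _ Cu.
have E : (fun x => mxvec (PiT Omega T u x)) = PiV Omega T (fun x => mxvec (u x)).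
  by apply/funext => x; rewrite mxvec_PiT.
rewrite E; apply: interpolation_Linf => // j.
by case: (Cu j).
Qed.
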